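(* Let $\Gamma$ be an additive subgroup of $\mathbb{F}^4$ satisfying condition (A) of the context, let $J=J_1\times J_2\times J_3\times J_4$ with each $J_p\in\{\{0\},\mathbb{N}\}$, and let $\mathcal{B}=\mathcal{B}(\Gamma,J)$ be the associated simple Lie algebra of Xu type. Then the Lie algebra $\mathrm{Der}\,\mathcal{B}$ of all derivations of $\mathcal{B}$ is spanned (over $\mathbb{F}$) by the inner derivations $\mathrm{ad}_{\mathcal{B}}$, the space $\mathrm{Hom}^*_{\mathbb{Z}}(\mathcal{B},\mathbb{F})$ (embedded via $\mu\mapsto d_\mu$), and the derivations $\partial_{t_p}$, $d_p$ for $p=1,2,3,4$, and $\bar d_2$.
   Context: $\mathbb{F}$ is an algebraically closed field of characteristic $0$; all vector spaces are over $\mathbb{F}$; $\mathbb{N}=\{0,1,2,\dots\}$. For $a\in\mathbb{F}$ and $p\in\{1,2,3,4\}$, $a_{[p]}\in\mathbb{F}^4$ denotes the vector with $a$ in position $p$ and $0$ elsewhere. Elements of $\mathbb{F}^4$ are written $\alpha=(\alpha_1,\alpha_2,\alpha_3,\alpha_4)$. Condition (A) on the additive subgroup $\Gamma\subseteq\mathbb{F}^4$: $\sigma:=(1,0,1,0)\in\Gamma$; $\Gamma\cap\mathbb{F}1_{[p]}\neq\{0\}$ for $p=1,2,3,4$; and $\Gamma\cap(1_{[q]}+\mathbb{F}1_{[q+1]})\neq\emptyset$ for $q=1,3$. Elements of $J$ are written $\mathbf{i}=(i_1,i_2,i_3,i_4)$. $\mathcal{A}_4=\mathcal{A}_4(\Gamma,J)$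 is the commutative associative semigroup algebra of $\Gamma\times J$ with basis $\{x^{\alpha,\mathbf{i}}\mid(\alpha,\mathbf{i})\in\Gamma\times J\}$ and product $x^{\alpha,\mathbf{i}}\cdot x^{\beta,\mathbf{j}}=x^{\alpha+\beta,\mathbf{i}+\mathbf{j}}$. Write $x^\alpha=x^{\alpha,0}$ and $1=x^{0,0}$. Convention: any technically appearing but undefined expression (e.g. $x^{\alpha,\mathbf{i}}$ with $\mathbf{i}\notin J$ because some $i_p<0$, or $x^\alpha$ with $\alpha\notin\Gamma$) is treated as zero. For $p=1,\dots,4$ let $\partial_p$ be the derivation of $\mathcal{A}_4$ with $\partial_p(x^{\alpha,\mathbf{i}})=\alpha_px^{\alpha,\mathbf{i}}+i_px^{\alpha,\mathbf{i}-1_{[p]}}$. The Lie bracket on $\mathcal{A}_4$ is $$[u,v]=x^{\sigma}\big(\partial_1(u)\partial_2(v)-\partial_1(v)\partial_2(u)\big)+(u+\partial_3(u))\partial_4(v)-(v+\partial_3(v))\partial_4(u).$$ Put $\sigma_1=-1_{[3]}=(0,0,-1,0)$ and $\sigma_2=1_{[1]}-2_{[3]}=(1,0,-2,0)$, with $x^{\sigma_i}$ treated as $0$ if $\sigma_i\notin\Gamma$. The element $x^{\sigma_1}$ is central; let $\mathcal{B}_4=\mathcal{A}_4/\mathbb{F}x^{\sigma_1}$ with the induced bracket, and write $x^{\alpha,\mathbf{i}}$ also for its image in $\mathcal{B}_4$ (so $x^{\sigma_1}=0$). The Lie algebra of Xu type is $\mathcal{B}=\mathcal{B}(\Gamma,J)=[\mathcal{B}_4,\mathcal{B}_4]$;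 it is simple, and equals $\mathcal{B}_4$ if $J\neq\{0\}$ or $\sigma_2\notin\Gamma$. With $\Gamma^\#=\Gamma$ if $J\neq\{0\}$ and $\Gamma^\#=\Gamma\setminus\{\sigma_1,\sigma_2\}$ if $J=\{0\}$, a basis of $\mathcal{B}$ is $\{x^{\alpha,\mathbf{i}}\mid(\alpha,\mathbf{i})\in\Gamma^\#\times J,\ (\alpha,\mathbf{i})\neq(\sigma_1,0)\}$. Derivations of $\mathcal{B}$: - $\mathrm{ad}_{\mathcal{B}}=\{\mathrm{ad}_u\mid u\in\mathcal{B}\}$, $\mathrm{ad}_u(v)=[u,v]$. - $\mathrm{Hom}^*_{\mathbb{Z}}(\mathcal{B},\mathbb{F})$ denotes the space of additive functions $\mu:\Gamma\to\mathbb{F}$ with $\mu(\sigma)=0$; each $\mu$ is identified with the derivation $d_\mu(x^{\alpha,\mathbf{i}})=\mu(\alpha)x^{\alpha,\mathbf{i}}$. - $\partial_{t_p}(x^{\alpha,\mathbf{i}})=i_px^{\alpha,\mathbf{i}-1_{[p]}}$ for $p=1,2,3,4$ (so $\partial_{t_p}=0$ if $J_p=\{0\}$). - For $p=1,2,3,4$: if $\sigma_1\in\Gamma$ and $J_p=\{0\}$, then $d_p$ is the derivation of $\mathcal{B}$ given by $d_1(x^{\beta,\mathbf{j}})=\beta_2x^{\beta+1_{[1]},\mathbf{j}}+j_2x^{\beta+1_{[1]},\mathbf{j}-1_{[2]}}$, $d_2(x^{\beta,\mathbf{j}})=-\beta_1x^{\beta+1_{[1]},\mathbf{j}}-j_1x^{\beta+1_{[1]},\mathbf{j}-1_{[1]}}$,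 $d_3(x^{\beta,\mathbf{j}})=\beta_4x^{\beta-1_{[3]},\mathbf{j}}+j_4x^{\beta-1_{[3]},\mathbf{j}-1_{[4]}}$, $d_4(x^{\beta,\mathbf{j}})=-(\beta_3+1)x^{\beta-1_{[3]},\mathbf{j}}-j_3x^{\beta-1_{[3]},\mathbf{j}-1_{[3]}}$; if $\sigma_1\notin\Gamma$ or $J_p\neq\{0\}$, set $d_p=0$. - If $J=\{0\}$ and $\sigma_2\in\Gamma$, then $\bar d_2=\mathrm{ad}_{x^{\sigma_2}}|_{\mathcal{B}}$, i.e. $\bar d_2(x^\beta)=\beta_2x^{\beta+2_{[1]}-1_{[3]}}-\beta_4x^{\beta+1_{[1]}-2_{[3]}}$; otherwise $\bar d_2=0$. *)

(* Defs.v *)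
From HB Require Import structures.
From mathcomp Require Import all_boot all_order all_algebra.
From mathcomp Require Import generic_quotient ring_quotient.
From mathcomp Require Import boolp classical_sets functions.
From mathcomp Require Import finmap.
From mathcomp.multinomials Require Import monalg.

Set Implicit Arguments.
Unset Strict Implicit.
Unset Printing Implicit Defensive.

Import GRing.Theory.
Local Open Scope ring_scope.
Local Open Scope classical_set_scope.
Local Open Scope quotient_scope.

Section Span.
Variables (F : fieldType) (V : lmodType F).

Definition lspan (S : set V) : set V :=
  [set v | exists (n : nat) (c : 'I_n -> F) (w : 'I_n -> V),
     (forall i, S (w i)) /\ v = \sum_i c i *: w i].

Lemma lspan_sub (S : set V) : S `<=` lspan S.
Proof.
move=> v Sv; exists 1%N, (fun=> 1), (fun=> v); split=> //.
by rewrite big_ord1 scale1r.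
Qed.

Lemma lspan_submod (S : set V) : submod_closed [pred v | `[< lspan S v >]].
Proof.
split=> [|a u v].
  by apply/asboolP; exists 0%N, (fun=> 0), (fun=> 0); split; [case|rewrite big_ord0].
move=> /asboolP[m [c [w [Sw ->]]]] /asboolP[n [d [z [Sz ->]]]].
apply/asboolP; exists (m + n)%N.
exists (fun i => match fintype.split i with inl j => a * c j | inr j => d j end).
exists (fun i => match fintype.split i with inl j => w j | inr j => z j end).
split=> [i|]; first by case: (fintype.split i).
rewrite big_split_ord /= scaler_sumr; congr (_ + _); apply: eq_bigr => i _.
  by rewrite -[lshift n i]/(unsplit (inl i)) unsplitK scalerA.
by rewrite -[rshift m i]/(unsplit (inr i)) unsplitK.
Qed.

End Span.

Definition pos1 : 'I_4 := @Ordinal 4 0 isT.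
Definition pos2 : 'I_4 := @Ordinal 4 1 isT.
Definition pos3 : 'I_4 := @Ordinal 4 2 isT.
Definition pos4 : 'I_4 := @Ordinal 4 3 isT.

(* [at_pos a p] is the vector a_[p] of F^4. *)
Definition at_pos (F : fieldType) (a : F) (p : 'I_4) : 'rV[F]_4 :=
  a *: delta_mx 0 p.

Section Vectors.
Variable F : fieldType.
Definition sigma : 'rV[F]_4 := at_pos 1 pos1 + at_pos 1 pos3.
Definition sigma1 : 'rV[F]_4 := - at_pos 1 pos3.
Definition sigma2 : 'rV[F]_4 := at_pos 1 pos1 - at_pos 2 pos3.
End Vectors.
Arguments sigma {F}.
Arguments sigma1 {F}.
Arguments sigma2 {F}.

Definition condA (F : fieldType) (Gam : zmodClosed 'rV[F]_4) : Prop :=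
  [/\ sigma \in Gam,
      forall p, exists2 a : F, a != 0 & at_pos a p \in Gam,
      exists a : F, at_pos 1 pos1 + at_pos a pos2 \in Gam
    & exists a : F, at_pos 1 pos3 + at_pos a pos4 \in Gam].

Section Algebra.
Variables (F : fieldType) (Gam : zmodClosed 'rV[F]_4) (J : 'I_4 -> set nat).

Definition Jprod : set 'rV[nat]_4 := [set i | forall p, J p (i 0 p)].

Definition in_idx : pred ('rV[F]_4 * 'rV[nat]_4) :=
  fun k => (k.1 \in Gam) && `[< Jprod k.2 >].
Definition idx := {k : 'rV[F]_4 * 'rV[nat]_4 | in_idx k}.

(* Finitely supported functions on Gam x J.  The multiplication of [malg] is
   not available here, since [monomType] excludes invertible monomials. *)
Definition A4 := {malg F[idx]}.
HB.instance Definition _ := GRing.Zmodule.on A4.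

End Algebra.

(* The scaling of [malg], locked so that unification does not unfold it. *)
HB.lock Definition scaleA (F : fieldType) (Gam : zmodClosed 'rV[F]_4)
    (J : 'I_4 -> set nat) (c : F) (u : A4 Gam J) : A4 Gam J :=
  c *: (u : {malg F[idx Gam J]}).

Section ScaleA.
Variables (F : fieldType) (Gam : zmodClosed 'rV[F]_4) (J : 'I_4 -> set nat).
Local Notation A4 := (A4 Gam J).
Local Notation scaleA := (@scaleA F Gam J).

Fact scaleAA (a b : F) (u : A4) : scaleA a (scaleA b u) = scaleA (a * b) u.
Proof. by rewrite scaleA.unlock scalerA. Qed.
Fact scale1A : left_id 1 scaleA.
Proof. by move=> u; rewrite scaleA.unlock scale1r. Qed.
Fact scaleADr : right_distributive scaleA +%R.
Proof. by move=> a u v; rewrite scaleA.unlock scalerDr. Qed.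
Fact scaleADl (u : A4) : {morph scaleA^~ u : a b / a + b}.
Proof. by move=> a b; rewrite scaleA.unlock scalerDl. Qed.

HB.instance Definition _ :=
  GRing.Zmodule_isLmodule.Build F A4 scaleAA scale1A scaleADr scaleADl.

Lemma scaleAE (c : F) (u : A4) : c *: u = c *: (u : {malg F[idx Gam J]}) :> A4.
Proof. by rewrite -[LHS]/(scaleA c u) scaleA.unlock. Qed.
End ScaleA.

(* x^{a,i}, zero when (a,i) is not in Gam x J. *)
HB.lock Definition xm (F : fieldType) (Gam : zmodClosed 'rV[F]_4)
    (J : 'I_4 -> set nat) (a : 'rV[F]_4) (i : 'rV[nat]_4) : A4 Gam J :=
  if insub (a, i) is Some k then mkmalgU (k : idx Gam J) (1 : F) else 0.

HB.lock Definition lin_ext (F : fieldType) (Gam : zmodClosed 'rV[F]_4)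
    (J : 'I_4 -> set nat) (V : lmodType F)
    (f : 'rV[F]_4 -> 'rV[nat]_4 -> V) (u : A4 Gam J) : V :=
  \sum_(k <- msupp u) mcoeff k u *: f (val k).1 (val k).2.

Section XuType.
Variables (F : fieldType) (Gam : zmodClosed 'rV[F]_4) (J : 'I_4 -> set nat).
Local Notation idx := (idx Gam J).
Local Notation A4 := (A4 Gam J).
Local Notation Jprod := (Jprod J).
Local Notation in_idx := (in_idx Gam J).
Local Notation xm := (@xm F Gam J).
Local Notation lin_ext := (@lin_ext F Gam J _).

Definition mulA (u v : A4) : A4 :=
  lin_ext (fun a i => lin_ext (fun b j => xm (a + b) (i + j)) v) u.

(* i - 1_[p]; the truncation at i_p = 0 is harmless, because this only occurs
   with coefficient i_p. *)
Definition dec (i : 'rV[nat]_4) (p : 'I_4) : 'rV[nat]_4 :=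
  \row_q (i 0%R q - (q == p))%N.

Definition del (p : 'I_4) : A4 -> A4 :=
  lin_ext (fun a i => a 0 p *: xm a i + (i 0 p)%:R *: xm a (dec i p)).

Definition brA (u v : A4) : A4 :=
  mulA (xm sigma 0) (mulA (del pos1 u) (del pos2 v) - mulA (del pos1 v) (del pos2 u))
  + mulA (u + del pos3 u) (del pos4 v) - mulA (v + del pos3 v) (del pos4 u).

Lemma lin_extE (V : lmodType F) (f : 'rV[F]_4 -> 'rV[nat]_4 -> V) (u : A4) :
  lin_ext f u = \sum_(k <- msupp u) mcoeff k u *: f (val k).1 (val k).2.
Proof. by rewrite lin_ext.unlock. Qed.

Lemma lin_ext_is_linear (V : lmodType F) (f : 'rV[F]_4 -> 'rV[nat]_4 -> V) :
  linear (lin_ext f).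
Proof.
have wide (D : {fset idx}) (u : A4) : fsubset (msupp u) D ->
    lin_ext f u = \sum_(k <- D) mcoeff k u *: f (val k).1 (val k).2.
  move=> uD; rewrite lin_extE; apply: big_fset_incl => // k _.
  by move=> /mcoeff_outdom ->; rewrite scale0r.
move=> c u v; pose D := fsetU (msupp u) (msupp v).
rewrite !(wide D) ?fsubsetUl ?fsubsetUr //.
  rewrite scaler_sumr -big_split /=; apply: eq_bigr => k _.
  by rewrite scaleAE mcoeffD mcoeffZ scalerDl scalerA.
apply: fsubset_trans (msuppD_le _ _) _.
by rewrite scaleAE fsetUSS // msuppZ_le.
Qed.
HB.instance Definition _ (V : lmodType F) (f : 'rV[F]_4 -> 'rV[nat]_4 -> V) :=
  GRing.isLinear.Build F A4 V *:%R (lin_ext f) (@lin_ext_is_linear V f).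

Lemma lin_ext_xm (V : lmodType F) (f : 'rV[F]_4 -> 'rV[nat]_4 -> V) a i :
  lin_ext f (xm a i) = if in_idx (a, i) then f a i else 0.
Proof.
rewrite xm.unlock; case: insubP => [k -> kE|/negbTE->]; last exact: raddf0.
by rewrite lin_extE msuppU oner_eq0 big_seq_fset1 mcoeffUU scale1r kE.
Qed.

Lemma mulA_linear_l v : linear (mulA^~ v).
Proof. by move=> c u w; exact: linearP. Qed.

Lemma mulA_linear_r u : linear (mulA u).
Proof.
move=> c v w; pose g (k : idx) := lin_ext (fun b j => xm ((val k).1 + b) ((val k).2 + j)).
have mulE x : mulA u x = \sum_(k <- msupp u) mcoeff k u *: g k x.
  exact: lin_extE.
rewrite !mulE scaler_sumr -big_split /=; apply: eq_bigr => k _.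
by rewrite /g linearP scalerDr !scalerA mulrC.
Qed.
HB.instance Definition _ u :=
  GRing.isLinear.Build F A4 A4 *:%R (mulA u) (mulA_linear_r u).

Lemma mulA_xm a i b j :
  in_idx (a, i) -> in_idx (b, j) -> mulA (xm a i) (xm b j) = xm (a + b) (i + j).
Proof. by move=> ha hb; rewrite /mulA lin_ext_xm ha lin_ext_xm hb. Qed.

Lemma del_is_linear p : linear (del p).
Proof. exact: lin_ext_is_linear. Qed.
HB.instance Definition _ p :=
  GRing.isLinear.Build F A4 A4 *:%R (del p) (del_is_linear p).

Lemma brA_linear_l v : linear (brA^~ v).
Proof.
suff gen (V : lmodType F) (m : V -> V -> V) (d : 'I_4 -> V -> V) (s x : V) :
    (forall y, linear (m^~ y)) -> (forall y, linear (m y)) ->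
    (forall p, linear (d p)) ->
    linear (fun u => m s (m (d pos1 u) (d pos2 x) - m (d pos1 x) (d pos2 u))
       + m (u + d pos3 u) (d pos4 x) - m (x + d pos3 x) (d pos4 u)).
  apply: gen; [exact: mulA_linear_l|exact: mulA_linear_r|exact: del_is_linear].
move=> mL mR dL c u w; rewrite !dL.
have addL (a a' b b' : V) :
    (c *: a + a') + (c *: b + b') = c *: (a + b) + (a' + b').
  by rewrite addrACA scalerDr.
have subL (a a' b b' : V) :
    (c *: a + a') - (c *: b + b') = c *: (a - b) + (a' - b').
  by rewrite opprD addrACA scalerBr.
by rewrite addL !mL !mR subL mR addL subL.
Qed.

Lemma brA_anti u v : brA u v = - brA v u.
Proof.
suff gen (V : lmodType F) (m : V -> V -> V) (d : 'I_4 -> V -> V) (s x y : V) :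
    (forall z, linear (m z)) ->
    m s (m (d pos1 x) (d pos2 y) - m (d pos1 y) (d pos2 x))
       + m (x + d pos3 x) (d pos4 y) - m (y + d pos3 y) (d pos4 x)
    = - (m s (m (d pos1 y) (d pos2 x) - m (d pos1 x) (d pos2 y))
       + m (y + d pos3 y) (d pos4 x) - m (x + d pos3 x) (d pos4 y)).
  by apply: gen; exact: mulA_linear_r.
move=> mR.
have mN (a b : V) : m s (a - b) = - m s (b - a).
  have m0 : m s 0 = 0 by have := mR s (-1) s s; rewrite !scaleN1r !addNr.
  by have := mR s (-1) (b - a) 0; rewrite !scaleN1r m0 !addr0 opprB.
by rewrite mN !opprD opprK addrAC -!addrA; congr (_ + _); rewrite addrC.
Qed.

Lemma row0 p : ((0%R : 'rV[nat]_4) 0%R p)%:R = 0 :> F.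
Proof. by rewrite mxE. Qed.

Lemma del_sigma1 p :
  del p (xm sigma1 0) = (sigma1 : 'rV[F]_4) 0 p *: xm sigma1 0.
Proof.
rewrite /del lin_ext_xm row0 scale0r addr0.
case: ifP => // h; rewrite xm.unlock insubN ?scaler0 //; exact/negbT.
Qed.

Lemma sigma1E p : (sigma1 : 'rV[F]_4) 0 p = - (p == pos3)%:R.
Proof. by rewrite !mxE eqxx mul1r. Qed.

Lemma brA_sigma1 v : brA (xm sigma1 0) v = 0.
Proof.
have d1 : del pos1 (xm sigma1 0) = 0 by rewrite del_sigma1 sigma1E oppr0 scale0r.
have d2 : del pos2 (xm sigma1 0) = 0 by rewrite del_sigma1 sigma1E oppr0 scale0r.
have d4 : del pos4 (xm sigma1 0) = 0 by rewrite del_sigma1 sigma1E oppr0 scale0r.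
have d3 : xm sigma1 0 + del pos3 (xm sigma1 0) = 0.
  by rewrite del_sigma1 sigma1E eqxx scaleN1r subrr.
have m0l x : mulA 0 x = 0 by exact: (raddf0 (lin_ext _)).
have m0r x : mulA x 0 = 0 by exact: (raddf0 (mulA x)).
rewrite /brA d1 d2 d3 d4 (m0l (del pos2 v)) (m0r (del pos1 v)) subrr.
by rewrite (m0r (xm sigma 0)) (m0l (del pos4 v)) (m0r (v + del pos3 v)) addr0 subrr.
Qed.

Definition line_sigma1 : {pred A4} :=
  [pred u | `[< exists c : F, u = c *: xm sigma1 0 >]].

Lemma line_sigma1_submod : submod_closed line_sigma1.
Proof.
split=> [|a u v]; first by apply/asboolP; exists 0; rewrite scale0r.
move=> /asboolP[c ->] /asboolP[d ->]; apply/asboolP; exists (a * c + d).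
by rewrite scalerDl scalerA.
Qed.

HB.instance Definition _ :=
  GRing.isSubmodClosed.Build F A4 line_sigma1 line_sigma1_submod.

Definition B4 := Quotient.quot line_sigma1.
HB.instance Definition _ := GRing.Zmodule.on B4.

Definition piB (u : A4) : B4 := \pi_B4 u.

Lemma piB_repr (w : B4) : piB (repr w) = w.
Proof. exact: reprK. Qed.

Lemma piBB (u v : A4) : piB (u - v) = piB u - piB v.
Proof. exact: raddfB. Qed.

Lemma piB_eq (u v : A4) : piB u = piB v <-> exists c : F, u - v = c *: xm sigma1 0.
Proof.
split=> [/eqP|h]; first by rewrite /piB -Quotient.idealrBE => /asboolP.
by apply/eqP; rewrite /piB -Quotient.idealrBE; apply/asboolP.
Qed.

Definition scaleB (c : F) (w : B4) : B4 := piB (c *: repr w).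

Lemma scaleB_pi (c : F) (u : A4) : scaleB c (piB u) = piB (c *: u).
Proof.
have /piB_eq[d e] := piB_repr (piB u).
by apply/piB_eq; exists (c * d); rewrite -scalerA -e scalerBr.
Qed.

Lemma piBD (u v : A4) : piB (u + v) = piB u + piB v.
Proof. exact: raddfD. Qed.

Fact scaleBA (a b : F) (w : B4) : scaleB a (scaleB b w) = scaleB (a * b) w.
Proof. by rewrite -[w]piB_repr !scaleB_pi scalerA. Qed.
Fact scale1B : left_id 1 scaleB.
Proof. by move=> w; rewrite -[w]piB_repr scaleB_pi scale1r. Qed.
Fact scaleBDr : right_distributive scaleB +%R.
Proof.
by move=> a v w; rewrite -[v]piB_repr -[w]piB_repr -piBD !scaleB_pi scalerDr piBD.
Qed.
Fact scaleBDl (w : B4) : {morph scaleB^~ w : a b / a + b}.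
Proof. by move=> a b; rewrite -[w]piB_repr !scaleB_pi scalerDl piBD. Qed.

HB.instance Definition _ :=
  GRing.Zmodule_isLmodule.Build F B4 scaleBA scale1B scaleBDr scaleBDl.

Lemma piB_is_linear : linear piB.
Proof. by move=> c u v; rewrite piBD -scaleB_pi. Qed.
HB.instance Definition _ := GRing.isLinear.Build F A4 B4 *:%R piB piB_is_linear.

Definition brB4 (v w : B4) : B4 := piB (brA (repr v) (repr w)).

Lemma brB4_pi (u v : A4) : brB4 (piB u) (piB v) = piB (brA u v).
Proof.
have inv_l x y : brA (repr (piB x)) y = brA x y.
  have /piB_eq[c e] := piB_repr (piB x).
  have -> : repr (piB x) = c *: xm sigma1 0 + x by rewrite -e subrK.
  by rewrite brA_linear_l brA_sigma1 scaler0 add0r.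
by rewrite /brB4 inv_l brA_anti inv_l -brA_anti.
Qed.

Definition descend (T : A4 -> A4) (w : B4) : B4 := piB (T (repr w)).

(* [descend T] is the induced map on the quotient as soon as T is linear and
   preserves the line F x^sigma1. *)
Lemma descend_pi (T : {linear A4 -> A4}) (u : A4) :
  (exists c : F, T (xm sigma1 0) = c *: xm sigma1 0) ->
  descend T (piB u) = piB (T u).
Proof.
case=> c Tc; have /piB_eq[d e] := piB_repr (piB u).
by apply/piB_eq; exists (d * c); rewrite -linearB e linearZ /= Tc scalerA.
Qed.

Definition derived : {pred B4} :=
  [pred w | `[< lspan [set z | exists u v, z = brB4 u v] w >]].

HB.instance Definition _ :=
  GRing.isSubmodClosed.Build F B4 derived (@lspan_submod F B4 _).

Record B := MkB { B_val : B4; B_prop : B_val \in derived }.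
HB.instance Definition _ := [isSub for B_val].
HB.instance Definition _ := [Choice of B by <:].
HB.instance Definition _ := [SubChoice_isSubLmodule of B by <:].

Lemma brB_subproof (v w : B) : brB4 (val v) (val w) \in derived.
Proof. by apply/asboolP/lspan_sub; exists (val v), (val w). Qed.
Definition brB (v w : B) : B := MkB (brB_subproof v w).

(* The maps T below induce derivations of B4 whenever they are used, hence
   preserve [B4, B4]: the default 0 of [insubd] is never reached. *)
Definition induced (T : A4 -> A4) (v : B) : B := insubd (0 : B) (descend T (val v)).

Definition Der : set (B -> B) :=
  [set D | linear D /\ forall u v, D (brB u v) = brB (D u) v + brB u (D v)].

Definition adB (u : B) : B -> B := brB u.

Definition homZ : set ('rV[F]_4 -> F) :=
  [set mu | {in Gam &, forall a b, mu (a + b) = mu a + mu b} /\ mu sigma = 0].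
Definition dmuA (mu : 'rV[F]_4 -> F) : A4 -> A4 :=
  lin_ext (fun a i => mu a *: xm a i).
Definition dmu (mu : 'rV[F]_4 -> F) : B -> B := induced (dmuA mu).

Definition dtA (p : 'I_4) : A4 -> A4 :=
  lin_ext (fun a i => (i 0 p)%:R *: xm a (dec i p)).
Definition dt (p : 'I_4) : B -> B := induced (dtA p).

Definition dA1 : A4 -> A4 := lin_ext (fun b j =>
  b 0 pos2 *: xm (b + at_pos 1 pos1) j
  + (j 0 pos2)%:R *: xm (b + at_pos 1 pos1) (dec j pos2)).
Definition dA2 : A4 -> A4 := lin_ext (fun b j =>
  - b 0 pos1 *: xm (b + at_pos 1 pos1) j
  - (j 0 pos1)%:R *: xm (b + at_pos 1 pos1) (dec j pos1)).
Definition dA3 : A4 -> A4 := lin_ext (fun b j =>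
  b 0 pos4 *: xm (b - at_pos 1 pos3) j
  + (j 0 pos4)%:R *: xm (b - at_pos 1 pos3) (dec j pos4)).
Definition dA4 : A4 -> A4 := lin_ext (fun b j =>
  - (b 0 pos3 + 1) *: xm (b - at_pos 1 pos3) j
  - (j 0 pos3)%:R *: xm (b - at_pos 1 pos3) (dec j pos3)).
Definition dA (p : 'I_4) : A4 -> A4 :=
  tnth [tuple dA1; dA2; dA3; dA4] p.

Lemma dmuA_sigma1 mu : dmuA mu (xm sigma1 0) = mu sigma1 *: xm sigma1 0.
Proof.
rewrite /dmuA lin_ext_xm; case: ifP => // h.
by rewrite xm.unlock insubN ?scaler0 //; exact/negbT.
Qed.

Lemma dtA_sigma1 p : dtA p (xm sigma1 0) = 0.
Proof. by rewrite /dtA lin_ext_xm row0 scale0r if_same. Qed.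

Lemma dA_sigma1 p : dA p (xm sigma1 0) = 0.
Proof.
case: p => -[|[|[|[|//]]]] lt_p; rewrite /dA (tnth_nth id) /=;
  rewrite /dA1 /dA2 /dA3 /dA4 lin_ext_xm !sigma1E !row0 /=.
- by rewrite oppr0 !scale0r addr0 if_same.
- by rewrite !oppr0 !scale0r subr0 if_same.
- by rewrite oppr0 !scale0r addr0 if_same.
by rewrite addNr oppr0 !scale0r subr0 if_same.
Qed.

Definition dd (p : 'I_4) : B -> B :=
  if `[< sigma1 \in Gam /\ J p = [set 0%N] >] then induced (dA p) else 0.

Lemma ad_sigma2_subproof (v : B) : brB4 (piB (xm sigma2 0)) (val v) \in derived.
Proof. by apply/asboolP/lspan_sub; exists (piB (xm sigma2 0)), (val v). Qed.
Definition dbar2 : B -> B :=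
  if `[< Jprod = [set 0] /\ sigma2 \in Gam >]
  then fun v => MkB (ad_sigma2_subproof v) else 0.

Definition generators : set (B -> B) :=
  range adB `|` (dmu @` homZ) `|` range dt `|` range dd `|` [set dbar2].
End XuType.

Arguments Der {F} Gam J.
Arguments generators {F} Gam J.

(* Main.v *)
From HB Require Import structures.
Require Import Defs.
From mathcomp Require Import all_boot all_algebra ring.
From mathcomp Require Import boolp classical_sets functions.
From mathcomp Require Import finmap generic_quotient.
From mathcomp.multinomials Require Import monalg.
Set Implicit Arguments.
Unset Strict Implicit.
Unset Printing Implicit Defensive.
Import GRing.Theory.
Local Open Scope ring_scope.

(** Write d1, ..., d4 for the four commuting derivations of A4, x for x^sigma and
    W for x^sigma1. Then [1, v] = d4 v, [x^(-sigma), v] = - d2 v, and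
      [x^a, x^b] = (a1 b2 - a2 b1) x^(a+b+sigma)
                   + ((a3 + 1) b4 - (b3 + 1) a4) x^(a+b).
    A derivation D of B has a linear lift E to A4, which satisfies the Leibniz
    rule on monomials up to the central line F W. Known derivations are
    subtracted from E until nothing is left ([derivation_decomposition]).

    Since d2 and d4 are inner and have primitives, E commutes with both after an
    inner correction ([commute_d2_d4]). It then preserves their weight spaces,
    so it multiplies x^a by an element P a killed by d2 and d4, and the Leibniz
    rule becomes a functional equation for P ([multipliers_eq]). Call a flat if
    a2 = a4 = 0. The equation for flat a gives P (a + b) = P b + Q a, once from
    the exponents b with b2 = 0 and once from those with b4 = 0. Comparing the
    two laws forces Q a to be a combination of x W and W, which is removed by
    the maps dA_2 and dA_4, plus a scalar nu a ([translation_form],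
    [normalise], [translation_extend]). Away from the flat exponents P is now
    additive and satisfies a symmetry condition, that is, P a = a2 p + a4 q +
    mu a with a closed pair (p, q) ([family_potentials]). A Poincare lemma
    ([poincare]) writes this as the multiplier of an inner derivation plus multiples
    of dA_1 and dA_3 and a derivation d_mu.

    Let E be corrected in this way, so that it kills the non-flat exponentials.
    An element that commutes with all of these is in F W ([center]), hence E
    kills the flat exponentials as well. By induction on the degree of t^i the
    same functional equation shows that E maps x^a t^i to k x^a with a scalar k
    independent of a ([level_scalar]); in degree 1 these scalars
    are removed by the derivations by the t_p, and in degree at least 2 they are
    zero, because t^i occurs in a bracket of monomials of smaller degree
    ([kill_higher], [kill_polynomials]).

    It remains to go back to B. Brackets reach everything except x^sigma2 when
    J = {0} ([piB_derived], [derived_cf]). So the inner correction is by an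
    element of B plus a multiple of x^sigma2, which yields dbar2 ([span_ad]);
    and the maps dA_p vanish if sigma1 is not in Gam, and are inner, given by
    W t_p, if t_p is present ([dA_inner], [span_dA]). Conversely all generators
    are derivations ([generators_Der]). *)

Local Notation "c %:K" := (in_alg _ c) (at level 2, format "c %:K").

(** * Derivations of a commutative algebra *)

Section Derivations.
Variables (F : fieldType) (A : comAlgType F).

(** Linearity over F is stated on the scalars of the ring A, because all
    computations below take place inside A. *)
Definition derivation (d : A -> A) :=
  [/\ forall u v, d (u + v) = d u + d v,
      forall u v, d (u * v) = d u * v + u * d v
    & forall c : F, d c%:K = 0].

Variables (d : A -> A) (D : derivation d).

Lemma derD u v : d (u + v) = d u + d v. Proof. by case: D. Qed.
Lemma derM u v : d (u * v) = d u * v + u * d v. Proof. by case: D. Qed.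
Lemma derK c : d c%:K = 0. Proof. by case: D. Qed.
Lemma der0 : d 0 = 0. Proof. by have := derK 0; rewrite rmorph0. Qed.
Lemma der1 : d 1 = 0. Proof. by have := derK 1; rewrite rmorph1. Qed.
Lemma derN u : d (- u) = - d u.
Proof. by apply/eqP; rewrite -addr_eq0 -derD addNr der0. Qed.
Lemma derB u v : d (u - v) = d u - d v. Proof. by rewrite derD derN. Qed.
Lemma derZ c u : d (c%:K * u) = c%:K * d u.
Proof. by rewrite derM derK mul0r add0r. Qed.

End Derivations.

Lemma scalar_inj (F : fieldType) (A : comAlgType F) (c : F) (u v : A) :
  c != 0 -> c%:K * u = c%:K * v -> u = v.
Proof.
by move=> c0 /(congr1 ( *%R c^-1%:K)); rewrite !mulrA -rmorphM mulVf // rmorph1 !mul1r.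
Qed.

Lemma scalar_eq0 (F : fieldType) (A : comAlgType F) (c : F) (u : A) :
  c != 0 -> c%:K * u = 0 -> u = 0.
Proof. by move=> c0 e; apply: (scalar_inj c0); rewrite mulr0. Qed.

(** Used with [ring]: an identity follows from one or two known ones by
    exhibiting it as their combination. *)
Lemma eq_sub1 (V : zmodType) (l r u v : V) : l = r -> u - v = l - r -> u = v.
Proof. by move=> -> e; apply: subr0_eq; rewrite e subrr. Qed.

Lemma eq_sub2 (V : zmodType) (l r l' r' u v : V) : l = r -> l' = r' ->
  u - v = (l - r) - (l' - r') -> u = v.
Proof. by move=> -> -> e; apply: subr0_eq; rewrite e !subrr. Qed.

Section Additive.
Variables (U V : zmodType) (f : U -> V) (fD : forall a b, f (a + b) = f a + f b).
Lemma addf0 : f 0 = 0.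
Proof. by apply: (@addrI _ (f 0)); rewrite -fD !addr0. Qed.
Lemma addfN a : f (- a) = - f a.
Proof. by apply/eqP; rewrite -addr_eq0 -fD addNr addf0. Qed.
Lemma addfMn a n : f (a *+ n) = f a *+ n.
Proof. by elim: n => [|n IH]; rewrite ?addf0 // !mulrS fD IH. Qed.
End Additive.

(** * The bracket on an algebra of exponentials *)

(** Here d_p multiplies the exponential X a by c_p a, sg and W stand for sigma
    and x^sigma1, and e_p is an exponent on the p-th axis. At this level of
    abstraction the identities needed are ring identities. *)
Section Xu.
Variables (F : fieldType) (char0 : [pchar F] =i pred0).
Variables (G : zmodType) (c1 c2 c3 c4 : G -> F).
Hypothesis c1D : forall a b, c1 (a + b) = c1 a + c1 b.
Hypothesis c2D : forall a b, c2 (a + b) = c2 a + c2 b.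
Hypothesis c3D : forall a b, c3 (a + b) = c3 a + c3 b.
Hypothesis c4D : forall a b, c4 (a + b) = c4 a + c4 b.
Variables sg e1 e2 e3 e4 : G.
Hypothesis sgE : [/\ c1 sg = 1, c2 sg = 0, c3 sg = 1 & c4 sg = 0].
Hypothesis e1E : [/\ c1 e1 != 0, c2 e1 = 0, c3 e1 = 0 & c4 e1 = 0].
Hypothesis e2E : [/\ c1 e2 = 0, c2 e2 != 0, c3 e2 = 0 & c4 e2 = 0].
Hypothesis e3E : [/\ c1 e3 = 0, c2 e3 = 0, c3 e3 != 0 & c4 e3 = 0].
Hypothesis e4E : [/\ c1 e4 = 0, c2 e4 = 0, c3 e4 = 0 & c4 e4 != 0].

Let c1sg : c1 sg = 1. Proof. by case: sgE. Qed.
Let c2sg : c2 sg = 0. Proof. by case: sgE. Qed.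
Let c3sg : c3 sg = 1. Proof. by case: sgE. Qed.
Let c4sg : c4 sg = 0. Proof. by case: sgE. Qed.
Let c1e1 : c1 e1 != 0. Proof. by case: e1E. Qed.
Let c2e1 : c2 e1 = 0. Proof. by case: e1E. Qed.
Let c3e1 : c3 e1 = 0. Proof. by case: e1E. Qed.
Let c4e1 : c4 e1 = 0. Proof. by case: e1E. Qed.
Let c1e2 : c1 e2 = 0. Proof. by case: e2E. Qed.
Let c2e2 : c2 e2 != 0. Proof. by case: e2E. Qed.
Let c3e2 : c3 e2 = 0. Proof. by case: e2E. Qed.
Let c4e2 : c4 e2 = 0. Proof. by case: e2E. Qed.
Let c1e3 : c1 e3 = 0. Proof. by case: e3E. Qed.
Let c2e3 : c2 e3 = 0. Proof. by case: e3E. Qed.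
Let c3e3 : c3 e3 != 0. Proof. by case: e3E. Qed.
Let c4e3 : c4 e3 = 0. Proof. by case: e3E. Qed.
Let c1e4 : c1 e4 = 0. Proof. by case: e4E. Qed.
Let c2e4 : c2 e4 = 0. Proof. by case: e4E. Qed.
Let c3e4 : c3 e4 = 0. Proof. by case: e4E. Qed.
Let c4e4 : c4 e4 != 0. Proof. by case: e4E. Qed.

Let cE := (c1D, c2D, c3D, c4D, addfN c1D, addfN c2D, addfN c3D, addfN c4D,
  addf0 c1D, addf0 c2D, addf0 c3D, addf0 c4D,
  addfMn c1D, addfMn c2D, addfMn c3D, addfMn c4D,
  (c1sg, c2sg, c3sg, c4sg), (c2e1, c3e1, c4e1), (c1e2, c3e2, c4e2),
  (c1e3, c2e3, c4e3), (c1e4, c2e4, c3e4)).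

(** The exponents of weight 0 for both d2 and d4. For any other exponent the
    weights of d2 and d4 separate X a from the scalars and from W. *)
Definition flat a := (c2 a == 0) && (c4 a == 0).
(** The exponent sigma2: when J = {0}, its exponential is the only one outside
    the derived algebra. *)
Definition is_sg2 a := [&& c1 a == 1, c2 a == 0, c3 a == -2%:R & c4 a == 0].

Variables (A : comAlgType F) (d1 d2 d3 d4 : A -> A).
Hypotheses (D1 : derivation d1) (D2 : derivation d2).
Hypotheses (D3 : derivation d3) (D4 : derivation d4).
Hypothesis d21 : forall u, d2 (d1 u) = d1 (d2 u).
Hypothesis d31 : forall u, d3 (d1 u) = d1 (d3 u).
Hypothesis d41 : forall u, d4 (d1 u) = d1 (d4 u).
Hypothesis d32 : forall u, d3 (d2 u) = d2 (d3 u).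
Hypothesis d42 : forall u, d4 (d2 u) = d2 (d4 u).
Hypothesis d43 : forall u, d4 (d3 u) = d3 (d4 u).
Variables (X : G -> A) (W : A).
Hypothesis XD : forall a b, X (a + b) = X a * X b.
Hypothesis X0 : X 0 = 1.
Hypothesis d1X : forall a, d1 (X a) = (c1 a)%:K * X a.
Hypothesis d2X : forall a, d2 (X a) = (c2 a)%:K * X a.
Hypothesis d3X : forall a, d3 (X a) = (c3 a)%:K * X a.
Hypothesis d4X : forall a, d4 (X a) = (c4 a)%:K * X a.
Hypothesis WE : [/\ d1 W = 0, d2 W = 0, d3 W = - W & d4 W = 0].
Let d1W : d1 W = 0. Proof. by case: WE. Qed.
Let d2W : d2 W = 0. Proof. by case: WE. Qed.
Let d3W : d3 W = - W. Proof. by case: WE. Qed.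
Let d4W : d4 W = 0. Proof. by case: WE. Qed.

Local Notation x := (X sg).
Let dlin := (derD D1, derD D2, derD D3, derD D4,
  derM D1, derM D2, derM D3, derM D4,
  derN D1, derN D2, derN D3, derN D4,
  derK D1, derK D2, derK D3, derK D4,
  der0 D1, der0 D2, der0 D3, der0 D4, der1 D1, der1 D2, der1 D3, der1 D4).
Let dcomm := (d21, d31, d41, d32, d42, d43).
Let dX := (d1X, d2X, d3X, d4X, d1W, d2W, d3W, d4W).

Let d1x : d1 x = x. Proof. by rewrite d1X cE rmorph1 mul1r. Qed.
Let d2x : d2 x = 0. Proof. by rewrite d2X cE rmorph0 mul0r. Qed.
Let d3x : d3 x = x. Proof. by rewrite d3X cE rmorph1 mul1r. Qed.
Let d4x : d4 x = 0. Proof. by rewrite d4X cE rmorph0 mul0r. Qed.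
Let dx := (d1x, d2x, d3x, d4x).

Definition br u v :=
  x * (d1 u * d2 v - d1 v * d2 u) + (u + d3 u) * d4 v - (v + d3 v) * d4 u.

Lemma br_jacobi u v w : br u (br v w) = br (br u v) w + br v (br u w).
Proof.
by rewrite /br !dlin !dx !dcomm; ring.
Qed.

Definition linop (E : A -> A) :=
  forall (c : F) u v, E (c%:K * u + v) = c%:K * E u + E v.

Section Linop.
Variables (E : A -> A) (lE : linop E).
Lemma linopD u v : E (u + v) = E u + E v.
Proof. by have := lE 1 u v; rewrite rmorph1 !mul1r. Qed.
Lemma linop0 : E 0 = 0.
Proof. exact: addf0 linopD. Qed.
Lemma linopN u : E (- u) = - E u.
Proof. exact: addfN linopD _. Qed.
Lemma linopZ c u : E (c%:K * u) = c%:K * E u.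
Proof. by have := lE c u 0; rewrite linop0 !addr0. Qed.
End Linop.

Lemma brDl u v w : br (u + v) w = br u w + br v w.
Proof. by rewrite /br !dlin; ring. Qed.
Lemma brDr u v w : br w (u + v) = br w u + br w v.
Proof. by rewrite /br !dlin; ring. Qed.
Lemma brNl u w : br (- u) w = - br u w.
Proof. by rewrite /br !dlin; ring. Qed.
Lemma brNr u w : br w (- u) = - br w u.
Proof. by rewrite /br !dlin; ring. Qed.
Lemma brZl c u w : br (c%:K * u) w = c%:K * br u w.
Proof. by rewrite /br !dlin; ring. Qed.
Lemma brZr c u w : br w (c%:K * u) = c%:K * br w u.
Proof. by rewrite /br !dlin; ring. Qed.
Lemma br0l w : br 0 w = 0.
Proof. by rewrite /br !dlin; ring. Qed.
Lemma br0r w : br w 0 = 0.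
Proof. by rewrite /br !dlin; ring. Qed.
Lemma brC u v : br u v = - br v u.
Proof. by rewrite /br; ring. Qed.
Lemma brWl v : br W v = 0.
Proof. by rewrite /br !dX; ring. Qed.
Lemma brWr v : br v W = 0.
Proof. by rewrite /br !dX; ring. Qed.
Lemma br1 v : br 1 v = d4 v.
Proof. by rewrite /br !dlin; ring. Qed.

Lemma Xsg_inv : X (- sg) * x = 1.
Proof. by rewrite -XD addNr X0. Qed.

(** Together with [br1] this makes d2 and d4 inner: it is the reason why any
    derivation can be made to commute with them. *)
Lemma br_Xneg v : br (X (- sg)) v = - d2 v.
Proof.
rewrite /br !dX !cE !(rmorphN, rmorph1, rmorph0) oppr0 !mul0r.
transitivity (- (X (- sg) * x) * d2 v); first by ring.
by rewrite Xsg_inv mulN1r.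
Qed.

(** The line F W, which the quotient kills. It is central, so a congruence
    modulo F W may be used inside a bracket. *)
Definition negl v := exists k : F, v = k%:K * W.

Lemma negl0 : negl 0. Proof. by exists 0; rewrite rmorph0 mul0r. Qed.
Lemma neglD u v : negl u -> negl v -> negl (u + v).
Proof. by move=> [k ->] [l ->]; exists (k + l); rewrite rmorphD mulrDl. Qed.
Lemma neglZ c u : negl u -> negl (c%:K * u).
Proof. by move=> [k ->]; exists (c * k); rewrite rmorphM mulrA. Qed.
Lemma neglN u : negl u -> negl (- u).
Proof. by move=> [k ->]; exists (- k); rewrite rmorphN mulNr. Qed.
Lemma neglB u v : negl u -> negl v -> negl (u - v).
Proof. by move=> hu /neglN; apply: neglD. Qed.
Lemma negl_d2 u : negl u -> d2 u = 0.
Proof. by move=> [k ->]; rewrite !dlin !dX; ring. Qed.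
Lemma negl_d4 u : negl u -> d4 u = 0.
Proof. by move=> [k ->]; rewrite !dlin !dX; ring. Qed.
Lemma negl_brl u v : negl u -> br u v = 0.
Proof. by move=> [k ->]; rewrite brZl brWl mulr0. Qed.
Lemma negl_brr u v : negl u -> br v u = 0.
Proof. by move=> [k ->]; rewrite brZr brWr mulr0. Qed.
Lemma brl_eq u u' v : negl (u - u') -> br u v = br u' v.
Proof. by move=> /(negl_brl v); rewrite brDl brNl => /subr0_eq. Qed.
Lemma brr_eq u u' v : negl (u - u') -> br v u = br v u'.
Proof. by move=> /(negl_brr v); rewrite brDr brNr => /subr0_eq. Qed.

(** W has weight 0 for d2 and d4. Hence a congruence modulo F W between two
    vectors of the same non-flat weight is an equality. *)
Lemma negl_weight a u : negl u -> ~~ flat a ->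
  d2 u = (c2 a)%:K * u -> d4 u = (c4 a)%:K * u -> u = 0.
Proof.
move=> ju; rewrite (negl_d2 ju) (negl_d4 ju) negb_and => /orP[] h e e'.
  exact: (scalar_eq0 h).
exact: (scalar_eq0 h).
Qed.

Lemma X_inj a u v : X a * u = X a * v -> u = v.
Proof.
move=> /(congr1 ( *%R (X (- a)))).
by rewrite !mulrA -XD addNr X0 !mul1r.
Qed.

Let natF n : (n.+1)%:R != 0 :> F.
Proof. by move/pcharf0P: char0 => ->. Qed.

Let natI : injective (fun n => n%:R : F).
Proof.
move=> m n /=; wlog le_mn : m n / (m <= n)%N.
  by move=> h; case/orP: (leq_total m n) => le_mn e; [|symmetry]; apply: h.
move=> /esym/eqP; rewrite -subr_eq0 -natrB //; move/pcharf0P: char0 => ->.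
by rewrite subn_eq0 => le_nm; apply/eqP; rewrite eqn_leq le_mn.
Qed.

Lemma flatP a : reflect (c2 a = 0 /\ c4 a = 0) (flat a).
Proof. by apply: (iffP andP) => -[/eqP ? /eqP ?]. Qed.

Lemma flatD a b : flat b -> flat (a + b) = flat a.
Proof. by case/flatP=> h2 h4; rewrite /flat !cE h2 h4 !addr0. Qed.
Lemma flatDl a b : flat b -> flat (b + a) = flat a.
Proof. by rewrite addrC; exact: flatD. Qed.
Lemma flatN a : flat (- a) = flat a.
Proof. by rewrite /flat !cE !oppr_eq0. Qed.
Lemma flatMn a n : flat (a *+ n.+1) = flat a.
Proof. by rewrite /flat !cE -[c2 a *+ _]mulr_natl -[c4 a *+ _]mulr_natl !mulf_eq0 !(negbTE (natF n)). Qed.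
Lemma flat_sg : flat sg. Proof. by rewrite /flat !cE eqxx. Qed.
Lemma flat_e1 : flat e1. Proof. by rewrite /flat !cE eqxx. Qed.
Lemma flat_e3 : flat e3. Proof. by rewrite /flat !cE eqxx. Qed.
Lemma flat0 : flat 0. Proof. by rewrite /flat !cE eqxx. Qed.
Lemma flat_e2 : ~~ flat e2. Proof. by rewrite /flat (negbTE c2e2). Qed.
Lemma flat_e4 : ~~ flat e4. Proof. by rewrite /flat (negbTE c4e4) andbF. Qed.

Lemma sg2_flat a : is_sg2 a -> flat a.
Proof. by case/and4P=> _ h2 _ h4; rewrite /flat h2. Qed.

Lemma nonflat_sg2 a : ~~ flat a -> ~~ is_sg2 a.
Proof. exact/contra/sg2_flat. Qed.

(** The form in which characteristic 0 enters the functional equations: a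
    multiple can be moved away from finitely many exceptional values. *)
Lemma avoid (a : F) (s : seq F) : a != 0 -> exists n, n%:R * a \notin s.
Proof.
move=> a0; pose t := [seq n%:R * a | n <- iota 0 (size s).+1].
have /negP nts : ~~ all (mem s) t.
  apply/negP=> /allP ts.
  have ut : uniq t.
    by rewrite map_inj_uniq ?iota_uniq // => m n /(mulIf a0) /natI.
  have := uniq_leq_size ut ts.
  by rewrite size_map size_iota ltnn.
have /allPn[_ /mapP[n _ ->] ns] : ~~ all (mem s) t by apply/negP.
by exists n.
Qed.

(** Eigenvectors for the three distinct eigenvalues 0, c and 2c are independent. *)
Lemma eigenvalues012 (d : A -> A) (c : F) (k p s : A) :
  derivation d -> c != 0 -> d k = 0 -> d p = c%:K * p ->
  d s = c%:K * (s + s) -> k + p + s = 0 -> s = 0.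
Proof.
move=> D c0 dk dp ds e0.
have ed (w : A) : w = 0 -> d w = 0 by move=> ->; exact: der0 D.
have := ed _ e0; rewrite !(derD D) dk dp ds => e.
have {e} e1' : p + s + s = 0 by apply: (scalar_eq0 c0); rewrite -[RHS]e; ring.
have := ed _ e1'; rewrite !(derD D) dp ds => e.
have {e} e2' : p + s + s + (s + s) = 0 by apply: (scalar_eq0 c0); rewrite -[RHS]e; ring.
apply: (scalar_eq0 (natF 1)); rewrite rmorph_nat; move: e2'; rewrite e1' add0r => <-.
by ring.
Qed.

Hypothesis eigW : forall v, d1 v = 0 -> d2 v = 0 -> d3 v = - v -> d4 v = 0 -> negl v.

Lemma X_mulN a : X a * X (- a) = 1. Proof. by rewrite -XD subrr X0. Qed.

(** [br w (X a)] is X a times a factor E a that is affine in a, so E (3a) - 2 E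
    (2a) + E a = 0. Each term is known up to F W; multiplied by X (3a), the
    three of them have different weights, so E a = 0 by [eigenvalues012].
    Letting a run through e2, 2 e2, e4 and e2 + e1 gives the equations that
    characterise F W. *)
Lemma center w : (forall a, ~~ flat a -> negl (br w (X a))) -> negl w.
Proof.
move=> hw.
pose E a := x * ((c2 a)%:K * d1 w - (c1 a)%:K * d2 w)
   + (c4 a)%:K * (w + d3 w) - ((c3 a)%:K + 1) * d4 w.
have brE a : br w (X a) = X a * E a by rewrite /br !dX /E; ring.
have Ek a : ~~ flat a -> exists k, E a = k%:K * (X (- a) * W).
  move=> /hw; rewrite brE => -[k e]; exists k; apply: (@X_inj a).
  by rewrite e -[LHS]mul1r -(X_mulN a); ring.
have E0 a : ~~ flat a -> E a = 0.
  move=> na.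
  have [k1 ek1] := Ek a na.
  have [|k2 ek2] := Ek (a *+ 2); first by rewrite flatMn.
  have [|k3 ek3] := Ek (a *+ 3); first by rewrite flatMn.
  have e0 : E (a *+ 3) + (- 2)%:K * E (a *+ 2) + E a = 0.
    by rewrite /E !cE !(rmorphMn, rmorphN, rmorph_nat); ring.
  have step (d : A -> A) (c : F) : derivation d -> d W = 0 ->
      d (X a) = c%:K * X a -> c != 0 -> E a = 0.
    move=> D dW da c0.
    have e1' : k3%:K * W + (- k2 - k2)%:K * (X a * W) + k1%:K * (X a * X a * W) = 0.
      transitivity (X (a *+ 3) * (E (a *+ 3) + (- 2)%:K * E (a *+ 2) + E a)); last first.
        by rewrite e0 mulr0.
      rewrite ek1 ek2 ek3 -!mulNrn !mulrS !mulr0n !addr0 !XD.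
      transitivity (k3%:K * (X a * X (- a)) ^+ 3 * W
        + (- k2 - k2)%:K * ((X a * X (- a)) ^+ 2 * (X a * W))
        + k1%:K * (X a * X (- a)) * (X a * X a * W)); last by ring.
      by rewrite X_mulN; ring.
    have := eigenvalues012 D c0 _ _ _ e1'.
    rewrite !(derM D, derK D, dW, da) => /(_ ltac:(ring) ltac:(ring) ltac:(ring)) e3'.
    rewrite ek1; transitivity (X (- a) * X (- a) * X (- a) * (k1%:K * (X a * X a * W))).
      transitivity ((X a * X (- a)) ^+ 2 * (k1%:K * (X (- a) * W))); last by ring.
      by rewrite X_mulN; ring.
    by rewrite e3' mulr0.
  move: na; rewrite negb_and => /orP[] h.
    exact: (step d2 (c2 a)).
  exact: (step d4 (c4 a)).
have d4w : d4 w = 0.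
  have h : E (e2 *+ 2) = 0 by rewrite E0 // flatMn flat_e2.
  transitivity (E (e2 *+ 2) - (1 + 1) * E e2); last by rewrite h E0 ?flat_e2 // mulr0 subrr.
  by rewrite /E !cE !(rmorphMn, rmorph0); ring.
have d1w : d1 w = 0.
  apply: (scalar_eq0 c2e2); apply: (@X_inj sg); rewrite mulr0 -[RHS](E0 e2 flat_e2) /E !cE d4w.
  by rewrite !rmorph0; ring.
have d3w : w + d3 w = 0.
  apply: (scalar_eq0 c4e4); rewrite -[RHS](E0 e4 flat_e4) /E !cE d4w.
  by rewrite !rmorph0; ring.
have d2w : d2 w = 0.
  apply: (scalar_eq0 c1e1); apply: (@X_inj sg); rewrite mulr0.
  have h : E (e2 + e1) = 0 by rewrite E0 // flatD ?flat_e1 ?flat_e2.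
  rewrite -[RHS]oppr0 -h /E !cE d4w d1w d3w.
  by rewrite !(rmorph0, rmorphD); ring.
by apply: eigW => //; apply/eqP; rewrite -addr_eq0 addrC d3w.
Qed.

Variables (inf : 'I_4 -> bool) (t : 'rV[nat]_4 -> A).
Definition inJ (i : 'rV[nat]_4) := [forall p, inf p || (i 0 p == 0%N)].
Hypothesis tD : forall i j, inJ i -> inJ j -> t (i + j) = t i * t j.
Hypothesis t0 : t 0 = 1.
Hypothesis d1t : forall i, inJ i -> d1 (t i) = (i 0 pos1)%:R%:K * t (dec i pos1).
Hypothesis d2t : forall i, inJ i -> d2 (t i) = (i 0 pos2)%:R%:K * t (dec i pos2).
Hypothesis d3t : forall i, inJ i -> d3 (t i) = (i 0 pos3)%:R%:K * t (dec i pos3).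
Hypothesis d4t : forall i, inJ i -> d4 (t i) = (i 0 pos4)%:R%:K * t (dec i pos4).

(** A right inverse I of d + c, up to an error K. On a weight space where d + c
    is invertible there is no error; where d + c is the derivative by the
    variable t_p, it is onto if t_p is present, which is the meaning of [b], and
    zero otherwise. *)
Definition has_primitives (d : A -> A) (c : F) (b : bool) (d' d'' d''' : A -> A) :=
  exists I : A -> A, [/\ linop I,
    forall w, let K := w - (d (I w) + c%:K * I w) in
      d K + c%:K * K = 0 /\ (b -> K = 0),
    forall u, d' (I u) = I (d' u),
    forall u, d'' (I u) = I (d'' u)
  & forall u, d''' (I u) = I (d''' u)].

Hypothesis prim1 : has_primitives d1 0 (inf pos1) d2 d3 d4.
Hypothesis prim2 : has_primitives d2 0 (inf pos2) d1 d3 d4.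
Hypothesis prim3 : has_primitives d3 1 (inf pos3) d1 d2 d4.
Hypothesis prim4 : has_primitives d4 0 (inf pos4) d1 d2 d3.

(** Without the variable t_p the derivation d_p is diagonalisable, so a
    generalised eigenvector is an eigenvector. *)
Definition diagonal (d : A -> A) (b : bool) := ~~ b -> forall (l : F) v,
  negl (d (d v - l%:K * v) - l%:K * (d v - l%:K * v)) -> negl (d v - l%:K * v).
Hypothesis diag2 : diagonal d2 (inf pos2).
Hypothesis diag4 : diagonal d4 (inf pos4).

Definition mon a i := X a * t i.
(** The monomials whose class lies in the derived algebra. *)
Definition dom a i := inJ i && ([exists p, inf p] || ~~ is_sg2 a).

Definition brder (E : A -> A) :=
  linop E /\ forall u v, E (br u v) = br (E u) v + br u (E v).

(** What a derivation of the quotient algebra gives on a linear lift E. The maps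
    subtracted from E below satisfy the stronger [brder]. *)
Definition isder (E : A -> A) := linop E /\ forall a i b j, dom a i -> dom b j ->
  negl (E (br (mon a i) (mon b j))
    - (br (E (mon a i)) (mon b j) + br (mon a i) (E (mon b j)))).

Lemma brder_ad u : brder (br u).
Proof.
split; first by move=> c v w; rewrite brDr brZr.
exact: br_jacobi.
Qed.

(** The bracket is built from the product, x and the derivations d_p. *)
Lemma brder_derivation E : derivation E ->
  (forall u, E (d1 u) = d1 (E u)) -> (forall u, E (d2 u) = d2 (E u)) ->
  (forall u, E (d3 u) = d3 (E u)) -> (forall u, E (d4 u) = d4 (E u)) ->
  E x = 0 -> brder E.
Proof.
move=> D h1 h2 h3 h4 hx; split=> [c u v|u v]; first by rewrite (derD D) (derZ D).
rewrite /br !(derD D, derM D, derN D) hx !(h1, h2, h3, h4).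
by ring.
Qed.

Lemma isderB E E' : isder E -> brder E' -> isder (fun u => E u - E' u).
Proof.
move=> [lE hE] [lE' hE']; split=> [c u v|a i b j ha hb].
  by rewrite lE lE'; ring.
rewrite hE'; have := hE a i b j ha hb.
by congr negl; rewrite brDl brNl brDr brNr; ring.
Qed.

Lemma inJ0 : inJ 0. Proof. by apply/forallP=> p; rewrite mxE eqxx orbT. Qed.
Lemma inJ_dec i p : inJ i -> inJ (dec i p).
Proof.
move/forallP=> hi; apply/forallP=> q; rewrite mxE.
by case/orP: (hi q) => [->//|/eqP->]; rewrite sub0n eqxx orbT.
Qed.
Lemma inJD i j : inJ i -> inJ j -> inJ (i + j).
Proof.
move=> /forallP hi /forallP hj; apply/forallP=> q; rewrite mxE.
by case/orP: (hi q) => [->//|/eqP->]; case/orP: (hj q) => [->//|/eqP->]; rewrite orbT.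
Qed.

Lemma mon0 a : mon a 0 = X a. Proof. by rewrite /mon t0 mulr1. Qed.

Lemma dom_nonflat a i : inJ i -> ~~ is_sg2 a -> dom a i.
Proof. by rewrite /dom => -> ->; rewrite orbT. Qed.

Lemma nsg2_0 : ~~ is_sg2 0.
Proof. by rewrite /is_sg2 !cE eq_sym oner_eq0. Qed.

Lemma nsg2_Xneg : ~~ is_sg2 (- sg).
Proof.
rewrite /is_sg2 !cE; apply/negP => /and4P[/eqP h _ _ _].
by have /eqP := h; rewrite eq_sym -addr_eq0 (negbTE (natF 1)).
Qed.

Lemma isderX E a b : isder E -> ~~ is_sg2 a -> ~~ is_sg2 b ->
  negl (E (br (X a) (X b)) - (br (E (X a)) (X b) + br (X a) (E (X b)))).
Proof.
move=> [_ hE] ha hb; rewrite -!mon0; apply: hE; exact: dom_nonflat inJ0 _.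
Qed.

Lemma dom_00 : dom 0 0. Proof. exact: dom_nonflat inJ0 nsg2_0. Qed.
Lemma dom_Xneg : dom (- sg) 0. Proof. exact: dom_nonflat inJ0 nsg2_Xneg. Qed.

Lemma isder1 E a i : isder E -> dom a i ->
  negl (E (d4 (mon a i)) - (br (E 1) (mon a i) + d4 (E (mon a i)))).
Proof.
move=> [_ hE] ha; have := hE _ _ _ _ dom_00 ha.
by rewrite mon0 X0 !br1.
Qed.

Lemma isder_Xneg E a i : isder E -> dom a i ->
  negl (E (d2 (mon a i)) - (- br (E (X (- sg))) (mon a i) + d2 (E (mon a i)))).
Proof.
move=> [lE hE] ha; have /neglN := hE _ _ _ _ dom_Xneg ha.
by rewrite mon0 !br_Xneg (linopN lE); congr negl; ring.
Qed.

Lemma dom_inJ a i : dom a i -> inJ i. Proof. by case/andP. Qed.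

Lemma inJ_fin i p : inJ i -> ~~ inf p -> i 0 p = 0%N.
Proof. by move=> /forallP/(_ p)/orP[->//|/eqP]. Qed.

(** * Commuting with the second and the fourth derivation *)

Definition comm (d E : A -> A) := forall a i, dom a i ->
  negl (E (d (mon a i)) - d (E (mon a i))).

Lemma d4_br u v : d4 (br u v) = br (d4 u) v + br u (d4 v).
Proof. by rewrite -!br1 br_jacobi. Qed.
Lemma d2_br u v : d2 (br u v) = br (d2 u) v + br u (d2 v).
Proof. by apply: oppr_inj; rewrite opprD -brNl -brNr -!br_Xneg br_jacobi. Qed.

(** Choose u with d4 u = - E 1, up to the error K of [has_primitives]: then E 1
    becomes K, and the Leibniz rule for [br 1 v = d4 v] says that E commutes
    with d4 up to br K. If t_4 is present, K = 0. Otherwise d4 K = 0, so that br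
    K maps the eigenvector mon a i of d4 to an eigenvector of the same weight,
    and [diag4] shows that the defect is in F W. *)
Lemma commute_d4 E : isder E -> exists u, comm d4 (fun v => E v - br u v).
Proof.
move=> hE; have [I [lI hI _ _ _]] := prim4.
exists (- I (E 1)); set E' := fun v => _.
have hE' : isder E' := isderB hE (brder_ad _).
have := hI (E 1); set K := _ - _ => -[dK iK].
have E1 : E' 1 = K by rewrite /E' brNl brC br1 /K rmorph0; ring.
have dK0 : d4 K = 0 by rewrite -[RHS]dK rmorph0; ring.
move=> a i hd; have := isder1 hE' hd; rewrite E1.
have [i4|i4] := boolP (inf pos4).
  by rewrite iK // br0l add0r.
move=> h; rewrite /mon; have tE := d4t (dom_inJ hd).
rewrite (inJ_fin (dom_inJ hd) i4) !(rmorph0, mul0r) in tE.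
have dm : d4 (mon a i) = (c4 a)%:K * mon a i.
  by rewrite /mon !dlin !dX tE; ring.
rewrite -/(mon a i) dm (linopZ hE'.1).
rewrite dm (linopZ hE'.1) in h.
rewrite -opprB; apply/neglN/diag4 => //.
set w := E' (mon a i) in h *.
have {}h : negl ((d4 w - (c4 a)%:K * w) + br K (mon a i)).
  by move/neglN: h; congr negl; ring.
have h0 : br K (d4 (mon a i)) = (c4 a)%:K * br K (mon a i) by rewrite dm brZr.
have /negl_d4 := h; rewrite (derD D4) d4_br dK0 br0l add0r h0 => h1.
move/(neglZ (c4 a))/neglN: h; congr negl.
by apply/subr0_eq; rewrite -[RHS]oppr0 -h1; ring.
Qed.

(** The argument of [commute_d4], with X (- sg) and d2 in place of 1 and d4. So
    as not to spoil the commutation with d4, the correcting element has to be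
    killed by d4. Therefore E (X (- sg)) is first replaced by a congruent
    element w with d4 w = 0: X (- sg) is a bracket of two exponentials of
    d4-weight 0, and w is the value predicted by the Leibniz rule. *)
Lemma commute_d2_d4 E : isder E ->
  exists u, let E' := fun v => E v - br u v in comm d4 E' /\ comm d2 E'.
Proof.
move=> hE; have [u hu] := commute_d4 hE; set E' := fun v => _ in hu.
have hE' : isder E' := isderB hE (brder_ad _).
pose a := X e2; pose b := X (- e2 - sg - sg).
have yE : br a b = (c2 e2 + c2 e2)%:K * X (- sg).
  have -> : X (- sg) = x * a * b.
    rewrite /a /b !XD; transitivity ((X e2 * X (- e2)) * (X (- sg) * x) * X (- sg)).
      by rewrite X_mulN Xsg_inv; ring.
    by ring.
  rewrite /br /a /b !dX !cE !(rmorphN, rmorph0, rmorph1, rmorphD, rmorphB).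
  by ring.
have yy : E' (X (- sg)) = (c2 e2 + c2 e2)^-1%:K * E' (br a b).
  rewrite yE (linopZ hE'.1) mulrA -rmorphM mulVf ?rmorph1 ?mul1r //.
  by rewrite -mulr2n -mulr_natl mulf_neq0 ?(natF 1).
pose w0 := br (E' a) b + br a (E' b).
pose w := (c2 e2 + c2 e2)^-1%:K * w0.
have dombb : ~~ is_sg2 (- e2 - sg - sg).
  by apply: nonflat_sg2; rewrite /flat !cE !subr0 oppr_eq0 (negbTE c2e2).
have yw : negl (E' (X (- sg)) - w).
  rewrite yy /w -mulrBr; apply: neglZ; apply: isderX => //.
  exact/nonflat_sg2/flat_e2.
have d4E' b' : ~~ is_sg2 b' -> c4 b' = 0 -> negl (d4 (E' (X b'))).
  move=> hb hc; have := hu b' 0 (dom_nonflat inJ0 hb).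
  rewrite mon0 d4X hc rmorph0 mul0r (linop0 hE'.1) sub0r => /neglN.
  by rewrite opprK.
have d4a : d4 a = 0 by rewrite d4X !cE rmorph0 mul0r.
have c4b : c4 (- e2 - sg - sg) = 0 by rewrite !cE !subr0 oppr0.
have d4b : d4 b = 0 by rewrite d4X c4b rmorph0 mul0r.
have d4w : d4 w = 0.
  rewrite derZ // /w0 derD // !d4_br d4a d4b br0l br0r.
  rewrite (negl_brl _ (d4E' _ (nonflat_sg2 flat_e2) c4e2)) (negl_brr _ (d4E' _ dombb c4b)).
  by rewrite !addr0 mulr0.
have [I [lI hI _ _ I4]] := prim2.
have := hI w; set K := _ - _ => -[dK iK].
have dK0 : d2 K = 0 by rewrite -[RHS]dK rmorph0; ring.
have d4Iw : d4 (I w) = 0 by rewrite I4 d4w (linop0 lI).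
exists (u + I w) => E''.
have E''E v : E'' v = E' v - br (I w) v by rewrite /E'' /E' brDl; ring.
have -> : E'' = (fun v => E' v - br (I w) v) by apply/funext.
clear E'' E''E; clearbody E'; set E'' := fun v => _.
have hE'' : isder E'' := isderB hE' (brder_ad _).
have E''y : negl (E'' (X (- sg)) - K).
  move: yw; congr negl; rewrite /E'' brC br_Xneg /K rmorph0; ring.
split=> [c i hd|c i hd].
  have := hu c i hd; congr negl.
  by rewrite /E'' (derB D4) d4_br d4Iw br0l; ring.
have h : negl (E'' (d2 (mon c i)) - (- br K (mon c i) + d2 (E'' (mon c i)))).
  by have := isder_Xneg hE'' hd; rewrite (brl_eq _ E''y).
have [i2|i2] := boolP (inf pos2).
  by move: h; rewrite iK // br0l oppr0 add0r.
have tE := d2t (dom_inJ hd).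
rewrite (inJ_fin (dom_inJ hd) i2) !(rmorph0, mul0r) in tE.
have dm : d2 (mon c i) = (c2 c)%:K * mon c i by rewrite /mon !dlin !dX tE; ring.
rewrite dm (linopZ hE''.1); rewrite dm (linopZ hE''.1) in h.
rewrite -opprB; apply/neglN/diag2 => //.
set v := E'' (mon c i) in h *.
have {}h : negl ((d2 v - (c2 c)%:K * v) - br K (mon c i)).
  by move/neglN: h; congr negl; ring.
have h0 : br K (d2 (mon c i)) = (c2 c)%:K * br K (mon c i) by rewrite dm brZr.
have /negl_d2 := h; rewrite (derB D2) d2_br dK0 br0l add0r h0 => h1.
move/(neglZ (c2 c))/neglN: h; congr negl.
by apply/subr0_eq; rewrite -[RHS]oppr0 -h1; ring.
Qed.

(** * Multipliers of the exponentials *)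

(** One of the two weights of a is nonzero, so v can be corrected by a multiple
    of W to an exact weight vector; P is its quotient by X a. *)
Lemma weight_lift a v : ~~ flat a ->
  negl (d2 v - (c2 a)%:K * v) -> negl (d4 v - (c4 a)%:K * v) ->
  exists P, [/\ d2 P = 0, d4 P = 0 & negl (v - P * X a)].
Proof.
move=> na j2 j4.
suff [v' [jv e2' e4']] : exists v', [/\ negl (v - v'), d2 v' = (c2 a)%:K * v'
    & d4 v' = (c4 a)%:K * v'].
  exists (v' * X (- a)); split.
  - by rewrite !dlin !dX e2' !cE rmorphN; ring.
  - by rewrite !dlin !dX e4' !cE rmorphN; ring.
  by rewrite -mulrA [X (- a) * _]mulrC X_mulN mulr1.
move: na; rewrite negb_and => /orP[] h.
  case: (j2) => k ek; exists (v + (k / c2 a)%:K * W).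
  have e2' : d2 (v + (k / c2 a)%:K * W) = (c2 a)%:K * (v + (k / c2 a)%:K * W).
    rewrite !dlin !dX; apply/subr0_eq.
    transitivity (d2 v - (c2 a)%:K * v - (c2 a * (k / c2 a))%:K * W); first by ring.
    by rewrite ek mulrCA divff // mulr1 subrr.
  split=> //; first by exists (- (k / c2 a)); ring.
  set v' := v + _ in e2' *; apply/subr0_eq.
  have j : negl (d4 v' - (c4 a)%:K * v').
    have := neglB j4 (neglZ (c4 a * (k / c2 a)) (ex_intro _ 1 erefl : negl (1%:K * W))).
    by congr negl; rewrite /v' !dlin !dX; ring.
  apply: (scalar_eq0 h); rewrite -[RHS](negl_d2 j) (derB D2) (derZ D2) -d42 e2' (derZ D4).
  by ring.
case: (j4) => k ek; exists (v + (k / c4 a)%:K * W).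
have e4' : d4 (v + (k / c4 a)%:K * W) = (c4 a)%:K * (v + (k / c4 a)%:K * W).
  rewrite !dlin !dX; apply/subr0_eq.
  transitivity (d4 v - (c4 a)%:K * v - (c4 a * (k / c4 a))%:K * W); first by ring.
  by rewrite ek mulrCA divff // mulr1 subrr.
split=> //; first by exists (- (k / c4 a)); ring.
set v' := v + _ in e4' *; apply/subr0_eq.
have j : negl (d2 v' - (c2 a)%:K * v').
  have := neglB j2 (neglZ (c2 a * (k / c4 a)) (ex_intro _ 1 erefl : negl (1%:K * W))).
  by congr negl; rewrite /v' !dlin !dX; ring.
apply: (scalar_eq0 h); rewrite -[RHS](negl_d4 j) (derB D4) (derZ D4) d42 e4' (derZ D2).
by ring.
Qed.

(** A map commuting with d2 and d4 multiplies each exponential by an element of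
    weight 0. The exponent sigma2 is excepted because E need not be a derivation
    there. *)
Definition multipliers (E : A -> A) (P : G -> A) := forall a,
  [/\ d2 (P a) = 0, d4 (P a) = 0 & ~~ is_sg2 a -> negl (E (X a) - P a * X a)].

Section Commuting.
Variables (E : A -> A) (hE : isder E) (hE2 : comm d2 E) (hE4 : comm d4 E).

Lemma comm2X a : ~~ is_sg2 a -> negl (d2 (E (X a)) - (c2 a)%:K * E (X a)).
Proof.
move=> ha; have := hE2 (dom_nonflat inJ0 ha).
by rewrite mon0 d2X (linopZ hE.1) => /neglN; rewrite opprB.
Qed.
Lemma comm4X a : ~~ is_sg2 a -> negl (d4 (E (X a)) - (c4 a)%:K * E (X a)).
Proof.
move=> ha; have := hE4 (dom_nonflat inJ0 ha).
by rewrite mon0 d4X (linopZ hE.1) => /neglN; rewrite opprB.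
Qed.

Lemma multiplier_nonflat a : ~~ flat a ->
  exists P, [/\ d2 P = 0, d4 P = 0 & negl (E (X a) - P * X a)].
Proof.
move=> na; apply: weight_lift => //.
  exact: comm2X (nonflat_sg2 na).
exact: comm4X (nonflat_sg2 na).
Qed.

(** The weights of X a do not determine E (X a) when a is flat, but the Leibniz
    rule does as soon as X a is a bracket of two non-flat exponentials. *)
Lemma multiplier_flat a a' b' (k : F) : flat a -> ~~ flat a' -> flat (a' + b') -> k != 0 ->
  br (X a') (X b') = k%:K * X a ->
  exists P, [/\ d2 P = 0, d4 P = 0 & negl (E (X a) - P * X a)].
Proof.
move=> fa na' fab k0 eb.
have nb' : ~~ flat b' by move: na'; apply: contra => fb; rewrite -(flatD a' fb).
have [Pa [Pa2 Pa4 Pa']] := multiplier_nonflat na'.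
have [Pb [Pb2 Pb4 Pb']] := multiplier_nonflat nb'.
pose z := k^-1%:K * (br (Pa * X a') (X b') + br (X a') (Pb * X b')).
case/flatP: fa => ca2 ca4; case/flatP: fab; rewrite !cE => cab2 cab4.
have z2 : d2 z = 0.
  rewrite /z (derZ D2) (derD D2) !d2_br !(derM D2) !d2X Pa2 Pb2 !mul0r !add0r.
  rewrite !(mulrCA Pa) !(mulrCA Pb) !(brZl, brZr) -!mulrDl.
  by rewrite -!(rmorphD (in_alg A)) cab2 rmorph0; ring.
have z4 : d4 z = 0.
  rewrite /z (derZ D4) (derD D4) !d4_br !(derM D4) !d4X Pa4 Pb4 !mul0r !add0r.
  rewrite !(mulrCA Pa) !(mulrCA Pb) !(brZl, brZr) -!mulrDl.
  by rewrite -!(rmorphD (in_alg A)) cab4 rmorph0; ring.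
exists (z * X (- a)); split.
- by rewrite (derM D2) z2 d2X !cE ca2 oppr0 rmorph0; ring.
- by rewrite (derM D4) z4 d4X !cE ca4 oppr0 rmorph0; ring.
rewrite -mulrA [X (- a) * _]mulrC X_mulN mulr1.
have := isderX hE (nonflat_sg2 na') (nonflat_sg2 nb').
rewrite (brl_eq _ Pa') (brr_eq _ Pb') eb (linopZ hE.1) => /(neglZ k^-1).
by congr negl; rewrite mulrBr mulrA -rmorphM mulVf // rmorph1 mul1r.
Qed.

Lemma brX a b : br (X a) (X b) =
  (c1 a * c2 b - c2 a * c1 b)%:K * X (a + b + sg)
  + ((c3 a + 1) * c4 b - (c3 b + 1) * c4 a)%:K * X (a + b).
Proof. by rewrite /br !dX !XD; ring. Qed.

Lemma multipliers_exist : exists P, multipliers E P.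
Proof.
suff h a : exists P, [/\ d2 P = 0, d4 P = 0 & ~~ is_sg2 a -> negl (E (X a) - P * X a)].
  by have [P hP] := choice h; exists P.
have [fa|na] := boolP (flat a); last first.
  by have [P [? ? ?]] := multiplier_nonflat na; exists P.
have [s2|s2] := boolP (is_sg2 a); first by exists 0; rewrite !dlin.
suff [P [? ? ?]] : exists P, [/\ d2 P = 0, d4 P = 0 & negl (E (X a) - P * X a)].
  by exists P.
case/flatP: (fa) => ca2 ca4.
(* Both families of brackets have a coefficient that can vanish, simultaneously
   only at sigma2. *)
have [a1|a1] := eqVneq (c1 a) 1; last first.
  apply: (@multiplier_flat a (e2 + a) (- e2 - sg) ((1 - c1 a) * c2 e2)) => //.
  - by rewrite flatD // flat_e2.
  - by rewrite /flat !cE ca2 ca4; apply/andP; split; apply/eqP; ring.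
  - by rewrite mulf_neq0 // subr_eq0 eq_sym.
  rewrite brX (_ : _ + _ + sg = a); last by rewrite addrACA addrN add0r subrK.
  by rewrite !cE ca2 ca4; ring.
apply: (@multiplier_flat a (e4 + a) (- e4) (- (c3 a + 2%:R) * c4 e4)) => //.
- by rewrite flatD // flat_e4.
- by rewrite /flat !cE ca2 ca4; apply/andP; split; apply/eqP; ring.
- rewrite mulf_neq0 // oppr_eq0 addr_eq0; apply: contra s2 => a3.
  by rewrite /is_sg2 a1 ca2 ca4 !eqxx a3.
rewrite brX [e4 + a]addrC addrK !cE ca2 ca4.
by ring.
Qed.

End Commuting.

Section MasterEquation.
Variables (E : A -> A) (hE : isder E) (P : G -> A) (hP : multipliers E P).

Let P2 a : d2 (P a) = 0. Proof. by case: (hP a). Qed.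
Let P4 a : d4 (P a) = 0. Proof. by case: (hP a). Qed.

(** The Leibniz rule on X a and X b. By [negl_weight] it is an equality and not
    only a congruence, since a + b is not flat. *)
Lemma multipliers_eq a b : ~~ is_sg2 a -> ~~ is_sg2 b -> ~~ flat (a + b) ->
  (c1 a * c2 b - c2 a * c1 b)%:K * x * P (a + b + sg)
  + ((c3 a + 1) * c4 b - (c3 b + 1) * c4 a)%:K * P (a + b)
  = (P a + P b) * ((c1 a * c2 b - c2 a * c1 b)%:K * x
                   + ((c3 a + 1) * c4 b - (c3 b + 1) * c4 a)%:K)
    + x * ((c2 b)%:K * d1 (P a) - (c2 a)%:K * d1 (P b))
    + (c4 b)%:K * d3 (P a) - (c4 a)%:K * d3 (P b).
Proof.
move=> ha hb nab.
have PE c : ~~ is_sg2 c -> negl (E (X c) - P c * X c) by case: (hP c).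
have := isderX hE ha hb; rewrite (brl_eq _ (PE _ ha)) (brr_eq _ (PE _ hb)) brX.
rewrite (linopD hE.1) !(linopZ hE.1).
set w := (_ - _)%:K; set p := (_ - _)%:K.
have nabs : ~~ flat (a + b + sg) by rewrite flatD ?flat_sg.
move=> j.
have {j} := neglB j (neglD (neglZ (c1 a * c2 b - c2 a * c1 b) (PE _ (nonflat_sg2 nabs)))
  (neglZ ((c3 a + 1) * c4 b - (c3 b + 1) * c4 a) (PE _ (nonflat_sg2 nab)))).
rewrite -/w -/p; set D := _ - _ => j.
set S1 := RHS; set S2 := LHS.
have DE : D = X (a + b) * (S2 - S1).
  rewrite /D /S1 /S2 /br !dlin !dX !P2 !P4 !XD /w /p; ring.
apply/subr0_eq/(@X_inj (a + b)); rewrite mulr0 -DE.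
have S2' : d2 (S2 - S1) = 0.
  by rewrite /S1 /S2 /w /p !dlin !dx !P2 !d21 -!d32 !P2 !dlin; ring.
have S4' : d4 (S2 - S1) = 0.
  by rewrite /S1 /S2 /w /p !dlin !dx !P4 !d41 !d43 !P4 !dlin; ring.
apply: (negl_weight j nab); rewrite DE ?(derM D2) ?(derM D4) ?S2' ?S4' !dX mulr0 addr0 mulrA //.
Qed.
End MasterEquation.

Hypothesis eigZ : forall v, d1 v = v -> d2 v = 0 -> d3 v = 0 -> d4 v = 0 ->
  exists k : F, v = k%:K * (x * W).
Hypothesis eig0 : forall v, d1 v = 0 -> d2 v = 0 -> d3 v = 0 -> d4 v = 0 ->
  exists k : F, v = k%:K.

(** * Translations by flat exponents *)

Definition addflat (V : zmodType) (Q : G -> V) :=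
  forall a b, flat a -> flat b -> Q (a + b) = Q a + Q b.

Lemma addflat0 (V : zmodType) (Q : G -> V) : addflat Q -> Q 0 = 0.
Proof. by move=> h; apply: (@addrI _ (Q 0)); rewrite -h ?flat0 // !addr0. Qed.

Lemma addflatMn (V : zmodType) (Q : G -> V) a n : addflat Q -> flat a -> Q (a *+ n) = Q a *+ n.
Proof.
move=> h fa; elim: n => [|n IH]; first by rewrite !mulr0n addflat0.
rewrite !mulrS h // ?IH //; case: n {IH} => [|n]; first by rewrite flat0.
by rewrite flatMn.
Qed.

(** A translation law that is known for enough flat exponents holds for all of
    them, and the translation constant is then additive. *)
Lemma shift_extend (P : G -> A) (C good : pred G) b0 : C b0 ->
  (forall a b, flat a -> C b -> C (a + b)) ->
  (forall a, flat a -> good a -> exists q, forall b, C b -> P (a + b) = P b + q) ->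
  (forall a, flat a -> exists a1 a2,
     [/\ flat a1, flat a2, good a1, good a2 & a = a1 + a2]) ->
  exists Q : G -> A, addflat Q /\ forall a b, flat a -> C b -> P (a + b) = P b + Q a.
Proof.
move=> Cb0 Cs hq hs; pose Q a := P (a + b0) - P b0.
have PQ a b : flat a -> C b -> P (a + b) = P b + Q a.
  move=> fa; have [u [v [fu fv gu gv ->]]] := hs a fa.
  have [q eq_q] := hq u fu gu; have [q' eq_q'] := hq v fv gv => Cb.
  rewrite /Q -!addrA !(eq_q _ (Cs _ _ _ _)) // !eq_q' //.
  by ring.
exists Q; split=> // a b fa fb; rewrite {1}/Q -addrA PQ ?(Cs b) // PQ //.
by rewrite addrAC [P b0 + _]addrC addrK addrC.
Qed.

(** All that is remembered of E from here on. *)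
Definition coherent (P : G -> A) := [/\ forall a, d2 (P a) = 0, forall a, d4 (P a) = 0
 & forall a b, ~~ is_sg2 a -> ~~ is_sg2 b -> ~~ flat (a + b) ->
  (c1 a * c2 b - c2 a * c1 b)%:K * x * P (a + b + sg)
  + ((c3 a + 1) * c4 b - (c3 b + 1) * c4 a)%:K * P (a + b)
  = (P a + P b) * ((c1 a * c2 b - c2 a * c1 b)%:K * x
                   + ((c3 a + 1) * c4 b - (c3 b + 1) * c4 a)%:K)
    + x * ((c2 b)%:K * d1 (P a) - (c2 a)%:K * d1 (P b))
    + (c4 b)%:K * d3 (P a) - (c4 a)%:K * d3 (P b)].

Lemma multipliers_coherent E P : isder E -> multipliers E P -> coherent P.
Proof. by move=> hE hP; split=> [a|a|]; [case: (hP a)|case: (hP a)|exact: (multipliers_eq hE hP)]. Qed.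

(** For a flat and b of one of the next two kinds, the functional equation for
    (a, b) loses one of its two terms on the left. *)
Definition only2 b := (c2 b != 0) && (c4 b == 0).
Definition only4 b := (c2 b == 0) && (c4 b != 0).

Lemma only2_shift a b : flat a -> only2 b -> only2 (a + b).
Proof. by case/flatP=> h2 h4; rewrite /only2 !cE h2 h4 !add0r. Qed.
Lemma only4_shift a b : flat a -> only4 b -> only4 (a + b).
Proof. by case/flatP=> h2 h4; rewrite /only4 !cE h2 h4 !add0r. Qed.
Lemma only2_flat b : only2 b -> ~~ flat b.
Proof. by case/andP=> h _; rewrite /flat (negbTE h). Qed.
Lemma only4_flat b : only4 b -> ~~ flat b.
Proof. by case/andP=> _ h; rewrite /flat (negbTE h) andbF. Qed.
Lemma only2_e2 : only2 e2. Proof. by rewrite /only2 c2e2 cE eqxx. Qed.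
Lemma only4_e4 : only4 e4. Proof. by rewrite /only4 c4e4 cE eqxx. Qed.

Lemma flatM0 a n : flat a -> flat (a *+ n).
Proof. by case/flatP=> h2 h4; rewrite /flat !cE h2 h4 mul0rn eqxx. Qed.
Lemma flatB a b : flat a -> flat b -> flat (a - b).
Proof. by move=> fa fb; rewrite flatD ?flatN. Qed.

(** The flat exponents at which [coherent4] below can be solved for the
    translation constant. *)
Definition good3 a := (c3 a + 1 != 0) && ~~ is_sg2 a.

Lemma flat_split3 a : flat a -> exists a1 a2,
  [/\ flat a1, flat a2, good3 a1, good3 a2 & a = a1 + a2].
Proof.
move=> fa; have [n] := avoid [:: c3 a + 1; c3 a + 2%:R; - 1] c3e3.
rewrite !inE !negb_or => /and3P[n1 n2 n3].
have fn := flatM0 n flat_e3.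
exists (a - e3 *+ n), (e3 *+ n); rewrite subrK flatB // fn; split=> //.
  rewrite /good3 /is_sg2 !cE -[_ *+ n]mulr_natl; apply/andP; split.
    by apply: contra n1; rewrite addrAC subr_eq0 eq_sym.
  apply/negP=> /and4P[_ _ /eqP h _]; case/eqP: n2; apply/subr0_eq.
  transitivity (- (c3 a - n%:R * c3 e3) - 2%:R); first by ring.
  by rewrite h; ring.
rewrite /good3 /is_sg2 !cE -[c3 e3 *+ n]mulr_natl mul0rn [0 == 1]eq_sym oner_eq0 /= andbT.
by apply: contra n3; rewrite addr_eq0.
Qed.

Section Coherent.
Variables (P : G -> A) (cP : coherent P).
Let P2 a : d2 (P a) = 0. Proof. by case: cP. Qed.
Let P4 a : d4 (P a) = 0. Proof. by case: cP. Qed.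
Let ME := let: And3 _ _ h := cP in h.

(** Here c2 b = 0, so only the coefficient (c3 a + 1) c4 b survives. The right
    hand side does not depend on b. *)
Lemma coherent4 a b : flat a -> ~~ is_sg2 a -> only4 b ->
  (c3 a + 1)%:K * (P (a + b) - P b) = (c3 a + 1)%:K * P a + d3 (P a).
Proof.
move=> fa sa ob; have nb := only4_flat ob; case/andP: (ob) => /eqP b2 b4.
case/flatP: (fa) => a2 a4.
have := @ME a b sa (nonflat_sg2 nb); rewrite flatDl // => /(_ nb).
rewrite a2 a4 b2 => h; apply: (scalar_inj b4).
apply/subr0_eq; move/eqP: h; rewrite -subr_eq0 => /eqP <-.
by ring.
Qed.

Lemma coherent2 a b : flat a -> ~~ is_sg2 a -> only2 b ->
  (c1 a)%:K * (P (a + sg + b) - P b) = (c1 a)%:K * P a + d1 (P a).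
Proof.
move=> fa sa ob; have nb := only2_flat ob; case/andP: (ob) => b2 /eqP b4.
case/flatP: (fa) => a2 a4.
have := @ME a b sa (nonflat_sg2 nb); rewrite flatDl // => /(_ nb).
rewrite a2 a4 b4 => h; apply: (scalar_inj b2); apply: (@X_inj sg).
apply/subr0_eq; move/eqP: h; rewrite -subr_eq0 => /eqP <-.
by rewrite [a + sg + b]addrAC; ring.
Qed.

Lemma shift4 : exists Q : G -> A, [/\ addflat Q,
  forall a b, flat a -> only4 b -> P (a + b) = P b + Q a
  & forall a, flat a -> ~~ is_sg2 a ->
      (c3 a + 1)%:K * Q a = (c3 a + 1)%:K * P a + d3 (P a)].
Proof.
have [||a fa /andP[g1 g2]|a fa|Q [aQ PQ]] := @shift_extend P only4
  good3 e4.
- exact: only4_e4.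
- exact: only4_shift.
- exists (P a + (c3 a + 1)^-1%:K * d3 (P a)) => b ob.
  apply: (scalar_inj g1); rewrite !mulrDr mulrA -rmorphM divff // rmorph1 mul1r.
  by rewrite -(coherent4 fa g2 ob); ring.
- exact: flat_split3.
exists Q; split=> // a fa sa.
by rewrite -(coherent4 fa sa only4_e4) PQ // ?only4_e4; ring.
Qed.

Lemma shift2 : exists Q : G -> A, [/\ addflat Q,
  forall a b, flat a -> only2 b -> P (a + b) = P b + Q a
  & forall a, flat a -> ~~ is_sg2 a ->
      (c1 a)%:K * Q (a + sg) = (c1 a)%:K * P a + d1 (P a)].
Proof.
have [||a fa /andP[g1 g2]|a fa|Q [aQ PQ]] := @shift_extend P only2
  (fun a => (c1 (a - sg) != 0) && ~~ is_sg2 (a - sg)) e2.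
- exact: only2_e2.
- exact: only2_shift.
- exists (P (a - sg) + (c1 (a - sg))^-1%:K * d1 (P (a - sg))) => b ob.
  apply: (scalar_inj g1); rewrite !mulrDr mulrA -rmorphM divff // rmorph1 mul1r.
  have := @coherent2 (a - sg) b (flatB fa flat_sg) g2 ob.
  by rewrite subrK => <-; ring.
- have [n] := avoid [:: c1 a - 1; c1 a - 2%:R; 1; 2%:R] c1e1.
  rewrite !inE !negb_or => /and4P[n1 n2 n3 n4].
  have fn := flatM0 n flat_e1.
  exists (a - e1 *+ n), (e1 *+ n); rewrite subrK flatB // fn.
  rewrite /is_sg2 !cE -[c1 e1 *+ n]mulr_natl; split=> //.
    rewrite !negb_and; apply/andP; split; last (apply/orP; left).
      apply: contra n1 => /eqP h; apply/eqP; apply/subr0_eq.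
      by rewrite -[RHS]oppr0 -h; ring.
    apply: contra n2 => /eqP h; apply/eqP; apply/subr0_eq.
    by transitivity (1 - (c1 a - n%:R * c1 e1 - 1)); [ring|rewrite h; ring].
  rewrite !negb_and; apply/andP; split; last (apply/orP; left).
    by rewrite subr_eq0.
  apply: contra n4 => /eqP h; apply/eqP; apply/subr0_eq.
  by transitivity ((n%:R * c1 e1 - 1) - 1); [ring|rewrite h; ring].
exists Q; split=> // a fa sa.
by rewrite -(coherent2 fa sa only2_e2) PQ ?only2_e2 // ?flatD ?flat_sg //; ring.
Qed.

End Coherent.

(** For a suitable n both n sg and a + n sg are in general position, and a is
    their difference. *)
Lemma flat_generic_ext (f g : G -> A) : addflat f -> addflat g ->
  (forall a, flat a -> c1 a != 0 -> c3 a != 0 ->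
     (forall n, (0 < n <= 3)%N -> ~~ is_sg2 (a *+ n)) -> f a = g a) ->
  forall a, flat a -> f a = g a.
Proof.
move=> af ag fg a fa.
have [n] := avoid [:: 0; - c1 a; - c3 a; 1 - c1 a; 2%:R^-1 - c1 a; 3%:R^-1 - c1 a] (oner_neq0 F).
rewrite mulr1 !inE !negb_or => /and5P[n0 n1 n3 m1 /andP[m2 m3]].
have fs : flat (sg *+ n) by exact/flatM0/flat_sg.
have fas : flat (a + sg *+ n) by rewrite flatD.
have e : f (sg *+ n) = g (sg *+ n).
  apply: fg; rewrite ?cE //.
  move=> m /andP[m0 _]; rewrite /is_sg2 !cE; apply/negP=> /and4P[/eqP -> _ /eqP h _].
  have /eqP := natF 2; case; transitivity (1 - (- 2%:R) : F); first by ring.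
  by rewrite -h subrr.
have e' : f (a + sg *+ n) = g (a + sg *+ n).
  apply: fg => //.
  - by rewrite !cE; apply: contra n1 => /eqP h; apply/eqP; apply/subr0_eq; rewrite -[RHS]h; ring.
  - by rewrite !cE; apply: contra n3 => /eqP h; apply/eqP; apply/subr0_eq; rewrite -[RHS]h; ring.
  have key (m : nat) : (m.+1)%:R * (c1 a + n%:R) = 1 -> n%:R = (m.+1)%:R^-1 - c1 a.
    move=> h; apply: (mulfI (natF m)); rewrite mulrBr divff ?natF //.
    apply/subr0_eq; transitivity ((m.+1)%:R * (c1 a + n%:R) - 1); first by ring.
    by rewrite h subrr.
  move=> [|[|[|[|m]]]] // _; rewrite /is_sg2 !cE negb_and; apply/orP; left.
  - apply: contra m1 => /eqP h; apply/eqP; rewrite -[1 - _]/(1%:R - _) -[1%:R in RHS]invr1.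
    by apply: (key 0%N); rewrite -[RHS]h; ring.
  - by apply: contra m2 => /eqP h; apply/eqP/key; rewrite -[RHS]h; ring.
  by apply: contra m3 => /eqP h; apply/eqP/key; rewrite -[RHS]h; ring.
by apply: (@addIr _ (f (sg *+ n))); rewrite -af // e' e -ag.
Qed.

(** The polynomial a n^2 + b n + c takes these values at n = 1, 2, 3. *)
Lemma quadratic_zero (a b c : A) : a + b + c = 0 ->
  4%:R * a + 2%:R * b + c = 0 -> 9%:R * a + 3%:R * b + c = 0 ->
  [/\ a = 0, b = 0 & c = 0].
Proof.
move=> h1 h2 h3.
have c0 : c = 0.
  transitivity (3%:R * (a + b + c) - 3%:R * (4%:R * a + 2%:R * b + c)
    + (9%:R * a + 3%:R * b + c)); first by ring.
  by rewrite h1 h2 h3; ring.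
have a0 : a = 0.
  apply: (scalar_eq0 (natF 1)); rewrite rmorph_nat.
  transitivity ((a + b + c) - 2%:R * (4%:R * a + 2%:R * b + c)
    + (9%:R * a + 3%:R * b + c)); first by ring.
  by rewrite h1 h2 h3; ring.
by split=> //; rewrite -h1 a0 c0; ring.
Qed.

Section TranslationAnalysis.
Variables (P Q Q' : G -> A).
Hypotheses (aQ : addflat Q) (aQ' : addflat Q').
Hypothesis QP : forall a, flat a -> ~~ is_sg2 a ->
  (c3 a + 1)%:K * Q a = (c3 a + 1)%:K * P a + d3 (P a).
Hypothesis QP' : forall a, flat a -> ~~ is_sg2 a ->
  (c1 a)%:K * Q' (a + sg) = (c1 a)%:K * P a + d1 (P a).

(** Eliminate P: c1 a + d1 applied to the law for Q and c3 a + 1 + d3 applied to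
    the law for Q' have the same right hand side, because d1 and d3 commute. *)
Lemma translation_compat a : flat a -> ~~ is_sg2 a ->
  (c1 a * (c3 a + 1))%:K * Q a + (c3 a + 1)%:K * d1 (Q a)
  = (c1 a * (c3 a + 1))%:K * (Q' a + Q' sg) + (c1 a)%:K * (d3 (Q' a) + d3 (Q' sg)).
Proof.
move=> fa sa; rewrite -(derD D3) -aQ' ?flat_sg //.
transitivity ((c1 a)%:K * ((c3 a + 1)%:K * Q a) + d1 ((c3 a + 1)%:K * Q a)).
  by rewrite !dlin; ring.
transitivity ((c3 a + 1)%:K * ((c1 a)%:K * Q' (a + sg)) + d3 ((c1 a)%:K * Q' (a + sg))).
  by rewrite QP // QP' // !dlin d31; ring.
by rewrite !dlin; ring.
Qed.

(** At n a the identity [translation_compat] is n times a quadratic polynomial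
    in n, since Q and Q' are additive. The values n = 1, 2, 3 separate its
    coefficients. *)
Lemma translation_generic a : flat a -> c1 a != 0 -> c3 a != 0 ->
  (forall n, (0 < n <= 3)%N -> ~~ is_sg2 (a *+ n)) ->
  [/\ Q a = Q' a, d3 (Q a) = (c3 a)%:K * d3 (Q' sg)
    & d1 (Q a) = (c1 a)%:K * (Q' sg + d3 (Q' sg))].
Proof.
move=> fa a1 a3 san.
pose p := (c1 a * c3 a)%:K * (Q a - Q' a).
pose q := (c1 a)%:K * Q a + (c3 a)%:K * d1 (Q a) - (c1 a)%:K * Q' a
  - (c1 a * c3 a)%:K * Q' sg - (c1 a)%:K * d3 (Q' a).
pose r := d1 (Q a) - (c1 a)%:K * (Q' sg + d3 (Q' sg)).
have h n : (0 < n <= 3)%N -> (n * n)%:R * p + n%:R * q + r = 0.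
  move=> n3; have := translation_compat (flatM0 n fa) (san n n3).
  rewrite !(addflatMn _ aQ fa, addflatMn _ aQ' fa) !cE.
  rewrite -(mulr_natl (Q a)) -(mulr_natl (Q' a)) -(mulr_natl (c1 a)) -(mulr_natl (c3 a)).
  rewrite -!(rmorph_nat (in_alg A)) !dlin => e.
  have n0 : n%:R != 0 :> F by case: n {e} n3.
  apply: (scalar_eq0 n0); move/eqP: e; rewrite -subr_eq0 => /eqP <-.
  by rewrite /p /q /r natrM; ring.
have [p0 q0 r0] : [/\ p = 0, q = 0 & r = 0].
  by apply: quadratic_zero; [have := h 1%N|have := h 2%N|have := h 3%N];
    rewrite ?mul1r; apply.
have eQ : Q a = Q' a.
  by apply/subr0_eq/(@scalar_eq0 _ _ (c1 a * c3 a)); rewrite ?mulf_neq0.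
have e1' : d1 (Q a) = (c1 a)%:K * (Q' sg + d3 (Q' sg)) by apply/subr0_eq.
split=> //; apply: (scalar_inj a1); apply/subr0_eq; rewrite -[RHS]oppr0 -q0 /q e1' -eQ.
by ring.
Qed.

Lemma translation_laws a : flat a ->
  [/\ Q a = Q' a, d3 (Q a) = (c3 a)%:K * d3 (Q' sg)
    & d1 (Q a) = (c1 a)%:K * (Q' sg + d3 (Q' sg))].
Proof.
move=> fa; split; move: a fa; apply: flat_generic_ext => //.
- by move=> a fa h1 h3 hn; case: (translation_generic fa h1 h3 hn).
- by move=> a b fa fb; rewrite aQ // derD.
- by move=> a b fa fb; rewrite cE; ring.
- by move=> a fa h1 h3 hn; case: (translation_generic fa h1 h3 hn).
- by move=> a b fa fb; rewrite aQ // derD.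
- by move=> a b fa fb; rewrite cE; ring.
by move=> a fa h1 h3 hn; case: (translation_generic fa h1 h3 hn).
Qed.

Hypothesis Q2 : forall a, d2 (Q a) = 0.
Hypothesis Q4 : forall a, d4 (Q a) = 0.

(** By [translation_laws], q = Q sg has d3 q in F W and q + d3 q in F x W, and
    these two elements govern all derivatives of all Q a. What is left of Q a
    has zero derivatives. *)
Lemma translation_form : exists (k l : F) (nu : G -> F),
  [/\ addflat nu, nu sg = 0 & forall a, flat a ->
    Q a = (l * c1 a)%:K * (x * W) + (k * c3 a)%:K * W + (nu a)%:K].
Proof.
pose q := Q sg.
have qE : Q' sg = q by rewrite /q; case: (translation_laws flat_sg).
have L3 a : flat a -> d3 (Q a) = (c3 a)%:K * d3 q.
  by move=> fa; case: (translation_laws fa); rewrite qE.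
have L1 a : flat a -> d1 (Q a) = (c1 a)%:K * (q + d3 q).
  by move=> fa; case: (translation_laws fa); rewrite qE.
have d13 : d1 (d3 q) = 0.
  apply: (scalar_eq0 c3e3); rewrite -derZ // -L3 ?flat_e3 // -d31 L1 ?flat_e3 //.
  by rewrite cE rmorph0 mul0r der0.
have d33 : d3 (d3 q) = - d3 q.
  apply/eqP; rewrite -addr_eq0 addrC; apply/eqP.
  apply: (scalar_eq0 c1e1); rewrite -derD // -derZ // -L1 ?flat_e1 // d31.
  by rewrite L3 ?flat_e1 // cE rmorph0 mul0r der0.
have d1q : d1 q = q + d3 q by rewrite {1}/q L1 ?flat_sg // cE rmorph1 mul1r.
have q2 : d2 q = 0 by exact: Q2.
have q4 : d4 q = 0 by exact: Q4.
have d23 : d2 (d3 q) = 0 by rewrite -d32 q2 der0.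
have d43' : d4 (d3 q) = 0 by rewrite d43 q4 der0.
have [l el] : exists l : F, q + d3 q = l%:K * (x * W).
  by apply: eigZ; rewrite !derD // ?d1q ?d13 ?q2 ?d23 ?d33 ?q4 ?d43' ?addr0 ?subrr.
have [k ek] : exists k : F, - d3 q = k%:K * W.
  by apply: eigW; rewrite derN // ?d13 ?d23 ?d33 ?d43' ?oppr0.
have dW' : d3 q = - (k%:K * W) by rewrite -ek opprK.
have h a : exists n : F, flat a ->
    Q a = (l * c1 a)%:K * (x * W) + (k * c3 a)%:K * W + n%:K.
  have [fa|] := boolP (flat a); last by exists 0.
  have [n en] : exists n : F, Q a - ((l * c1 a)%:K * (x * W) + (k * c3 a)%:K * W) = n%:K.
    apply: eig0.
    - by rewrite derB // L1 // el !dlin !dx !dX; ring.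
    - by rewrite derB // Q2 !dlin !dx !dX; ring.
    - by rewrite derB // L3 // dW' !dlin !dx !dX; ring.
    - by rewrite derB // Q4 !dlin !dx !dX; ring.
  by exists n => _; rewrite -en addrC subrK.
have [nu hnu] := choice h.
have Kinj : injective (in_alg A) by exact: fmorph_inj.
exists k, l, nu; split=> // [a b fa fb|].
  apply: Kinj; have := aQ fa fb; rewrite !hnu ?flatD // !cE => e.
  rewrite rmorphD; apply: (addrI ((l * (c1 a + c1 b))%:K * (x * W) + (k * (c3 a + c3 b))%:K * W)).
  by rewrite e; ring.
have := hnu _ flat_sg; rewrite !cE !mulr1.
rewrite -el -ek -/q => e; apply: Kinj; rewrite rmorph0.
by apply: (addrI q); rewrite addr0 {2}e; ring.
Qed.
End TranslationAnalysis.

(** Let S a b be the defect T (a + b) - T b - nu a. The hypothesis only bounds a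
    combination of S (a + sg) b and S a b. If c2 b = 0, the first term is
    absent. If not, exponents with c3 = -1 lose the second term; this makes S
    vanish at e1, then at sg. After that S a b does not change when a is moved
    by multiples of e1 or by sg, whereas the coefficient of the first term does,
    and S a b = 0 follows. *)
Lemma translation_extend (T : G -> A) (nu : G -> F) : addflat nu -> nu sg = 0 ->
  (forall a b, flat a -> ~~ is_sg2 a -> ~~ flat b ->
    (c1 a * c2 b)%:K * x * (T (a + sg + b) - T b - (nu a)%:K)
    + ((c3 a + 1) * c4 b)%:K * (T (a + b) - T b - (nu a)%:K) = 0) ->
  forall a b, flat a -> ~~ flat b -> T (a + b) = T b + (nu a)%:K.
Proof.
move=> anu nus Teq.
pose S a b := T (a + b) - T b - (nu a)%:K.
have SD a a' b : flat a -> flat a' -> S (a + a') b = S a (a' + b) + S a' b.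
  by move=> fa fa'; rewrite /S anu // rmorphD -(addrA a); ring.
have S0 b : S 0 b = 0.
  by rewrite /S add0r (addflat0 anu) rmorph0 !subr0 subrr.
suff Sz a b : flat a -> ~~ flat b -> S a b = 0.
  move=> a b fa nb; apply/subr0_eq; transitivity (S a b); [by rewrite /S; ring|exact: Sz].
move=> fa nb; have [b2|b2] := eqVneq (c2 b) 0.
  have ob : only4 b by move: nb; rewrite /flat /only4 b2 eqxx.
  have S4 a' b' : flat a' -> good3 a' -> only4 b' -> S a' b' = 0.
    move=> fa' /andP[h3 hs] ob'; have := Teq a' b' fa' hs (only4_flat ob').
    case/andP: ob' => /eqP -> h4; rewrite mulr0 rmorph0 !mul0r add0r.
    exact/scalar_eq0/mulf_neq0.
  have [a1' [a2' [f1 f2 g1 g2 ->]]] := flat_split3 fa.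
  by rewrite SD // !S4 ?addr0 //; exact: only4_shift.
pose K a' := flat a' /\ forall b', c2 b' != 0 -> S a' b' = 0.
have shift2' a' b' : flat a' -> c2 b' != 0 -> c2 (a' + b') != 0.
  by case/flatP=> h _; rewrite cE h add0r.
have KD a' a'' : K a' -> K a'' -> K (a' + a'').
  move=> [f1 h1] [f2 h2]; split=> [|b' hb']; first by rewrite flatD.
  by rewrite SD // h1 ?h2 ?addr0 //; exact: shift2'.
have KN a' : K a' -> K (- a').
  move=> [f1 h1]; split=> [|b' hb']; first by rewrite flatN.
  have := SD a' (- a') b' f1; rewrite subrr S0 flatN => /(_ f1).
  by rewrite h1 ?add0r //; apply: shift2' => //; rewrite flatN.
have c2nf b' : c2 b' != 0 -> ~~ flat b' by move=> h; rewrite /flat (negbTE h).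
have Ks a' : flat a' -> c3 a' = 0 -> c1 a' != 1 -> K a'.
  move=> f1 h3 h1; split=> // b' hb'.
  have ns : ~~ is_sg2 (a' - sg).
    rewrite /is_sg2 !cE h3; apply/negP=> /and4P[_ _ /eqP h _].
    by have /eqP := natF 0; case; transitivity ((0 - 1) + 2%:R : F); [ring|rewrite h; ring].
  have := Teq (a' - sg) b' (flatB f1 flat_sg) ns (c2nf _ hb').
  rewrite !cE h3 (_ : 0 - 1 + 1 = 0) ?mul0r ?rmorph0 ?mul0r ?addr0; last by ring.
  have -> : nu (a' - sg) = nu a'.
    transitivity (nu (a' - sg + sg)); last by rewrite subrK.
    by rewrite (anu (a' - sg) sg) ?flat_sg ?flatB ?flat_sg // nus addr0.
  rewrite subrK -mulrA => /scalar_eq0; rewrite mulf_neq0 ?subr_eq0 // => /(_ isT) h.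
  by apply: (@X_inj sg); rewrite mulr0 -[RHS]h.
have Ke : K e1.
  have [e11|] := eqVneq (c1 e1) 1; last by apply: Ks; rewrite ?flat_e1 ?cE.
  rewrite -[e1]opprK; apply/KN/Ks; rewrite ?flatN ?flat_e1 ?cE ?oppr0 // e11.
  by rewrite eq_sym -addr_eq0 (natF 1).
have nse1 : ~~ is_sg2 e1.
  rewrite /is_sg2 !cE; apply/negP=> /and4P[_ _ /eqP h _].
  by have /eqP := natF 1; case; rewrite -[LHS]opprK -h oppr0.
have Ksg : K sg.
  suff : K (e1 + sg - e1) by rewrite addrAC subrr add0r.
  apply: KD (KN _ Ke); split=> [|b' hb']; first by rewrite flatD ?flat_sg ?flat_e1.
  have := Teq e1 b' flat_e1 nse1 (c2nf _ hb').
  rewrite -/(S e1 b') Ke.2 // mulr0 addr0 -mulrA => /scalar_eq0; rewrite mulf_neq0 // => /(_ isT) h.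
  by apply: (@X_inj sg); rewrite mulr0 -[RHS]h /S anu ?flat_sg ?flat_e1 // nus addr0.
(* Both n and n.+1 will be used as multiples of e1, and sigma2 has c1 = 1. *)
have [n] := avoid [:: 1 - c1 a; 1 - c1 a - c1 e1] c1e1.
rewrite !inE !negb_or => /andP[n1 n2].
have Kn m : K (e1 *+ m).
  elim: m => [|m IH]; last by rewrite mulrS; apply: KD.
  by split=> [|b' _]; rewrite ?flat0 ?S0.
have h m : (m%:R * c1 e1 != 1 - c1 a) ->
    ((c1 a + m%:R * c1 e1) * c2 b)%:K * x * S a b + ((c3 a + 1) * c4 b)%:K * S a b = 0.
  move=> hm; have fm := flatM0 m flat_e1.
  have ns : ~~ is_sg2 (a + e1 *+ m).
    rewrite /is_sg2 !cE negb_and -[c1 e1 *+ m]mulr_natl; apply/orP; left.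
    apply: contra hm => /eqP hm; apply/eqP/subr0_eq.
    by transitivity (c1 a + m%:R * c1 e1 - 1); [ring|rewrite hm subrr].
  have fam' : flat (a + e1 *+ m) by rewrite flatD.
  have := Teq (a + e1 *+ m) b fam' ns nb; rewrite -/(S (a + e1 *+ m) b).
  have -> : T (a + e1 *+ m + sg + b) - T b - (nu (a + e1 *+ m))%:K = S (a + (e1 *+ m + sg)) b.
    by rewrite /S !addrA [in RHS]anu ?flat_sg // nus addr0.
  have [fK hK] := KD _ _ (Kn m) Ksg.
  have -> : S (a + (e1 *+ m + sg)) b = S a b.
    by rewrite addrC SD // hK ?add0r //; apply: shift2'.
  have -> : S (a + e1 *+ m) b = S a b.
    by rewrite addrC SD // (Kn m).2 ?add0r //; apply: shift2'.
  by rewrite !cE -[c1 e1 *+ m]mulr_natl => <-; ring.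
apply: (@scalar_eq0 _ _ (c1 e1 * c2 b)); first by rewrite mulf_neq0.
apply: (@X_inj sg); rewrite mulr0 -[RHS](subrr 0) -{1}(h n.+1) -?(h n) //.
  by rewrite mulrS; ring.
apply: contra n2 => /eqP hm; apply/eqP/subr0_eq.
transitivity (n.+1%:R * c1 e1 - (1 - c1 a)); last by rewrite hm subrr.
by rewrite mulrS; ring.
Qed.

(** * Additive families and the Poincare lemma *)

(** Formally the brackets with W t_p for p = 1, ..., 4, which make sense without
    the variable t_p: they are the maps dA_p of A4. *)
Definition ham1 v := x * W * d2 v.
Definition ham2 v := - (x * W * d1 v).
Definition ham3 v := W * d4 v.
Definition ham4 v := - (W * (v + d3 v)).

Lemma brder_ham1 : brder ham1.
Proof.
split=> [c u v|u v]; rewrite /ham1; first by rewrite !dlin; ring.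
by rewrite /br !dlin ?dx ?dX ?dcomm; ring.
Qed.
Lemma brder_ham2 : brder ham2.
Proof.
split=> [c u v|u v]; rewrite /ham2; first by rewrite !dlin; ring.
by rewrite /br !dlin ?dx ?dX ?dcomm; ring.
Qed.
Lemma brder_ham3 : brder ham3.
Proof.
split=> [c u v|u v]; rewrite /ham3; first by rewrite !dlin; ring.
by rewrite /br !dlin ?dx ?dX ?dcomm; ring.
Qed.
Lemma brder_ham4 : brder ham4.
Proof.
split=> [c u v|u v]; rewrite /ham4; first by rewrite !dlin; ring.
by rewrite /br !dlin ?dx ?dX ?dcomm; ring.
Qed.

Lemma brderD E E' : brder E -> brder E' -> brder (fun v => E v + E' v).
Proof.
move=> [lE hE] [lE' hE']; split=> [c u v|u v]; first by rewrite lE lE'; ring.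
by rewrite hE hE' brDl brDr; ring.
Qed.
Lemma brderZ c E : brder E -> brder (fun v => c%:K * E v).
Proof.
move=> [lE hE]; split=> [c' u v|u v]; first by rewrite lE; ring.
by rewrite hE brZl brZr; ring.
Qed.

Lemma brder_sum (I : Type) (r : seq I) (c : I -> F) (E : I -> A -> A) :
  (forall p, brder (E p)) -> brder (fun v => \sum_(p <- r) (c p)%:K * E p v).
Proof.
move=> hE; elim: r => [|p r IH].
  by split=> [k u v|u v]; rewrite !big_nil ?br0l ?br0r; ring.
have -> : (fun v => \sum_(q <- p :: r) (c q)%:K * E q v)
    = (fun v => (c p)%:K * E p v + \sum_(q <- r) (c q)%:K * E q v).
  by apply/funext => v; rewrite big_cons.
by apply: brderD IH; exact: brderZ.
Qed.

(** The part l c1 a x W + k c3 a W of the translation constant in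
    [translation_form] is the one of a combination of ham2 and ham4. *)
Lemma normalise E : isder E -> comm d2 E -> comm d4 E ->
  exists (k l : F) (nu : G -> F) (P : G -> A),
    let E' := fun v => E v - (l%:K * ham2 v + k%:K * ham4 v) in
    [/\ isder E', multipliers E' P, addflat nu, nu sg = 0 &
      forall a b, flat a -> only2 b || only4 b -> P (a + b) = P b + (nu a)%:K].
Proof.
move=> hE E2 E4; have [P hP] := multipliers_exist hE E2 E4.
have cP := multipliers_coherent hE hP.
have [Q [aQ PQ QP]] := shift4 cP; have [Q' [aQ' PQ' QP']] := shift2 cP.
have [P2 P4 _] := cP.
have QE a : flat a -> Q a = P (a + e4) - P e4.
  by move=> fa; rewrite PQ ?only4_e4 //; ring.
pose R a := P (a + e4) - P e4.
have aR : addflat R by move=> a b fa fb; rewrite /R -!QE ?flatD // aQ.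
have RP a : flat a -> ~~ is_sg2 a -> (c3 a + 1)%:K * R a = (c3 a + 1)%:K * P a + d3 (P a).
  by move=> fa sa; rewrite /R -QE // QP.
have R2 a : d2 (R a) = 0 by rewrite /R derB // !P2 subrr.
have R4 a : d4 (R a) = 0 by rewrite /R derB // !P4 subrr.
have [k [l [nu [anu nus Rnu]]]] := translation_form aR aQ' RP QP' R2 R4.
have R' a : flat a -> Q' a = R a.
  by move=> fa; case: (translation_laws aR aQ' RP QP' fa).
exists (- k), (- l), nu.
exists (fun a => P a - ((l * c1 a)%:K * (x * W) + (k * (c3 a + 1))%:K * W)) => E'.
have hE' : isder E'.
  by apply: isderB hE _; apply: brderD; apply: brderZ; [exact: brder_ham2|exact: brder_ham4].
split=> // [a|a b fa ob].
  case: (hP a) => Pa2 Pa4 PaX; split.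
  - by rewrite derB // Pa2 !dlin !dx !dX; ring.
  - by rewrite derB // Pa4 !dlin !dx !dX; ring.
  move=> /PaX; congr negl; rewrite /E' /ham2 /ham4 !dX; ring.
have -> : P (a + b) = P b + R a.
  by case/orP: ob => ob; [rewrite PQ' // R'|rewrite PQ // QE].
by rewrite Rnu // !cE; ring.
Qed.

Section AdditiveFamily.
Variables (P : G -> A) (nu : G -> F) (cP : coherent P).
Hypotheses (anu : addflat nu) (nus : nu sg = 0).
Hypothesis Pnu : forall a b, flat a -> only2 b || only4 b -> P (a + b) = P b + (nu a)%:K.

Let P2 a : d2 (P a) = 0. Proof. by case: cP. Qed.
Let P4 a : d4 (P a) = 0. Proof. by case: cP. Qed.
Let ME := let: And3 _ _ h := cP in h.

(** The translation laws in the directions 2 and 4 express d1 (P a) and d3 (P a)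
    by nu a - P a, which gives the functional equation the shape required by
    [translation_extend]. *)
Lemma translate a b : flat a -> ~~ flat b -> P (a + b) = P b + (nu a)%:K.
Proof.
apply: translation_extend => // {a b} a b fa sa nb.
have h4 := coherent4 cP fa sa only4_e4; rewrite Pnu ?only4_e4 ?orbT // in h4.
have h2 := coherent2 cP fa sa only2_e2.
rewrite Pnu ?only2_e2 ?flatD ?flat_sg // anu ?flat_sg // nus addr0 in h2.
have e3' : d3 (P a) = (c3 a + 1)%:K * ((nu a)%:K - P a).
  by apply: (addrI ((c3 a + 1)%:K * P a)); rewrite -h4; ring.
have e1' : d1 (P a) = (c1 a)%:K * ((nu a)%:K - P a).
  by apply: (addrI ((c1 a)%:K * P a)); rewrite -h2; ring.
have := @ME a b sa (nonflat_sg2 nb); rewrite flatDl // => /(_ nb).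
case/flatP: (fa) => -> ->; rewrite e3' e1' => h.
by rewrite [a + sg + b]addrAC; apply: (eq_sub1 h); ring.
Qed.

(** Translating a by a flat e changes the functional equation by a multiple of
    the defect P (a + b) - P a - P b, with a nonzero factor for e = e1 or e =
    e3. The defect being zero, the rest of the equation is the symmetry of the
    second claim. *)
Lemma additive_nonflat a b : ~~ flat a -> ~~ flat b -> ~~ flat (a + b) ->
  P (a + b) = P a + P b /\
  x * (c2 b)%:K * d1 (P a) + (c4 b)%:K * d3 (P a)
  = x * (c2 a)%:K * d1 (P b) + (c4 a)%:K * d3 (P b).
Proof.
move=> na nb nab.
have Psg c : ~~ flat c -> P (c + sg) = P c.
  by move=> nc; rewrite addrC translate ?flat_sg // nus rmorph0 addr0.
have h := ME (nonflat_sg2 na) (nonflat_sg2 nb) nab; rewrite Psg // in h.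
have shift e : flat e -> 
  (c1 e * c2 b)%:K * x * (P (a + b) - P a - P b) + (c3 e * c4 b)%:K * (P (a + b) - P a - P b) = 0.
  move=> fe; have nea : ~~ flat (e + a) by rewrite flatDl.
  have neab : ~~ flat (e + a + b) by rewrite -addrA flatDl.
  have := ME (nonflat_sg2 nea) (nonflat_sg2 nb) neab; rewrite Psg //.
  rewrite -(addrA e) (translate fe na) (translate fe nab) !(derD D1, derD D3, derK D1, derK D3) !cE.
  case/flatP: (fe) => -> -> h'.
  by apply: (eq_sub2 h' h); ring.
have G0 : P (a + b) - P a - P b = 0.
  move: nb; rewrite negb_and => /orP[] h'.
    have := shift _ flat_e1; rewrite !cE !mul0r rmorph0 mul0r addr0 -mulrA => /scalar_eq0.
    rewrite mulf_neq0 // => /(_ isT) e; apply: (@X_inj sg); rewrite e; ring.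
  have := shift _ flat_e3; rewrite !cE !mul0r rmorph0 !mul0r add0r => /scalar_eq0.
  by rewrite mulf_neq0 // => /(_ isT).
have Pab : P (a + b) = P a + P b by apply: (eq_sub1 G0); ring.
by split=> //; rewrite Pab in h; apply/esym/(eq_sub1 h); ring.
Qed.

Lemma nonflat_shift a b : exists c, [/\ ~~ flat c, ~~ flat (a + c) & ~~ flat (b + c)].
Proof.
have [n] := avoid [:: 0; - c2 a; - c2 b] c2e2.
rewrite !inE !negb_or => /and3P[n0 na nb]; exists (e2 *+ n).
rewrite /flat !cE -[c2 e2 *+ n]mulr_natl !negb_and n0.
have ha : c2 a + n%:R * c2 e2 != 0 by rewrite addrC addr_eq0.
have hb : c2 b + n%:R * c2 e2 != 0 by rewrite addrC addr_eq0.
by rewrite ha hb.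
Qed.

(** With the translation constant in place of P on the flat exponents, P becomes
    additive everywhere. *)
Let Pt a := if flat a then (nu a)%:K else P a.

Let PtD a b : Pt (a + b) = Pt a + Pt b.
Proof.
rewrite /Pt; have [fa|na] := boolP (flat a); have [fb|nb] := boolP (flat b).
- by rewrite flatD // fa anu // rmorphD.
- by rewrite flatDl // (negbTE nb) translate // addrC.
- by rewrite flatD // (negbTE na) addrC translate // addrC.
have [fab|nab] := boolP (flat (a + b)); last by case: (additive_nonflat na nb nab).
have [c [nc nac nbc]] := nonflat_shift a b.
have nabc : ~~ flat (a + (b + c)) by rewrite addrA flatDl.
have [e _] := additive_nonflat na nbc nabc.
have [e' _] := additive_nonflat nb nc nbc.
have e'' := translate fab nc; rewrite -addrA e e' in e''.
by apply/esym/(eq_sub1 e''); ring.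
Qed.

Let Pt_closed a b :
  x * (c2 b)%:K * d1 (Pt a) + (c4 b)%:K * d3 (Pt a)
  = x * (c2 a)%:K * d1 (Pt b) + (c4 a)%:K * d3 (Pt b).
Proof.
have Pt_flat c : flat c -> d1 (Pt c) = 0 /\ d3 (Pt c) = 0.
  by rewrite /Pt => ->; rewrite !derK.
have PtN c : ~~ flat c -> Pt c = P c by rewrite /Pt => /negbTE->.
have [fa|na] := boolP (flat a).
  by have [-> ->] := Pt_flat a fa; case/flatP: fa => -> ->; rewrite !rmorph0; ring.
have [fb|nb] := boolP (flat b).
  by have [-> ->] := Pt_flat b fb; case/flatP: fb => -> ->; rewrite !rmorph0; ring.
have [fab|nab] := boolP (flat (a + b)); last first.
  by rewrite !PtN //; case: (additive_nonflat na nb nab).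
have [c [nc nac nbc]] := nonflat_shift a b.
have nabc : ~~ flat (a + (b + c)) by rewrite addrA flatDl.
have [_ e] := additive_nonflat na nbc nabc.
have [_ e'] := additive_nonflat na nc nac.
rewrite -!PtN // PtD !(derD D1, derD D3) !cE in e e' *.
by apply: (eq_sub2 e e'); ring.
Qed.

(** An additive family is linear in c2 a and c4 a up to a scalar mu a, because
    [Pt_closed] at (a, e2) and (a, e4) determines the derivatives of P a. At
    (e4, e2) it says that (p, q) is closed. *)
Lemma family_potentials : exists (p q : A) (mu : G -> F),
  [/\ [/\ d2 p = 0, d4 p = 0, d2 q = 0, d4 q = 0 & d3 p = x * d1 q],
      forall a b, mu (a + b) = mu a + mu b, mu sg = 0
    & forall a, ~~ flat a -> P a = (c2 a)%:K * p + (c4 a)%:K * q + (mu a)%:K].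
Proof.
pose p := (c2 e2)^-1%:K * Pt e2; pose q := (c4 e4)^-1%:K * Pt e4.
have pE : Pt e2 = (c2 e2)%:K * p by rewrite /p mulrA -rmorphM divff // rmorph1 mul1r.
have qE : Pt e4 = (c4 e4)%:K * q by rewrite /q mulrA -rmorphM divff // rmorph1 mul1r.
have Pt2 a : d2 (Pt a) = 0 by rewrite /Pt; case: ifP => _; rewrite ?derK ?P2.
have Pt4 a : d4 (Pt a) = 0 by rewrite /Pt; case: ifP => _; rewrite ?derK ?P4.
have p2 : d2 p = 0 by rewrite /p (derZ D2) Pt2 mulr0.
have p4 : d4 p = 0 by rewrite /p (derZ D4) Pt4 mulr0.
have q2 : d2 q = 0 by rewrite /q (derZ D2) Pt2 mulr0.
have q4 : d4 q = 0 by rewrite /q (derZ D4) Pt4 mulr0.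
clearbody p q.
have C2 a : x * d1 (Pt a) = x * (c2 a)%:K * d1 p + (c4 a)%:K * d3 p.
  apply: (scalar_inj c2e2); have := Pt_closed a e2; rewrite pE (derZ D1) (derZ D3) !cE => h.
  by apply: (eq_sub1 h); rewrite !rmorph0; ring.
have C4 a : d3 (Pt a) = x * (c2 a)%:K * d1 q + (c4 a)%:K * d3 q.
  apply: (scalar_inj c4e4); have := Pt_closed a e4; rewrite qE (derZ D1) (derZ D3) !cE => h.
  by apply: (eq_sub1 h); rewrite !rmorph0; ring.
have pq : d3 p = x * d1 q.
  apply: (scalar_inj c4e4); have := C2 e4; rewrite qE (derZ D1) !cE => h.
  by apply/esym/(eq_sub1 h); rewrite !rmorph0; ring.
have h a : exists k : F, Pt a - (c2 a)%:K * p - (c4 a)%:K * q = k%:K.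
  apply: eig0.
  - apply: (@X_inj sg); rewrite mulr0 !(derB D1) !(derZ D1).
    by apply: (eq_sub1 (C2 a)); rewrite pq; ring.
  - by rewrite !(derB D2) !(derZ D2) Pt2 p2 q2; ring.
  - rewrite !(derB D3) !(derZ D3) C4 pq; ring.
  by rewrite !(derB D4) !(derZ D4) Pt4 p4 q4; ring.
have [mu hmu] := choice h.
have Kinj : injective (in_alg A) by exact: fmorph_inj.
exists p, q, mu; split=> //.
- move=> a b; apply: Kinj; transitivity ((mu a)%:K + (mu b)%:K : A).
    by rewrite -!hmu PtD !cE; ring.
  by rewrite rmorphD.
- apply: Kinj; rewrite -hmu /Pt flat_sg nus !cE !rmorph0; ring.
by move=> a na; rewrite -hmu /Pt (negbTE na); ring.
Qed.

End AdditiveFamily.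

Hypothesis diag1 : ~~ inf pos1 -> forall v, d1 (d1 v) = 0 -> d1 v = 0.

(** Integrate p / x along d1. What is then left of q is constant along d1 and is
    integrated along d3 + 1. The two errors of integration are in F W. *)
Lemma poincare p q : d2 p = 0 -> d4 p = 0 -> d2 q = 0 -> d4 q = 0 ->
  d3 p = x * d1 q -> exists (f : A) (k l : F),
  [/\ d2 f = 0, d4 f = 0, p = x * d1 f + k%:K * (x * W) & q = f + d3 f + l%:K * W].
Proof.
move=> p2 p4 q2 q4 pq.
pose p' := X (- sg) * p.
have pE : p = x * p' by rewrite /p' mulrA [x * _]mulrC Xsg_inv mul1r.
have p'2 : d2 p' = 0 by apply: (@X_inj sg); rewrite mulr0 -p2 pE !dlin dx; ring.
have p'4 : d4 p' = 0 by apply: (@X_inj sg); rewrite mulr0 -p4 pE !dlin dx; ring.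
have p'q : p' + d3 p' = d1 q by apply: (@X_inj sg); rewrite -pq pE !dlin dx; ring.
clearbody p'.
have [I [lI hI I2 I3 I4]] := prim1.
have := hI p'; rewrite rmorph0 !mul0r !addr0; set f1 := I p'; set K1 := p' - d1 f1.
case=> K1d K1i; rewrite ?mul0r ?addr0 in K1d; pose q' := q - (f1 + d3 f1).
have f12 : d2 f1 = 0 by rewrite /f1 I2 p'2 (linop0 lI).
have f14 : d4 f1 = 0 by rewrite /f1 I4 p'4 (linop0 lI).
have K1E : K1 = p' - d1 f1 by [].
clearbody K1 f1.
have K12 : d2 K1 = 0 by rewrite K1E (derB D2) d21 p'2 f12 (der0 D1) subrr.
have K14 : d4 K1 = 0 by rewrite K1E (derB D4) d41 p'4 f14 (der0 D1) subrr.
have q'1 : d1 q' = K1 + d3 K1.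
  by rewrite /q' K1E !dlin -p'q d31; ring.
have q'2 : d2 q' = 0 by rewrite /q' (derB D2) (derD D2) -d32 q2 f12 (der0 D3) addr0 subrr.
have q'4 : d4 q' = 0 by rewrite /q' (derB D4) (derD D4) d43 q4 f14 (der0 D3) addr0 subrr.
have q'E : q' = q - (f1 + d3 f1) by [].
clearbody q'.
have q'0 : d1 q' = 0.
  have [i1|i1] := boolP (inf pos1); first by rewrite q'1 K1i // (der0 D3) addr0.
  by apply: diag1 => //; rewrite q'1 derD // -d31 K1d (der0 D3) addr0.
have [k ek] : negl K1.
  apply: eigW => //; apply/eqP; rewrite -addr_eq0 addrC -q'1 q'0 eqxx //.
have [I' [lI' hI' I'1 I'2 I'4]] := prim3.
have := hI' q'; rewrite rmorph1 !mul1r; set f2 := I' q'; set K3 := q' - _.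
case=> K3d _; rewrite ?mul1r in K3d.
have f21 : d1 f2 = 0 by rewrite /f2 I'1 q'0 (linop0 lI').
have f22 : d2 f2 = 0 by rewrite /f2 I'2 q'2 (linop0 lI').
have f24 : d4 f2 = 0 by rewrite /f2 I'4 q'4 (linop0 lI').
have K3E : K3 = q' - (d3 f2 + f2) by [].
clearbody K3 f2.
have [l el] : negl K3.
  apply: eigW.
  - by rewrite K3E (derB D1) (derD D1) -d31 q'0 f21 (der0 D3) addr0 subrr.
  - by rewrite K3E (derB D2) (derD D2) -d32 q'2 f22 (der0 D3) addr0 subrr.
  - by apply/eqP; rewrite -addr_eq0 K3d.
  by rewrite K3E (derB D4) (derD D4) d43 q'4 f24 (der0 D3) addr0 subrr.
exists (f1 + f2), k, l; split.
- by rewrite derD // f12 f22 addr0.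
- by rewrite derD // f14 f24 addr0.
- by rewrite pE derD // f21 mulrCA -ek K1E; ring.
by rewrite -el K3E q'E (derD D3); ring.
Qed.

Hypothesis weight_der : forall mu : G -> F, (forall a b, mu (a + b) = mu a + mu b) ->
  mu sg = 0 -> exists M, brder M /\ forall a i, M (mon a i) = (mu a)%:K * mon a i.

(** The multiplier of ad f + k1 ham1 + k3 ham3 at X a is c2 a p + c4 a q for the
    pair (p, q) of [poincare]. *)
Lemma kill_exponentials E : isder E -> comm d2 E -> comm d4 E ->
  exists (f : A) (k1 k2 k3 k4 : F) (mu : G -> F) (M : A -> A),
  [/\ forall a b, mu (a + b) = mu a + mu b, mu sg = 0, brder M,
      forall a i, M (mon a i) = (mu a)%:K * mon a i &
  let D := fun v => br f v + (k1%:K * ham1 v + k2%:K * ham2 v + k3%:K * ham3 v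
                   + k4%:K * ham4 v) + M v in
  brder D /\ forall a, ~~ flat a -> negl (E (X a) - D (X a))].
Proof.
move=> hE E2 E4; have [k4 [k2 [nu [P [hE' hP anu nus Pnu]]]]] := normalise hE E2 E4.
have cP := multipliers_coherent hE' hP.
have [p [q [mu [[p2 p4 q2 q4 pq] muD mus PE]]]] := family_potentials cP anu nus Pnu.
have [f [k1 [k3 [f2 f4 ep eq_]]]] := poincare p2 p4 q2 q4 pq.
have [M [hM ME]] := weight_der muD mus.
exists f, k1, k2, k3, k4, mu, M; split=> //; split.
  apply: brderD hM; apply: brderD; first exact: brder_ad.
  do 3?apply: brderD; apply: brderZ; [exact: brder_ham1|exact: brder_ham2|
    exact: brder_ham3|exact: brder_ham4].
move=> a na; have [_ _ /(_ (nonflat_sg2 na))] := hP a; rewrite PE //.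
congr negl; rewrite -(mon0 a) ME mon0 ep eq_ /br /ham1 /ham2 /ham3 /ham4 !dX f2 f4.
by ring.
Qed.

(** * Maps that kill the exponentials *)

Definition dg (i : 'rV[nat]_4) := (i 0%R pos1 + i 0%R pos2 + i 0%R pos3 + i 0%R pos4)%N.
Definition unit4 (p : 'I_4) : 'rV[nat]_4 := \row_q (q == p : nat).

Lemma pos_cases (p : 'I_4) : [\/ p = pos1, p = pos2, p = pos3 | p = pos4].
Proof.
by case: p => -[|[|[|[|m]]]] h //; [constructor 1|constructor 2|constructor 3|constructor 4];
  apply: val_inj.
Qed.

Lemma dg_dec (i : 'rV[nat]_4) p : i 0 p != 0%N -> (dg (dec i p)).+1 = dg i.
Proof.
move=> ip; rewrite /dg !mxE.
by case: (pos_cases p) ip => -> /=; rewrite !subn0; case: (i 0 _) => // m _;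
  rewrite subn1 /= ?addSn ?addnS.
Qed.

Lemma dg_unit p : dg (unit4 p) = 1%N.
Proof. by rewrite /dg !mxE; case: (pos_cases p) => ->. Qed.

Lemma dec_unit (i : 'rV[nat]_4) p : i 0 p != 0%N -> i = unit4 p + dec i p.
Proof.
move=> ip; apply/rowP=> q; rewrite !mxE; have [->|_] := eqVneq q p.
  by case: (i 0 p) ip => // m _; rewrite subn1.
by rewrite subn0.
Qed.

Lemma dg0 i : dg i = 0%N -> i = 0.
Proof.
move=> h; apply/rowP=> q; rewrite mxE; apply/eqP; move/eqP: h.
by rewrite /dg !addn_eq0 -!andbA => /and4P[h1 h2 h3 h4]; case: (pos_cases q) => ->.
Qed.

Lemma dg_pos (i : 'rV[nat]_4) : dg i != 0%N -> exists p, i 0 p != 0%N.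
Proof.
rewrite /dg !addn_eq0 -!andbA !negb_and => /or4P[] h; eexists; exact: h.
Qed.

Lemma dg1 i : dg i = 1%N -> exists p, i = unit4 p.
Proof.
move=> h; have [|p ip] := @dg_pos i; first by rewrite h.
exists p; have := dg_dec ip; rewrite h => -[/dg0 h0].
by rewrite [LHS](dec_unit ip) h0 addr0.
Qed.

Section Killing.
Variables (E : A -> A) (hE : isder E).
Let lE : linop E. Proof. by case: hE. Qed.

(** The non-flat exponents suffice by [center], and congruences between them are
    equalities. *)
Definition kills_multiples v := forall c, ~~ flat c -> negl (E (X c * v)).

Lemma lowD u v : kills_multiples u -> kills_multiples v -> kills_multiples (u + v).
Proof. by move=> hu hv c nc; rewrite mulrDr (linopD lE); apply: neglD; [exact: hu|exact: hv]. Qed.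
Lemma lowZ k v : kills_multiples v -> kills_multiples (k%:K * v).
Proof. by move=> hv c nc; rewrite mulrCA (linopZ lE); apply: neglZ; exact: hv. Qed.
Lemma lowN v : kills_multiples v -> kills_multiples (- v).
Proof. by move=> hv c nc; rewrite mulrN (linopN lE); apply: neglN; exact: hv. Qed.
Lemma lowB u v : kills_multiples u -> kills_multiples v -> kills_multiples (u - v).
Proof. by move=> hu hv; apply: lowD => //; exact: lowN. Qed.
Lemma low0 : kills_multiples 0.
Proof. by move=> c nc; rewrite mulr0 (linop0 lE); exact: negl0. Qed.

Definition kills_below n := forall i, inJ i -> (dg i < n)%N -> kills_multiples (t i).

Lemma low_dec n (i : 'rV[nat]_4) p : kills_below n -> inJ i -> (dg i <= n)%N ->
  kills_multiples ((i 0 p)%:R%:K * t (dec i p)).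
Proof.
move=> hn hi di; have [->|ip] := eqVneq (i 0 p) 0%N.
  by rewrite rmorph0 mul0r; exact: low0.
by apply/lowZ/hn; [exact: inJ_dec|rewrite -(dg_dec ip) in di].
Qed.

Lemma br_exp_mon a b v : br (X a) (X b * v) =
  X (a + b + sg) * ((c1 a * c2 b - c2 a * c1 b)%:K * v
                   + (c1 a)%:K * d2 v - (c2 a)%:K * d1 v)
  + X (a + b) * (((c3 a + 1) * c4 b - (c3 b + 1) * c4 a)%:K * v
                   + (c3 a + 1)%:K * d4 v - (c4 a)%:K * d3 v).
Proof. by rewrite /br !dlin !dX !XD; ring. Qed.

Lemma negl_center v : (forall a, ~~ flat a -> negl (E (br (X a) v))) ->
  (forall a, ~~ flat a -> negl (E (br (X a) v) - br (X a) (E v))) -> negl (E v).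
Proof.
move=> h1 h2; apply: center => a na; rewrite brC; apply: neglN.
by have := neglB (h1 a na) (h2 a na); congr negl; ring.
Qed.

(** The brackets of mon a i with the non-flat exponentials are combinations of
    monomials killed by E. So E (mon a i) commutes with these exponentials, and
    [center] applies. *)
Lemma kill_flat n a i : (forall b, ~~ flat b -> negl (E (X b))) ->
  (forall j, inJ j -> (dg j <= n)%N -> kills_multiples (t j)) -> (dg i <= n)%N ->
  dom a i -> negl (E (mon a i)).
Proof.
move=> hX hn di hd; have hi := dom_inJ hd.
have [fa|na] := boolP (flat a); last exact: hn.
apply: negl_center => b nb; last first.
  have [_ hE'] := hE; have := hE' b 0 a i (dom_nonflat inJ0 (nonflat_sg2 nb)) hd.
  by rewrite mon0 (negl_brl _ (hX b nb)) add0r.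
have hl : kills_below n.+1 by move=> j hj; rewrite ltnS; exact: hn.
have di' := leqW di.
rewrite /mon br_exp_mon (linopD lE).
rewrite d1t // d2t // d3t // d4t //.
have nba : ~~ flat (b + a) by rewrite flatD.
have ht : kills_multiples (t i) by exact: hn.
apply: neglD; [have : ~~ flat (b + a + sg) by rewrite flatD // flat_sg|move: nba];
  move: (_ + _ : G); rewrite -/(kills_multiples _).
  apply: lowB; first apply: lowD; apply: lowZ => //; exact: low_dec hl hi di'.
by apply: lowB; first apply: lowD; apply: lowZ => //; exact: low_dec hl hi di'.
Qed.

Hypothesis hX : forall b, ~~ flat b -> negl (E (X b)).

Lemma low1 : kills_multiples 1. Proof. by move=> c nc; rewrite mulr1; exact: hX. Qed.

Lemma low_below1 : kills_below 1.
Proof. by move=> i _; rewrite ltnS leqn0 => /eqP/dg0 ->; rewrite t0; exact: low1. Qed.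

Lemma kill_X a : ~~ is_sg2 a -> negl (E (X a)).
Proof.
move=> sa; rewrite -mon0; apply: (@kill_flat 0 a 0) => //.
- by move=> j hj h; apply: low_below1.
- by rewrite /dg !mxE.
by apply: dom_nonflat; first exact: inJ0.
Qed.

Lemma kill_comm : comm d2 E /\ comm d4 E.
Proof.
split=> a i hd.
  have := isder_Xneg hE hd; rewrite (negl_brl _ (kill_X nsg2_Xneg)) oppr0 add0r //.
by have := isder1 hE hd; rewrite -X0 (negl_brl _ (kill_X nsg2_0)) add0r.
Qed.

Section Level.
Variables (n : nat) (hn : kills_below n) (i : 'rV[nat]_4) (hi : inJ i) (di : (dg i <= n)%N).

(** If E kills the monomials of lower degree, then it behaves on mon b i as on
    an exponential: d2 and d4 act on mon b i by their weights, up to lower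
    terms. *)
Lemma level_family : exists T : G -> A, forall b, ~~ flat b ->
  [/\ d2 (T b) = 0, d4 (T b) = 0 & negl (E (mon b i) - T b * X b)].
Proof.
suff h b : exists T, ~~ flat b -> [/\ d2 T = 0, d4 T = 0 & negl (E (mon b i) - T * X b)].
  by have [T hT] := choice h; exists T.
have [fb|nb] := boolP (flat b); first by exists 0.
have [E2 E4] := kill_comm.
have hd : dom b i by apply: dom_nonflat => //; exact: nonflat_sg2.
suff [T hT] : exists T, [/\ d2 T = 0, d4 T = 0 & negl (E (mon b i) - T * X b)] by exists T.
apply: weight_lift => //.
  have := neglB (low_dec pos2 hn hi di nb) (E2 _ _ hd).
  rewrite [d2 (mon b i)](derM D2) d2X d2t // (linopD lE) -mulrA (linopZ lE) -/(mon b i).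
  by congr negl; ring.
have := neglB (low_dec pos4 hn hi di nb) (E4 _ _ hd).
rewrite [d4 (mon b i)](derM D4) d4X d4t // (linopD lE) -mulrA (linopZ lE) -/(mon b i).
by congr negl; ring.
Qed.

(** The counterpart of [multipliers_eq] with P a = 0, since E kills X a. *)
Lemma level_eq T a b : (forall b, ~~ flat b ->
    [/\ d2 (T b) = 0, d4 (T b) = 0 & negl (E (mon b i) - T b * X b)]) ->
  ~~ is_sg2 a -> ~~ flat b -> ~~ flat (a + b) ->
  (c1 a * c2 b - c2 a * c1 b)%:K * x * T (a + b + sg)
  + ((c3 a + 1) * c4 b - (c3 b + 1) * c4 a)%:K * T (a + b)
  = T b * ((c1 a * c2 b - c2 a * c1 b)%:K * x
                   + ((c3 a + 1) * c4 b - (c3 b + 1) * c4 a)%:K)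
    - x * ((c2 a)%:K * d1 (T b)) - (c4 a)%:K * d3 (T b).
Proof.
move=> hT sa nb nab.
have nabs : ~~ flat (a + b + sg) by rewrite flatD ?flat_sg.
have [Tb2 Tb4 Tb] := hT b nb.
have [Tab2 Tab4 Tab] := hT _ nab; have [Tabs2 Tabs4 Tabs] := hT _ nabs.
have hd : dom b i by apply: dom_nonflat => //; exact: nonflat_sg2.
have [_ /(_ a 0 b i (dom_nonflat inJ0 sa) hd)] := hE.
rewrite mon0 (negl_brl _ (kill_X sa)) add0r (brr_eq _ Tb) {1}/mon br_exp_mon.
rewrite d1t // d2t // d3t // d4t //.
set w := (_ - _)%:K; set p := (_ - _)%:K => j.
have l1 : kills_multiples ((c1 a)%:K * ((i 0 pos2)%:R%:K * t (dec i pos2))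
   - (c2 a)%:K * ((i 0 pos1)%:R%:K * t (dec i pos1))).
  by apply: lowB; apply: lowZ; exact: low_dec hn hi di.
have l2 : kills_multiples ((c3 a + 1)%:K * ((i 0 pos4)%:R%:K * t (dec i pos4))
   - (c4 a)%:K * ((i 0 pos3)%:R%:K * t (dec i pos3))).
  by apply: lowB; apply: lowZ; exact: low_dec hn hi di.
have {j l1 l2} := neglB (neglB (neglB j (l1 _ nabs)) (l2 _ nab))
  (neglD (neglZ (c1 a * c2 b - c2 a * c1 b) Tabs)
     (neglZ ((c3 a + 1) * c4 b - (c3 b + 1) * c4 a) Tab)).
rewrite -/w -/p /mon -[_ + _ - (c2 a)%:K * _]addrA -[_ + _ - (c4 a)%:K * _]addrA.
rewrite !mulrDr !(linopD lE) ![X _ * (w * _)]mulrCA ![X _ * (p * _)]mulrCA !(linopZ lE).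
move=> j; set S1 := RHS; set S2 := LHS.
have {}j : negl (X (a + b) * (S2 - S1)).
  move: j; congr negl; rewrite /S1 /S2 /mon /br !dlin !dX Tb2 Tb4 !XD /w /p; ring.
apply/subr0_eq/(@X_inj (a + b)); rewrite mulr0.
have S2' : d2 (S2 - S1) = 0.
  by rewrite /S1 /S2 /w /p !dlin !dx Tb2 Tab2 Tabs2 !d21 -!d32 !Tb2 !dlin; ring.
have S4' : d4 (S2 - S1) = 0.
  by rewrite /S1 /S2 /w /p !dlin !dx Tb4 Tab4 Tabs4 !d41 !d43 !Tb4 !dlin; ring.
by apply: (negl_weight j nab); rewrite ?(derM D2) ?(derM D4) ?S2' ?S4' !dX mulr0 addr0 mulrA.
Qed.

(** [translation_extend] with nu = 0 makes T invariant under flat translations.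
    As in [additive_nonflat], T is then invariant under non-flat ones, and its
    derivatives by d1 and d3 vanish. *)
Lemma level_scalar : exists k : F, forall b, ~~ flat b -> negl (E (mon b i) - k%:K * X b).
Proof.
have [T hT] := level_family.
have T2 b : ~~ flat b -> d2 (T b) = 0 by case/hT.
have T4 b : ~~ flat b -> d4 (T b) = 0 by case/hT.
have tr a b : flat a -> ~~ flat b -> T (a + b) = T b.
  move=> fa nb; rewrite -[RHS]addr0 -(rmorph0 (in_alg A)).
  apply: (@translation_extend T (fun=> 0)) => // [? ? _ _|{a b fa nb} a b fa sa nb].
    by rewrite addr0.
  have nab : ~~ flat (a + b) by rewrite flatDl.
  have := level_eq hT sa nb nab; case/flatP: (fa) => -> -> h.
  by rewrite [a + sg + b]addrAC; apply: (eq_sub1 h); rewrite !rmorph0; ring.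
have key a b : ~~ flat a -> ~~ flat b -> ~~ flat (a + b) ->
    T (a + b) = T b /\ (c2 a)%:K * (x * d1 (T b)) + (c4 a)%:K * d3 (T b) = 0.
  move=> na nb nab.
  have sgT c : ~~ flat c -> T (c + sg) = T c by move=> nc; rewrite addrC tr // flat_sg.
  have h := level_eq hT (nonflat_sg2 na) nb nab; rewrite sgT // in h.
  have shift e : flat e ->
      (c2 a * c1 e)%:K * (x * (T (a + b) - T b)) + (c3 e * c4 a)%:K * (T (a + b) - T b) = 0.
    move=> fe; have nb' : ~~ flat (b + e) by rewrite flatD.
    have nab' : ~~ flat (a + (b + e)) by rewrite addrA flatD.
    have := level_eq hT (nonflat_sg2 na) nb' nab'; rewrite sgT //.
    rewrite addrA [a + b + e]addrC [b + e]addrC !(tr e) // !cE.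
    case/flatP: (fe) => -> -> h'.
    by apply/esym/(eq_sub2 h' h); ring.
  have e0 : T (a + b) - T b = 0.
    move: na; rewrite negb_and => /orP[] h'.
      have := shift _ flat_e1; rewrite !cE !mul0r rmorph0 mul0r addr0 => /scalar_eq0.
      by rewrite mulf_neq0 // => /(_ isT) e; apply: (@X_inj sg); rewrite e mulr0.
    have := shift _ flat_e3; rewrite !cE !mulr0 rmorph0 !mul0r add0r => /scalar_eq0.
    by rewrite mulf_neq0 // => /(_ isT).
  have e1' : T (a + b) = T b by apply: subr0_eq.
  by split=> //; rewrite e1' in h; apply: (eq_sub1 h); ring.
have avoidn (c : F) (d : F) : d != 0 -> exists m, (d *+ m != 0) && (c + d *+ m != 0).
  move=> d0; have [m] := avoid [:: 0; - c] d0; rewrite !inE !negb_or => /andP[m1 m2].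
  by exists m; rewrite -[d *+ m]mulr_natl m1 addrC addr_eq0.
have dT b : ~~ flat b -> d1 (T b) = 0 /\ d3 (T b) = 0.
  move=> nb; split.
    have [m /andP[m1 m2]] := avoidn (c2 b) _ c2e2.
    have na : ~~ flat (e2 *+ m) by rewrite /flat !cE negb_and m1.
    have nab : ~~ flat (e2 *+ m + b) by rewrite /flat !cE [_ + c2 b]addrC negb_and m2.
    have [_] := key _ _ na nb nab; rewrite !cE mul0rn rmorph0 mul0r addr0 => /(scalar_eq0 m1) e.
    by apply: (@X_inj sg); rewrite e mulr0.
  have [m /andP[m1 m2]] := avoidn (c4 b) _ c4e4.
  have na : ~~ flat (e4 *+ m) by rewrite /flat !cE negb_and m1 orbT.
  have nab : ~~ flat (e4 *+ m + b) by rewrite /flat !cE [_ + c4 b]addrC negb_and m2 orbT.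
  by have [_] := key _ _ na nb nab; rewrite !cE mul0rn rmorph0 mul0r add0r => /(scalar_eq0 m1).
have const b : ~~ flat b -> T b = T e2.
  move=> nb; have [c [nc nbc nec]] := nonflat_shift b e2.
  have [e _] := key b c nb nc nbc; have ncb : ~~ flat (c + b) by rewrite addrC.
  have [e' _] := key c b nc nb ncb.
  have [f _] := key e2 c flat_e2 nc nec; have nce : ~~ flat (c + e2) by rewrite addrC.
  have [f' _] := key c e2 nc flat_e2 nce.
  by rewrite -e' addrC e -f addrC f'.
have [k ek] : exists k : F, T e2 = k%:K.
  have [h1 h3] := dT _ flat_e2.
  by apply: eig0 => //; [exact: T2 flat_e2|exact: T4 flat_e2].
by exists k => b nb; have [_ _] := hT b nb; rewrite const // ek.
Qed.
End Level.
End Killing.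

Lemma dgD i j : dg (i + j) = (dg i + dg j)%N.
Proof.
rewrite /dg !mxE.
by rewrite (addnACA (i 0%R pos1)) (addnACA (i 0%R pos1 + i 0%R pos2)%N)
  (addnACA (i 0%R pos1 + i 0%R pos2 + i 0%R pos3)%N).
Qed.

Lemma inJ_unit i p : inJ i -> i 0 p != 0%N -> inJ (unit4 p).
Proof.
move=> /forallP hi ip; apply/forallP=> q; rewrite mxE.
have [->|//] := eqVneq q p; last by rewrite orbT.
by have := hi p; rewrite (negbTE ip) orbF => ->.
Qed.

Lemma dt_unit p q : inJ (unit4 p) ->
  (unit4 p 0 q)%:R%:K * t (dec (unit4 p) q) = (q == p)%:R%:K :> A.
Proof.
move=> hp; rewrite mxE; have [->|_] := eqVneq q p; last by rewrite !rmorph0 mul0r.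
suff -> : dec (unit4 p) p = 0 by rewrite t0 mulr1.
by apply/rowP=> r; rewrite !mxE; case: eqP.
Qed.

Lemma br_mon2 a b S T : br (X a * S) (X b * T) =
  X (a + b + sg) * (((c1 a)%:K * S + d1 S) * ((c2 b)%:K * T + d2 T)
                    - ((c1 b)%:K * T + d1 T) * ((c2 a)%:K * S + d2 S))
  + X (a + b) * (((c3 a + 1)%:K * S + d3 S) * ((c4 b)%:K * T + d4 T)
                 - ((c3 b + 1)%:K * T + d3 T) * ((c4 a)%:K * S + d4 S)).
Proof. by rewrite /br !dlin !dX !XD; ring. Qed.

(** If t_p divides t^i and j = i - 1_p, then E kills the bracket of X e2 t_p and
    X b t^j, and all terms of this bracket except the multiples of X c t^i. The
    coefficient of X (e2 + b + sg) t^i is - c2 e2 c1 e1 for b = e2 + e1, so the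
    scalar of [level_scalar] is 0. *)
Lemma kill_higher E : isder E -> (forall b, ~~ flat b -> negl (E (X b))) ->
  kills_below E 2 -> forall n, kills_below E n.
Proof.
move=> hE hX h2; have lE := hE.1; elim=> [|n IH] i hi; first by [].
rewrite ltnS => di; have [n1|n2] := leqP n 1.
  by apply: h2 => //; apply: leq_ltn_trans di _; rewrite ltnS.
move: di; rewrite leq_eqVlt => /orP[/eqP di|]; last exact: IH.
have [|k hk] := level_scalar hE hX IH hi; first by rewrite di.
suff k0 : k = 0 by move=> c nc; have := hk c nc; rewrite k0 rmorph0 mul0r subr0.
have [|p ip] := @dg_pos i; first by rewrite di; case: (n) n2.
pose j := dec i p; have hj : inJ j by exact: inJ_dec.
have dj : (dg j).+1 = n by rewrite /j dg_dec.
have hu := inJ_unit hi ip.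
have tij : t (unit4 p) * t j = t i by rewrite -tD // -dec_unit.
(* The summand e1 of b makes the coefficient - c2 e2 * c1 e1 below nonzero. *)
pose b := e2 + e1; have nb : ~~ flat b by rewrite flatD ?flat_e1 ?flat_e2.
have nab : ~~ flat (e2 + b).
  by rewrite addrA flatD ?flat_e1 // -mulr2n flatMn flat_e2.
have nabs : ~~ flat (e2 + b + sg) by rewrite flatD ?flat_sg.
have lu : kills_multiples E (t (unit4 p)) by apply: IH; rewrite ?dg_unit.
have lj : kills_multiples E (t j) by apply: IH; rewrite ?dj // -dj.
have ld q : kills_multiples E ((j 0 q)%:R%:K * t (dec j q)) by apply: (@low_dec E hE n j q IH hj); rewrite -dj.
have lud q : kills_multiples E (t (unit4 p) * ((j 0 q)%:R%:K * t (dec j q))).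
  have [->|jq] := eqVneq (j 0 q) 0%N; first by rewrite rmorph0 mul0r mulr0; exact: low0 hE.
  rewrite mulrCA -tD ?inJ_dec //; apply: (lowZ hE); apply: IH.
    by apply: inJD => //; exact: inJ_dec.
  by rewrite dgD dg_unit add1n dg_dec // -dj.
have [_ /(_ e2 (unit4 p) b j)] := hE.
have hd1 : dom e2 (unit4 p) by apply: dom_nonflat => //; exact/nonflat_sg2/flat_e2.
have hd2 : dom b j by apply: dom_nonflat => //; exact/nonflat_sg2.
move=> /(_ hd1 hd2); rewrite (negl_brl _ (lu _ flat_e2)) (negl_brr _ (lj _ nb)).
rewrite addr0 subr0 /mon br_mon2.
rewrite !(d1t hu, d2t hu, d3t hu, d4t hu) !dt_unit //.
rewrite !(d1t hj, d2t hj, d3t hj, d4t hj).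
pose s q : F := (q == p)%:R.
set T1 := _ * t (dec j pos1); set T2 := _ * t (dec j pos2).
set T3 := _ * t (dec j pos3); set T4 := _ * t (dec j pos4).
rewrite -![(_ == p)%:R]/(s _).
pose v1 := (s pos1 * c2 e2)%:K * t j + (s pos1)%:K * T2 - (c1 e1 * s pos2)%:K * t j
  - (c2 e2)%:K * (t (unit4 p) * T1) - (s pos2)%:K * T1.
pose v2 := t (unit4 p) * T4 + (s pos3)%:K * T4 - (s pos4)%:K * t j - (s pos4)%:K * T3.
have l1 : kills_multiples E v1.
  by do !apply: (lowB hE); [apply: (lowD hE)|..]; apply: (lowZ hE);
    first [exact: ld|exact: lud|exact: lj].
have l2 : kills_multiples E v2.
  do !apply: (lowB hE); [apply: (lowD hE); first exact: lud|..]; apply: (lowZ hE);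
    first [exact: ld|exact: lud|exact: lj].
have -> : X (e2 + b + sg) * (((c1 e2)%:K * t (unit4 p) + (s pos1)%:K) * ((c2 b)%:K * t j + T2)
     - ((c1 b)%:K * t j + T1) * ((c2 e2)%:K * t (unit4 p) + (s pos2)%:K))
   + X (e2 + b) * (((c3 e2 + 1)%:K * t (unit4 p) + (s pos3)%:K) * ((c4 b)%:K * t j + T4)
     - ((c3 b + 1)%:K * t j + T3) * ((c4 e2)%:K * t (unit4 p) + (s pos4)%:K))
  = (- (c2 e2 * c1 e1))%:K * mon (e2 + b + sg) i + X (e2 + b + sg) * v1 + X (e2 + b) * v2.
  by rewrite /mon -tij /v1 /v2 /b !cE; ring.
rewrite !(linopD lE) (linopZ lE) => j0.
have {j0} j1 := neglB (neglB j0 (l2 _ nab)) (l1 _ nabs).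
have j2 : negl (k%:K * X (e2 + b + sg)).
  have := neglZ (- (c2 e2 * c1 e1))^-1 j1.
  move/neglB/(_ (hk _ nabs)); congr negl.
  rewrite addrK addrK mulrA -rmorphM mulVf ?oppr_eq0 ?mulf_neq0 // rmorph1 mul1r.
  ring.
have e0 : k%:K * X (e2 + b + sg) = 0.
  by apply: (negl_weight j2 nabs); rewrite ?(derZ D2) ?(derZ D4) dX; ring.
apply: (fmorph_inj (in_alg A)); rewrite rmorph0 -[LHS]mulr1 -(X_mulN (e2 + b + sg)).
by rewrite mulrA e0 mul0r.
Qed.

Hypothesis shift_der : forall tau : 'I_4 -> F, exists M, brder M /\
  forall a i, inJ i -> M (mon a i) = \sum_p (tau p * (i 0 p)%:R)%:K * mon a (dec i p).

(** In degree 1 the scalars of [level_scalar] are the coefficients of a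
    combination of the derivatives by the t_p. Once it is subtracted,
    [kill_higher] applies in all degrees. *)
Lemma kill_polynomials E : isder E -> (forall b, ~~ flat b -> negl (E (X b))) ->
  exists (tau : 'I_4 -> F) (M : A -> A), [/\ brder M,
    forall a i, inJ i -> M (mon a i) = \sum_p (tau p * (i 0 p)%:R)%:K * mon a (dec i p)
  & forall a i, dom a i -> negl (E (mon a i) - M (mon a i))].
Proof.
move=> hE hX.
have h1 p : exists k : F, inJ (unit4 p) ->
    forall b, ~~ flat b -> negl (E (mon b (unit4 p)) - k%:K * X b).
  have [hp|] := boolP (inJ (unit4 p)); last by exists 0.
  have [|k hk] := level_scalar hE hX (low_below1 hX) hp; first by rewrite dg_unit.
  by exists k.
have [tau htau] := choice h1; have [M [hM ME]] := shift_der tau.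
exists tau, M; split=> // a i hd.
have hE' := isderB hE hM; set E' := fun v => _ in hE'.
have hX' b : ~~ flat b -> negl (E' (X b)).
  move=> nb; rewrite /E' -mon0 ME ?inJ0 // big1 ?subr0 ?mon0; first exact: hX.
  by move=> p _; rewrite mxE mulr0 rmorph0 mul0r.
have h2 : kills_below E' 2.
  move=> j hj; rewrite ltnS leq_eqVlt => /orP[/eqP/dg1[p ej]|]; last exact: low_below1 hX' _ hj.
  move=> b nb; rewrite -/(mon b j) /E' ME // (bigD1 p) // big1; last first.
    by move=> q /andP[_ qp]; rewrite ej mxE (negbTE qp) mulr0 rmorph0 mul0r.
  have := htau p; rewrite -ej => /(_ hj b nb); congr negl.
  rewrite Monoid.mulm1 ej mxE eqxx mulr1; congr (_ - _ * _); rewrite -[LHS]mon0; congr mon.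
  by apply/rowP=> r; rewrite !mxE; case: eqP.
have hn := kill_higher hE' hX' h2.
by apply: (@kill_flat E' hE' (dg i)) => // j hj dj; apply: (hn (dg i).+1).
Qed.

Theorem derivation_decomposition E : isder E ->
  exists (u : A) (k1 k2 k3 k4 : F) (mu : G -> F) (tau : 'I_4 -> F),
  [/\ forall a b, mu (a + b) = mu a + mu b, mu sg = 0 &
   forall a i, dom a i ->
    negl (E (mon a i) - (br u (mon a i)
      + (k1%:K * ham1 (mon a i) + k2%:K * ham2 (mon a i)
         + k3%:K * ham3 (mon a i) + k4%:K * ham4 (mon a i))
      + (mu a)%:K * mon a i
      + \sum_p (tau p * (i 0 p)%:R)%:K * mon a (dec i p)))].
Proof.
move=> hE; have [u [E4 E2]] := commute_d2_d4 hE.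
have hE1 := isderB hE (brder_ad u).
have [f [k1 [k2 [k3 [k4 [mu [M [muD mus hM ME [hD hX]]]]]]]]] := kill_exponentials hE1 E2 E4.
have hE2 := isderB hE1 hD.
have [tau [N [hN NE hk]]] := kill_polynomials hE2 hX.
exists (u + f), k1, k2, k3, k4, mu, tau; split=> // a i hd.
have := hk a i hd; rewrite NE ?(dom_inJ hd) // ME; congr negl.
by rewrite brDl; ring.
Qed.
End Xu.

Local Open Scope classical_set_scope.

(** * Coefficients and linear spans *)

Lemma linear_sum (F : fieldType) (U V : lmodType F) (h : U -> V) (I : Type)
    (r : seq I) (c : I -> F) (w : I -> U) : linear h ->
  h (\sum_(k <- r) c k *: w k) = \sum_(k <- r) c k *: h (w k).
Proof.
move=> lh; elim: r => [|k r IH]; last by rewrite !big_cons lh IH.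
by rewrite !big_nil; have := lh (-1) 0 0; rewrite scaler0 addr0 scaleN1r addNr.
Qed.

Section SpanTheory.
Variables (F : fieldType) (V : lmodType F) (S : set V).

Lemma lspan0 : lspan S 0.
Proof. by have [/asboolP] := lspan_submod S. Qed.
Lemma lspanZ c v : lspan S v -> lspan S (c *: v).
Proof.
move=> h; have [_ /(_ c v 0)] := lspan_submod S; rewrite addr0 => H.
by apply/asboolP/H; apply/asboolP => //; exact: lspan0.
Qed.
Lemma lspanD v w : lspan S v -> lspan S w -> lspan S (v + w).
Proof.
move=> h h'; have [_ /(_ 1 v w)] := lspan_submod S; rewrite scale1r => H.
by apply/asboolP/H; apply/asboolP.
Qed.
Lemma lspan_sum (I : Type) (r : seq I) (v : I -> V) :
  (forall i, lspan S (v i)) -> lspan S (\sum_(i <- r) v i).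
Proof.
move=> h; elim: r => [|i r IH]; first by rewrite big_nil; exact: lspan0.
by rewrite big_cons; exact: lspanD.
Qed.
End SpanTheory.

Section Basis.
Variables (F : fieldType) (Gam : zmodClosed 'rV[F]_4) (J : 'I_4 -> set nat).
Local Notation A4 := (A4 Gam J).
Local Notation xm := (@xm F Gam J).
Local Notation in_idx := (in_idx Gam J).

Lemma xm_out a i : ~~ in_idx (a, i) -> xm a i = 0.
Proof. by move=> h; rewrite xm.unlock insubN. Qed.

Lemma lin_ext_xm_id (u : A4) : lin_ext xm u = u.
Proof.
rewrite lin_extE [RHS]monalgE; apply: eq_bigr => k _.
rewrite xm.unlock; case: k => -[a i] /= h; rewrite insubT /= scaleAE.
apply/malgP=> k'.
rewrite mcoeffZ.
rewrite [in RHS]mcoeffU. rewrite mcoeffU.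
by rewrite mulrnAr mulr1.
Qed.

Lemma xm_ext (V : lmodType F) (f g : A4 -> V) : linear f -> linear g ->
  (forall a i, in_idx (a, i) -> f (xm a i) = g (xm a i)) -> f =1 g.
Proof.
move=> lf lg fg u; rewrite -(lin_ext_xm_id u) lin_extE.
rewrite !linear_sum //; apply: eq_bigr => k _; rewrite fg //.
by case: k => -[a i].
Qed.

(** As for [xm], an index outside Gam x J gives 0. *)
Definition cf (u : A4) (a : 'rV[F]_4) (i : 'rV[nat]_4) : F :=
  if insub (a, i) is Some k then mcoeff (k : idx Gam J) u else 0.

Lemma cf_linear a i : linear (fun u : A4 => cf u a i : F^o).
Proof.
move=> c u v; rewrite /cf; case: insub => [k|]; last by rewrite scaler0 addr0.
by rewrite scaleAE mcoeffD mcoeffZ.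
Qed.

Lemma cfD u v a i : cf (u + v) a i = cf u a i + cf v a i.
Proof. by have := cf_linear a i 1 u v; rewrite !scale1r. Qed.
Lemma cf0 a i : cf 0 a i = 0.
Proof. by rewrite /cf; case: insub => // k; rewrite mcoeff0. Qed.
Lemma cfZ c u a i : cf (c *: u) a i = c * cf u a i.
Proof. by have := cf_linear a i c u 0; rewrite !addr0 cf0 addr0. Qed.
Lemma cfN u a i : cf (- u) a i = - cf u a i.
Proof. by rewrite -scaleN1r cfZ mulN1r. Qed.
Lemma cfB u v a i : cf (u - v) a i = cf u a i - cf v a i.
Proof. by rewrite cfD cfN. Qed.

Lemma cf_out u a i : ~~ in_idx (a, i) -> cf u a i = 0.
Proof. by move=> h; rewrite /cf insubN. Qed.

Lemma cf_xm a i b j : cf (xm a i) b j = (((a, i) == (b, j)) && in_idx (a, i))%:R.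
Proof.
have [ha|ha] := boolP (in_idx (a, i)); last by rewrite xm_out // cf0 andbF.
rewrite andbT; have [hb|hb] := boolP (in_idx (b, j)); last first.
  by rewrite cf_out //; case: eqP ha => // -> ; rewrite (negbTE hb).
by rewrite /cf xm.unlock !insubT /= mcoeffU -val_eqE.
Qed.

Lemma cf_ext (u v : A4) : (forall a i, cf u a i = cf v a i) -> u = v.
Proof.
move=> h; apply/malgP => -[[a i] hk].
by have := h a i; rewrite /cf insubT.
Qed.

Lemma cf_bound (u : A4) : exists N, forall a i, cf u a i != 0 ->
  forall p, (i 0%R p <= N)%N.
Proof.
pose m (k : idx Gam J) := (\max_p (val k).2 0%R p)%N.
exists (\max_(k <- msupp u) m k)%N => a i h p.
have hk : in_idx (a, i) by apply: contraR h => /cf_out->.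
pose k : idx Gam J := exist _ (a, i) hk.
have kk : k \in msupp u.
  by rewrite -mcoeff_neq0; move: h; rewrite /cf insubT.
apply: (@leq_trans (m k)); first exact: (@leq_bigmax _ (fun p => (val k).2 0%R p) p).
exact: leq_bigmax_seq.
Qed.
End Basis.

(** * The commutative algebra on Gam x J *)

Definition index_shape (J : 'I_4 -> set nat) :=
  forall p, J p = [set 0%N] \/ J p = [set: nat].

Section Ring.
Variables (F : fieldType) (Gam : zmodClosed 'rV[F]_4) (J : 'I_4 -> set nat).
Hypothesis hJ : index_shape J.
Local Notation A4 := (A4 Gam J).
Local Notation xm := (@xm F Gam J).
Local Notation in_idx := (in_idx Gam J).
Local Notation lin_ext := (@lin_ext F Gam J _).
Local Notation mulA := (@Defs.mulA F Gam J).

Lemma in_idxE a i : in_idx (a, i) = (a \in Gam) && `[< Jprod J i >].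
Proof. by []. Qed.

Lemma Jprod0 : Jprod J 0.
Proof. by move=> p; rewrite mxE; case: (hJ p) => ->. Qed.

Lemma JprodD i j : Jprod J i -> Jprod J j -> Jprod J (i + j).
Proof.
move=> hi hj p; rewrite mxE; have := hi p; have := hj p.
by case: (hJ p) => -> //= -> ->.
Qed.

Lemma Jprod_dec i p : Jprod J i -> Jprod J (dec i p).
Proof.
move=> hi q; rewrite mxE; have := hi q.
by case: (hJ q) => -> //= ->; rewrite sub0n.
Qed.

Lemma in_idxD a i b j : in_idx (a, i) -> in_idx (b, j) -> in_idx (a + b, i + j).
Proof.
rewrite !in_idxE => /andP[ha /asboolP hi] /andP[hb /asboolP hj].
by rewrite rpredD //; apply/asboolP/JprodD.
Qed.

Lemma in_idx_dec a i p : in_idx (a, i) -> in_idx (a, dec i p).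
Proof.
by rewrite !in_idxE => /andP[-> /asboolP hi]; apply/asboolP/Jprod_dec.
Qed.

Lemma in_idx00 : in_idx (0, 0).
Proof. by rewrite in_idxE rpred0; apply/asboolP/Jprod0. Qed.

Lemma lin_ext_linear (V : lmodType F) (f : 'rV[F]_4 -> 'rV[nat]_4 -> V) : linear (lin_ext f).
Proof. exact: linearP. Qed.

Lemma linear_comp (U V W : lmodType F) (f : U -> V) (g : V -> W) :
  linear f -> linear g -> linear (g \o f).
Proof. by move=> lf lg c u v; rewrite /= lf lg. Qed.

Lemma mulA_comm (u v : A4) : mulA u v = mulA v u.
Proof.
apply: (@xm_ext _ _ _ _ (mulA^~ v) (mulA v)) u => [||a i ha].
- exact: mulA_linear_l.
- exact: mulA_linear_r.
apply: (@xm_ext _ _ _ _ (mulA (xm a i)) (mulA^~ (xm a i))) v => [||b j hb].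
- exact: mulA_linear_r.
- exact: mulA_linear_l.
by rewrite !mulA_xm // addrC [i + j]addrC.
Qed.

Lemma mulA_assoc (u v w : A4) : mulA u (mulA v w) = mulA (mulA u v) w.
Proof.
apply: (@xm_ext _ _ _ _ (mulA^~ (mulA v w)) (fun u => mulA (mulA u v) w)) u => [||a i ha].
- exact: mulA_linear_l.
- by move=> c u v'; rewrite !mulA_linear_l.
apply: (@xm_ext _ _ _ _ (fun v => mulA (xm a i) (mulA v w)) (fun v => mulA (mulA (xm a i) v) w)) v => [||b j hb].
- by move=> c u v'; rewrite mulA_linear_l mulA_linear_r.
- by move=> c u v'; rewrite mulA_linear_r mulA_linear_l.
apply: (@xm_ext _ _ _ _ (fun w => mulA (xm a i) (mulA (xm b j) w)) (mulA (mulA (xm a i) (xm b j)))) w => [||e l he].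
- by move=> c u v'; rewrite !mulA_linear_r.
- exact: mulA_linear_r.
by rewrite !mulA_xm ?in_idxD // !addrA.
Qed.

Lemma mul1A (u : A4) : mulA (xm 0 0) u = u.
Proof.
apply: (@xm_ext _ _ _ _ (mulA (xm 0 0)) id) u => [||a i ha //].
- exact: mulA_linear_r.
- by [].
by rewrite mulA_xm ?in_idx00 // !add0r.
Qed.

Lemma mulADl (u v w : A4) : mulA (u + v) w = mulA u w + mulA v w.
Proof. by have := mulA_linear_l w 1 u v; rewrite !scale1r. Qed.

Lemma xm00_neq0 : xm 0 0 != 0 :> A4.
Proof.
apply/eqP => /(congr1 (fun u => cf u 0 0)); rewrite cf_xm cf0 eqxx in_idx00 => /eqP.
by rewrite oner_eq0.
Qed.

Lemma scale_mulA c (u v : A4) : c *: mulA u v = mulA (c *: u) v.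
Proof.
have := mulA_linear_l v c u 0; rewrite !addr0 => ->.
by have := mulA_linear_l v (-1) 0 0; rewrite scaler0 addr0 scaleN1r addNr => ->; rewrite addr0.
Qed.
End Ring.

(** The ring axioms depend on the shape of J; the alias keeps that hypothesis in
    the type, so that the algebra structure can be found on it. *)
Definition xuA (F : fieldType) (Gam : zmodClosed 'rV[F]_4) (J : 'I_4 -> set nat)
  (hJ : index_shape J) : Type := A4 Gam J.

Section RingInstance.
Variables (F : fieldType) (Gam : zmodClosed 'rV[F]_4) (J : 'I_4 -> set nat).
Hypothesis hJ : index_shape J.
HB.instance Definition _ := GRing.Lmodule.copy (xuA Gam hJ) (A4 Gam J).
HB.instance Definition _ := GRing.Zmodule_isComNzRing.Build (xuA Gam hJ)
  (@mulA_assoc F Gam J hJ) (@mulA_comm F Gam J) (@mul1A F Gam J hJ)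
  (@mulADl F Gam J) (@xm00_neq0 F Gam J hJ).
HB.instance Definition _ := GRing.Lmodule_isLalgebra.Build F (xuA Gam hJ)
  (@scale_mulA F Gam J).
HB.instance Definition _ := GRing.Lalgebra_isComAlgebra.Build F (xuA Gam hJ).
End RingInstance.

Lemma sum_pos (V : zmodType) (f : 'I_4 -> V) :
  \sum_p f p = f pos1 + f pos2 + f pos3 + f pos4.
Proof.
rewrite !big_ord_recl big_ord0 addr0 !addrA.
by congr (_ + _ + _ + _); congr f; apply: val_inj.
Qed.

Lemma derivationD (F : fieldType) (A : comAlgType F) (d d' : A -> A) : derivation d -> derivation d' ->
  derivation (fun u => d u + d' u).
Proof.
move=> D D'; split=> [u v|u v|c].
- by rewrite (derD D) (derD D') addrACA.
- by rewrite (derM D) (derM D'); ring.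
by rewrite (derK D) (derK D') addr0.
Qed.

Definition gam (F : fieldType) (Gam : zmodClosed 'rV[F]_4) : Type := {a | a \in Gam}.
HB.instance Definition _ (F : fieldType) (Gam : zmodClosed 'rV[F]_4) :=
  SubType.copy (gam Gam) {a | a \in Gam}.
HB.instance Definition _ (F : fieldType) (Gam : zmodClosed 'rV[F]_4) :=
  [Choice of gam Gam by <:].
HB.instance Definition _ (F : fieldType) (Gam : zmodClosed 'rV[F]_4) :=
  [SubChoice_isSubZmodule of gam Gam by <:].

Section Concrete.
Variables (F : fieldType) (char0 : [pchar F] =i pred0).
Variables (Gam : zmodClosed 'rV[F]_4) (J : 'I_4 -> set nat).
Hypothesis hJ : index_shape J.
Local Notation A4 := (A4 Gam J).
Local Notation A := (xuA Gam hJ).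
Local Notation xm := (@xm F Gam J).
Local Notation in_idx := (in_idx Gam J).
Local Notation lin_ext := (@lin_ext F Gam J _).
Local Notation del := (@del F Gam J).
Local Notation dtA := (@dtA F Gam J).
Local Notation dmuA := (@dmuA F Gam J).

Lemma KE (c : F) (u : A) : c%:K * u = c *: u.
Proof. exact: mulr_algl. Qed.

Lemma xmM a i b j : in_idx (a, i) -> in_idx (b, j) ->
  (xm a i : A) * (xm b j : A) = xm (a + b) (i + j).
Proof. exact: mulA_xm. Qed.

Lemma leibniz_ext (d : A -> A) : linear d ->
  (forall a i b j, in_idx (a, i) -> in_idx (b, j) ->
    d (xm (a + b) (i + j)) = d (xm a i) * (xm b j : A) + (xm a i : A) * d (xm b j)) ->
  derivation d.
Proof.
move=> ld hd.
have dD u v : d (u + v) = d u + d v by have := ld 1 u v; rewrite !scale1r.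
have dM (u v : A) : d (u * v) = d u * v + u * d v.
  apply: (@xm_ext _ _ _ A (fun u : A => d (u * v)) (fun u : A => d u * v + u * d v)) u => [||a i ha].
  - by move=> c u w; rewrite mulrDl -scalerAl ld.
  - move=> c u w; rewrite ld !mulrDl -!scalerAl scalerDr -!addrA.
    by congr (_ + _); rewrite addrCA.
  apply: (@xm_ext _ _ _ A (fun v : A => d ((xm a i : A) * v))
    (fun v : A => d (xm a i) * v + (xm a i : A) * d v)) v => [||b j hb].
  - by move=> c u w; rewrite mulrDr -scalerAr ld.
  - move=> c u w; rewrite ld !mulrDr -!scalerAr scalerDr -!addrA.
    by congr (_ + _); rewrite addrCA.
  by rewrite xmM // hd.
have d1 : d 1 = 0.
  by have := dM 1 1; rewrite !mulr1 mul1r => /eqP; rewrite -subr_eq0 opprD addNKr oppr_eq0 => /eqP.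
split=> // c; have d0 : d 0 = 0 by apply: (addrI (d 0)); rewrite -dD !addr0.
by have := ld c 1 0; rewrite d1 d0 scaler0 !addr0.
Qed.

Lemma dmuA_xm mu a i : dmuA mu (xm a i) = mu a *: xm a i.
Proof.
rewrite /Defs.dmuA lin_ext_xm; case: ifP => // h.
by rewrite xm_out ?h // scaler0.
Qed.

Lemma dtA_xm p a i : in_idx (a, i) -> dtA p (xm a i) = (i 0 p)%:R *: xm a (dec i p).
Proof. by move=> h; rewrite /Defs.dtA lin_ext_xm h. Qed.

Lemma del_xm p a i : in_idx (a, i) ->
  del p (xm a i) = a 0 p *: xm a i + (i 0 p)%:R *: xm a (dec i p).
Proof. by move=> h; rewrite /Defs.del lin_ext_xm h. Qed.

Lemma dmuA_linear mu : linear (dmuA mu). Proof. exact: lin_ext_linear. Qed.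
Lemma dtA_linear p : linear (dtA p). Proof. exact: lin_ext_linear. Qed.
Lemma del_linear p : linear (del p). Proof. exact: lin_ext_linear. Qed.
Lemma linearZe (d : A4 -> A4) c u : linear d -> d (c *: u) = c *: d u.
Proof. by move=> ld; have := @linear_sum _ _ _ d unit [:: tt] (fun=> c) (fun=> u) ld; rewrite !big_seq1. Qed.
Lemma linear0e (d : A4 -> A4) : linear d -> d 0 = 0.
Proof. by move=> ld; have := linearZe 0 0 ld; rewrite !scale0r. Qed.
Lemma linearDe (d : A4 -> A4) u v : linear d -> d (u + v) = d u + d v.
Proof. by move=> ld; have := ld 1 u v; rewrite !scale1r. Qed.

Lemma dmuA_derivation (mu : 'rV[F]_4 -> F) :
  {in Gam &, forall a b, mu (a + b) = mu a + mu b} -> derivation (dmuA mu : A -> A).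
Proof.
move=> hmu; apply: leibniz_ext => [|a i b j ha hb]; first exact: lin_ext_linear.
rewrite !dmuA_xm -scalerAl -scalerAr xmM // hmu; last 2 first.
- by case/andP: ha.
- by case/andP: hb.
by rewrite scalerDl.
Qed.

Lemma decD (i j : 'rV[nat]_4) p : i 0 p != 0%N -> dec (i + j) p = dec i p + j.
Proof.
move=> ip; apply/rowP=> q; rewrite !mxE; have [->|_] := eqVneq q p; last by rewrite !subn0.
by case: (i 0 p) ip => // m _; rewrite !subn1.
Qed.

Lemma dtA_derivation p : derivation (dtA p : A -> A).
Proof.
apply: leibniz_ext => [|a i b j ha hb]; first exact: lin_ext_linear.
rewrite !dtA_xm ?in_idxD // -scalerAl -scalerAr !xmM ?in_idx_dec //.
rewrite mxE natrD scalerDl; congr (_ + _).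
  by have [->|ip] := eqVneq (i 0 p) 0%N; [rewrite !scale0r|rewrite decD].
have [->|jp] := eqVneq (j 0 p) 0%N; first by rewrite !scale0r.
by rewrite [i + j]addrC decD // [dec j p + i]addrC.
Qed.

Lemma delE p u : del p u = dmuA (fun a => a 0 p) u + dtA p u.
Proof.
apply: (@xm_ext _ _ _ _ (del p) (fun u => dmuA (fun a => a 0 p) u + dtA p u)) u => [||a i ha].
- exact: lin_ext_linear.
- by move=> c u v; rewrite dmuA_linear dtA_linear scalerDr addrACA.
by rewrite del_xm // dmuA_xm dtA_xm.
Qed.

Lemma del_derivation p : derivation (del p : A -> A).
Proof.
have -> : (del p : A -> A) = (fun u => dmuA (fun a => a 0 p) u + dtA p u).
  by apply/funext => u; exact: delE.
apply: derivationD; last exact: dtA_derivation.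
by apply: dmuA_derivation => a b _ _; rewrite mxE.
Qed.

Lemma dmu_dt_comm mu p (u : A4) : dmuA mu (dtA p u) = dtA p (dmuA mu u).
Proof.
apply: (@xm_ext _ _ _ _ (dmuA mu \o dtA p) (dtA p \o dmuA mu)) u => [||a i ha].
- by apply: linear_comp; exact: lin_ext_linear.
- by apply: linear_comp; exact: lin_ext_linear.
rewrite /= dtA_xm // dmuA_xm !linearZe ?dmuA_xm ?dtA_xm //; try exact: dmuA_linear; try exact: dtA_linear.
by rewrite !scalerA mulrC.
Qed.

Lemma dmu_dmu_comm mu nu (u : A4) : dmuA mu (dmuA nu u) = dmuA nu (dmuA mu u).
Proof.
apply: (@xm_ext _ _ _ _ (dmuA mu \o dmuA nu) (dmuA nu \o dmuA mu)) u => [||a i ha].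
- by apply: linear_comp; exact: lin_ext_linear.
- by apply: linear_comp; exact: lin_ext_linear.
rewrite /= !dmuA_xm !linearZe ?dmuA_xm //; try exact: dmuA_linear; try exact: dtA_linear.
by rewrite !scalerA mulrC.
Qed.

Lemma dec_dec (i : 'rV[nat]_4) p q : dec (dec i p) q = dec (dec i q) p.
Proof. by apply/rowP => r; rewrite !mxE subnAC. Qed.

Lemma dt_dt_comm p q (u : A4) : dtA p (dtA q u) = dtA q (dtA p u).
Proof.
apply: (@xm_ext _ _ _ _ (dtA p \o dtA q) (dtA q \o dtA p)) u => [||a i ha].
- by apply: linear_comp; exact: lin_ext_linear.
- by apply: linear_comp; exact: lin_ext_linear.
have [->//|pq] := eqVneq p q.
rewrite /= !dtA_xm // !linearZe ?dtA_xm ?in_idx_dec //; try exact: dmuA_linear; try exact: dtA_linear.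
rewrite !scalerA dec_dec !mxE (negbTE pq) [q == p]eq_sym (negbTE pq) !subn0.
by rewrite mulrC.
Qed.

Lemma del_comm p q (u : A4) : del p (del q u) = del q (del p u).
Proof.
rewrite !delE !(linearDe _ _ (@dmuA_linear _)) !(linearDe _ _ (@dtA_linear _)) dt_dt_comm dmu_dmu_comm !dmu_dt_comm -!addrA; congr (_ + _).
by rewrite addrCA.
Qed.

Lemma del_dmu p mu (u : A4) : dmuA mu (del p u) = del p (dmuA mu u).
Proof.
by rewrite !delE !(linearDe _ _ (@dmuA_linear _)) dmu_dmu_comm dmu_dt_comm.
Qed.
Lemma del_dt p q (u : A4) : dtA q (del p u) = del p (dtA q u).
Proof.
by rewrite !delE !(linearDe _ _ (@dtA_linear _)) dt_dt_comm dmu_dt_comm.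
Qed.

(** * Joint eigenvectors and primitives *)

Definition inc (i : 'rV[nat]_4) (p : 'I_4) : 'rV[nat]_4 := \row_q (i 0%R q + (q == p))%N.

Lemma dec_inc i p : dec (inc i p) p = i.
Proof. by apply/rowP=> q; rewrite !mxE addnK. Qed.

Lemma inc_dec (i : 'rV[nat]_4) p : i 0 p != 0%N -> inc (dec i p) p = i.
Proof.
move=> ip; apply/rowP=> q; rewrite !mxE; have [->|_] := eqVneq q p.
  by rewrite subnK // lt0n.
by rewrite subn0 addn0.
Qed.

Lemma inc_pos i p : inc i p 0 p = (i 0%R p).+1.
Proof. by rewrite mxE eqxx addn1. Qed.

Lemma in_idx_inc_inf a i p : J p = [set: nat] -> in_idx (a, i) -> in_idx (a, inc i p).
Proof.
move=> hp; rewrite !in_idxE => /andP[-> /asboolP h]; apply/asboolP => q.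
by rewrite mxE; have := h q; have [->|_] := eqVneq q p; rewrite ?hp // addn0.
Qed.

Lemma in_idx_inc_fin a i p : J p <> [set: nat] -> ~~ in_idx (a, inc i p).
Proof.
move=> hp; rewrite in_idxE negb_and; apply/orP; right; apply/asboolP => /(_ p).
by case: (hJ p) => // ->; rewrite inc_pos.
Qed.

Lemma cf_del p (u : A4) a i :
  cf (del p u) a i = a 0 p * cf u a i + (i 0 p).+1%:R * cf u a (inc i p).
Proof.
apply: (@xm_ext _ _ _ F^o (fun u => cf (del p u) a i)
  (fun u => a 0 p * cf u a i + (i 0 p).+1%:R * cf u a (inc i p))) u => [||b j hb].
- by move=> c u v; rewrite del_linear cf_linear.
- move=> c u v; rewrite !cfD !cfZ; rewrite !mulrDr scalerDr addrACA.
  by congr (_ + _); congr (_ + _); rewrite mulrCA.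
rewrite del_xm // cfD !cfZ !cf_xm hb (in_idx_dec hJ) // !andbT; congr (_ + _).
  by have [[-> _]|_] := eqVneq (b, j) (a, i); rewrite ?mulr0.
rewrite !xpair_eqE; have [_|_] /= := eqVneq b a; last by rewrite !mulr0.
have [j0|jp] := eqVneq (j 0 p) 0%N.
  rewrite j0 mul0r; case: eqP => [ej|]; last by rewrite mulr0.
  by move: j0; rewrite ej inc_pos.
have [->|ne] := eqVneq j (inc i p); first by rewrite dec_inc eqxx inc_pos.
case: eqP => [ei|]; last by rewrite !mulr0.
by case/eqP: ne; rewrite -ei inc_dec.
Qed.

Let natF n : (n.+1)%:R != 0 :> F.
Proof. by move/pcharf0P: char0 => ->. Qed.

Lemma inc_iter (i : 'rV[nat]_4) p n : iter n (inc^~ p) i 0 p = (i 0%R p + n)%N.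
Proof. by elim: n => [|n IH] /=; rewrite ?addn0 // inc_pos IH addnS. Qed.

(** If a_p <> l, the eigenvector equation makes the coefficients along i, i +
    1_p, i + 2 1_p and so on all nonzero. *)
Lemma cf_eigen p (v : A4) (l : F) a i : del p v = l *: v ->
  cf v a i != 0 -> a 0 p = l /\ i 0 p = 0%N.
Proof.
move=> e h.
have step (b : 'rV[F]_4) (j : 'rV[nat]_4) : (b 0 p - l) * cf v b j = - ((j 0 p).+1%:R * cf v b (inc j p)).
  have := congr1 (fun u => cf u b j) e; rewrite cf_del cfZ => e'.
  by apply/eqP; rewrite -subr_eq0 opprK mulrBl addrAC e' subrr.
have al : a 0 p = l.
  apply/eqP/negPn/negP => al.
  have nz n : cf v a (iter n (inc^~ p) i) != 0.
    elim: n => // n IH /=; apply/negP => /eqP h0.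
    have := step a (iter n (inc^~ p) i); rewrite h0 mulr0 oppr0 => /eqP.
    by rewrite mulf_eq0 subr_eq0 (negbTE al) (negbTE IH).
  have [N hN] := cf_bound v; have := hN _ _ (nz N.+1) p.
  by rewrite inc_iter addnS ltnNge leq_addl.
split=> //; apply/eqP/negPn/negP => ip.
have := step a (dec i p); rewrite al subrr mul0r inc_dec // => /eqP.
by rewrite eq_sym oppr_eq0 mulf_eq0 (negbTE (natF _)) (negbTE h).
Qed.

Lemma joint_eigen (l : 'rV[F]_4) (v : A4) : (forall p, del p v = l 0 p *: v) ->
  v = cf v l 0 *: xm l 0.
Proof.
move=> h; apply: cf_ext => a i; rewrite cfZ cf_xm.
have [hi|hi] := boolP (in_idx (a, i)); last first.
  rewrite [LHS]cf_out //; case: eqP => [->|_]; last by rewrite mulr0.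
  by rewrite (negbTE hi) mulr0.
have [[-> ->]|ne] := eqVneq (l, 0) (a, i).
  have [_|ho] := boolP (in_idx _); first by rewrite mulr1.
  by rewrite cf_out // mul0r.
rewrite mulr0; apply/eqP/negPn/negP => nz; case/eqP: ne.
by congr pair; apply/rowP=> p; have [al ip] := cf_eigen (h p) nz; rewrite ?al ?ip ?mxE.
Qed.

Lemma cf_del_fin p (u : A4) a i : J p <> [set: nat] -> cf (del p u) a i = a 0 p * cf u a i.
Proof.
move=> hp; rewrite cf_del [cf u a (inc _ _)]cf_out ?mulr0 ?addr0 //.
exact: in_idx_inc_fin.
Qed.

Lemma sigma1_lineP (v : A4) : (exists k : F, v = k *: xm sigma1 0) <->
  forall a i, (a, i) != (sigma1, 0) -> cf v a i = 0.
Proof.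
split=> [[k ->] a i ne|h]; first by rewrite cfZ cf_xm eq_sym (negbTE ne) mulr0.
exists (cf v sigma1 0); apply: cf_ext => a i; rewrite cfZ cf_xm.
have [hi|hi] := boolP (in_idx (a, i)); last first.
  rewrite [LHS]cf_out //; case: eqP => [->|_]; last by rewrite mulr0.
  by rewrite (negbTE hi) mulr0.
have [[-> ->]|ne] := eqVneq (sigma1, 0) (a, i).
  have [_|ho] := boolP (in_idx _); first by rewrite mulr1.
  by rewrite cf_out // mul0r.
by rewrite mulr0 h // eq_sym.
Qed.

Lemma del_diagonal p l (v : A4) : J p <> [set: nat] ->
  (exists k : F, del p (del p v - l *: v) - l *: (del p v - l *: v) = k *: xm sigma1 0) ->
  exists k : F, del p v - l *: v = k *: xm sigma1 0.
Proof.
move=> hp /sigma1_lineP h; apply/sigma1_lineP => a i ne.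
have := h a i ne; rewrite cfB cf_del_fin // cfZ cfB cf_del_fin // cfZ -!mulrBl.
by move=> /eqP; rewrite mulf_eq0 => /orP[/eqP->|/eqP//]; rewrite mul0r.
Qed.

Lemma del_diagonal0 p (v : A4) : J p <> [set: nat] -> del p (del p v) = 0 -> del p v = 0.
Proof.
move=> hp h; apply: cf_ext => a i; have := congr1 (fun u => cf u a i) h.
rewrite !cf_del_fin // !cf0 => /eqP.
by rewrite mulf_eq0 => /orP[/eqP->|/eqP//]; rewrite mul0r.
Qed.

Definition iset (i : 'rV[nat]_4) (p : 'I_4) (m : nat) : 'rV[nat]_4 :=
  \row_q (if q == p then m else i 0 q).

(** The solution u of l u + u' = t_p^m, for the derivative by t_p and l <> 0:
    the finite geometric series of a nilpotent operator. *)
Fixpoint prim_rec (l : F) a i p m : A4 :=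
  if m is m'.+1 then l^-1 *: (xm a (iset i p m) - m%:R *: prim_rec l a i p m')
  else l^-1 *: xm a (iset i p 0).

(** If c + a_p = 0 there remains a plain integration by t_p. Without t_p the
    monomial is 0 by convention, which is the source of the error K in
    [has_primitives]. *)
Definition prim_mon (p : 'I_4) (c : F) (a : 'rV[F]_4) (i : 'rV[nat]_4) : A4 :=
  if c + a 0 p == 0 then (i 0 p).+1%:R^-1 *: xm a (inc i p)
  else prim_rec (c + a 0 p) a i p (i 0 p).

Definition prim p c : A4 -> A4 := lin_ext (prim_mon p c).

Lemma iset_id i p : iset i p (i 0 p) = i.
Proof. by apply/rowP => q; rewrite mxE; case: eqP => [->|]. Qed.

Lemma dec_iset i p m : dec (iset i p m.+1) p = iset i p m.
Proof.
apply/rowP=> q; rewrite !mxE; case: eqP => _; last by rewrite subn0.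
by rewrite subn1.
Qed.

Lemma in_idx_iset a i p m : in_idx (a, iset i p m.+1) -> in_idx (a, iset i p m).
Proof. by move=> /(in_idx_dec hJ p); rewrite dec_iset. Qed.

Lemma prim_step (V : lmodType F) (l al m : F) (x x' r dr : V) : l != 0 ->
  dr + (l - al) *: r = x' ->
  l^-1 *: ((al *: x + m *: x') - m *: dr) + (l - al) *: (l^-1 *: (x - m *: r)) = x.
Proof.
move=> l0 <-; rewrite [(l - al) *: (l^-1 *: _)]scalerA [_ * l^-1]mulrC -[(l^-1 * _) *: _]scalerA.
rewrite -scalerDr [(l - al) *: (x - _)]scalerBr [m *: (dr + _)]scalerDr !scalerA [m * _]mulrC.
rewrite [m *: dr + _]addrC [al *: x + (_ *: r + _)]addrA addrK addrACA subrr addr0 -scalerDl addrC subrK.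
by rewrite scalerA mulVf // scale1r.
Qed.

Lemma prim_step0 (V : lmodType F) (n c al : F) (x y : V) : n != 0 -> c + al = 0 ->
  n^-1 *: (al *: y + n *: x) + c *: (n^-1 *: y) = x.
Proof.
move=> n0 e; rewrite scalerDr !scalerA mulVf // scale1r addrAC -scalerDl mulrC -mulrDl.
by rewrite addrC addrC [al + c]addrC e mul0r scale0r add0r.
Qed.

Lemma prim_rec_del l (a : 'rV[F]_4) i p m : l != 0 -> in_idx (a, iset i p m) ->
  del p (prim_rec l a i p m) + (l - a 0 p) *: prim_rec l a i p m = xm a (iset i p m).
Proof.
have dl := @del_linear p.
move=> l0; elim: m => [|m IH] hm.
  rewrite /= (linearZe _ _ dl) del_xm // !mxE eqxx scale0r addr0.
  by rewrite !scalerA -scalerDl mulrC -mulrDl addrC subrK mulfV // scale1r.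
have := @prim_step _ l (a 0 p) m.+1%:R (xm a (iset i p m.+1)) _ _ _ l0 (IH (in_idx_iset hm)).
move=> <-; rewrite [prim_rec _ _ _ _ m.+1]/=; congr (_ + _).
rewrite (linearZe _ _ dl) (linearDe _ _ dl) -!scaleNr (linearZe _ _ dl) del_xm //.
by rewrite dec_iset !mxE eqxx.
Qed.

Lemma prim_spec p c (a : 'rV[F]_4) i : in_idx (a, i) ->
  let K := xm a i - (del p (prim p c (xm a i)) + c *: prim p c (xm a i)) in
  del p K + c *: K = 0 /\ (J p = [set: nat] -> K = 0).
Proof.
move=> hi; have dl := @del_linear p; rewrite /prim lin_ext_xm hi /prim_mon.
have [e|ne] := eqVneq (c + a 0 p) 0; last first.
  have := @prim_rec_del (c + a 0 p) a i p (i 0 p) ne.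
  rewrite iset_id addrK => /(_ hi) ->; rewrite subrr /=.
  by rewrite (linear0e dl) scaler0 addr0.
have [hp|hp] := EM (J p = [set: nat]).
  have hi' := in_idx_inc_inf hp hi.
  rewrite (linearZe _ _ dl) del_xm // dec_inc inc_pos prim_step0 // subrr /=.
  by rewrite (linear0e dl) scaler0 addr0.
rewrite [xm a (inc i p)]xm_out; last exact: in_idx_inc_fin.
rewrite !scaler0 (linear0e dl) addr0 subr0; split=> //=; apply: cf_ext => b j.
rewrite cfD cfZ cf_del_fin // -mulrDl cf0 cf_xm addrC.
by case: eqP => [[<- _]|_]; rewrite ?mulr0 // e mul0r.
Qed.

Lemma iset_dec i p q m : q != p -> iset (dec i q) p m = dec (iset i p m) q.
Proof.
move=> qp; apply/rowP=> r; rewrite !mxE; have [->|//] := eqVneq r p.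
by rewrite eq_sym (negbTE qp) subn0.
Qed.

Lemma scale_comm (V : lmodType F) (l al n k : F) (u v r s : V) :
  l *: ((al *: u + n *: v) + k *: (al *: r + n *: s))
  = al *: (l *: (u + k *: r)) + n *: (l *: (v + k *: s)).
Proof.
rewrite !scalerA [al * l]mulrC [n * l]mulrC -[(l * al) *: _]scalerA -[(l * n) *: _]scalerA.
rewrite -[RHS]scalerDr; congr (_ *: _); rewrite !scalerDr [RHS]addrACA !scalerA.
by rewrite [al * k]mulrC [n * k]mulrC.
Qed.

Lemma prim_rec_comm l (a : 'rV[F]_4) (i : 'rV[nat]_4) p q m : q != p ->
  in_idx (a, iset i p m) ->
  del q (prim_rec l a i p m) = a 0 q *: prim_rec l a i p m
    + (i 0 q)%:R *: prim_rec l a (dec i q) p m.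
Proof.
have dl := @del_linear q; move=> qp; elim: m => [|m IH] hm /=.
  rewrite (linearZe _ _ dl) del_xm // iset_dec // mxE (negbTE qp) scalerDr !scalerA.
  by rewrite mulrC [l^-1 * _]mulrC.
rewrite (linearZe _ _ dl) (linearDe _ _ dl) -!scaleNr (linearZe _ _ dl) del_xm //.
rewrite (IH (in_idx_iset hm)) iset_dec // [iset _ _ _ _ _]mxE (negbTE qp).
by rewrite scale_comm.
Qed.

Lemma prim_comm p q c (u : A4) : q != p -> del q (prim p c u) = prim p c (del q u).
Proof.
move=> qp; apply: (@xm_ext _ _ _ _ (del q \o prim p c) (prim p c \o del q)) u => [||a i hi].
- by apply: linear_comp; [exact: lin_ext_linear|exact: del_linear].
- by apply: linear_comp; [exact: del_linear|exact: lin_ext_linear].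
have dl := @del_linear q; have pl : linear (prim p c) by exact: lin_ext_linear.
rewrite /= del_xm // (linearDe _ _ pl) !(linearZe _ _ pl) /prim !lin_ext_xm hi in_idx_dec //.
rewrite /prim_mon; have [e|ne] := eqVneq (c + a 0 p) 0.
  rewrite (linearZe _ _ dl) mxE [p == q]eq_sym (negbTE qp) subn0.
  have [hp|hp] := EM (J p = [set: nat]).
    rewrite del_xm ?in_idx_inc_inf // scalerDr !scalerA mulrC [_ * (_%:R)]mulrC.
    rewrite [inc i p 0 q]mxE (negbTE qp) addn0; congr (_ + _ *: xm a _).
    by apply/rowP=> r; rewrite !mxE; have [->|_] := eqVneq r p; rewrite ?[p == q]eq_sym ?(negbTE qp) ?subn0 ?addn0.
  by rewrite !xm_out ?in_idx_inc_fin // (linear0e dl) !scaler0 addr0.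
have ii : in_idx (a, iset i p (i 0 p)) by rewrite iset_id.
rewrite (prim_rec_comm _ qp ii) mxE [p == q]eq_sym (negbTE qp) subn0 //.
Qed.

(** * The decomposition on A4 *)

Let G := gam Gam.
Let co (p : 'I_4) (a : G) : F := val a 0 p.
Let Xe (a : G) : A := xm (val a) 0.
Let We : A := xm sigma1 0.
Let te (i : 'rV[nat]_4) : A := xm 0 i.
Let infp (p : 'I_4) : bool := `[< J p = [set: nat] >].

Lemma coD p (a b : G) : co p (a + b) = co p a + co p b.
Proof. by rewrite /co raddfD mxE. Qed.

Lemma in_idx_gam (a : G) : in_idx (val a, 0).
Proof. by rewrite in_idxE (valP a); apply/asboolP/(Jprod0 hJ). Qed.

Lemma XeD (a b : G) : Xe (a + b) = Xe a * Xe b.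
Proof. by rewrite /Xe xmM ?in_idx_gam // raddfD addr0. Qed.

Lemma Xe0 : Xe 0 = 1.
Proof. by rewrite /Xe raddf0. Qed.

Lemma del_xm0 p a : del p (xm a 0) = a 0 p *: xm a 0.
Proof.
have [h|h] := boolP (in_idx (a, 0)); last by rewrite xm_out // (linear0e (@del_linear p)) scaler0.
by rewrite del_xm // mxE scale0r addr0.
Qed.

Lemma del_Xe p (a : G) : (del p (Xe a) : A) = (co p a)%:K * Xe a.
Proof. by rewrite KE; exact: del_xm0. Qed.

Lemma inJE i : inJ infp i = `[< Jprod J i >].
Proof.
have fin p : J p = [set 0%N] -> infp p = false.
  move=> e; apply/asboolP; rewrite e => e'.
  by have : [set 0%N] 1%N by rewrite e'.
have cof p : J p = [set: nat] -> infp p by move=> e; apply/asboolP.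
apply/forallP/asboolP => h p; have := h p; case: (hJ p) => e.
- by rewrite fin // e => /eqP.
- by rewrite e.
- by rewrite fin // e => /eqP.
by rewrite cof.
Qed.

Lemma in_idx_te i : inJ infp i -> in_idx (0, i).
Proof. by rewrite inJE in_idxE rpred0. Qed.

Lemma te_mul i j : inJ infp i -> inJ infp j -> te (i + j) = te i * te j.
Proof. by move=> hi hj; rewrite /te xmM ?in_idx_te // addr0. Qed.

Lemma del_te p i : inJ infp i -> (del p (te i) : A) = (i 0 p)%:R%:K * te (dec i p).
Proof. by move=> hi; rewrite KE /te del_xm ?in_idx_te // mxE scale0r add0r. Qed.

Lemma monE (a : G) i : inJ infp i -> mon Xe te a i = xm (val a) i.
Proof. by move=> hi; rewrite /mon /Xe /te xmM ?in_idx_gam ?in_idx_te // addr0 add0r. Qed.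

Lemma prim_linop p c : linop (prim p c : A -> A).
Proof. by move=> k u v; rewrite !KE; exact: lin_ext_linear. Qed.

Lemma prim_total p c (w : A4) :
  let K := w - (del p (prim p c w) + c *: prim p c w) in
  del p K + c *: K = 0 /\ (J p = [set: nat] -> K = 0).
Proof.
have dl := @del_linear p; have pl : linear (prim p c) by exact: lin_ext_linear.
pose f w := w - (del p (prim p c w) + c *: prim p c w).
have lf : linear f.
  move=> k u v; rewrite /f pl dl [c *: (_ + _)]scalerDr scalerA mulrC -scalerA.
  by rewrite [X in _ - X]addrACA -scalerDr opprD addrACA -scalerBr.
rewrite -/(f w) /=; split=> [|hp].
  apply: (@xm_ext _ _ _ _ (fun w => del p (f w) + c *: f w) (fun=> 0)) w => [||a i hi].
  - by move=> k u v; rewrite lf dl !scalerDr !scalerA [c * k]mulrC addrACA.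
  - by move=> k u v; rewrite scaler0 addr0.
  by case: (prim_spec p c hi).
apply: (@xm_ext _ _ _ _ f (fun=> 0)) w => [//||a i hi].
- by move=> k u v; rewrite scaler0 addr0.
by case: (prim_spec p c hi) => _; apply.
Qed.

Lemma has_primitives_del p q r s c : q != p -> r != p -> s != p ->
  has_primitives (del p : A -> A) c (infp p) (del q) (del r) (del s).
Proof.
move=> qp rp sp; exists (prim p c); split; try by move=> u; exact: prim_comm.
  exact: prim_linop.
move=> w /=; have [h1 h2] := prim_total p c w.
rewrite (KE c (prim p c w)) KE.
by split; [exact: h1|move/asboolP; exact: h2].
Qed.

Lemma neglE (v : A) : negl We v <-> exists k : F, v = k *: xm sigma1 0 :> A4.
Proof. by split=> -[k ->]; exists k; rewrite KE. Qed.

Lemma infpN p : ~~ infp p -> J p <> [set: nat].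
Proof. by move=> /asboolP. Qed.

Lemma del_diag p : diagonal We (del p : A -> A) (infp p).
Proof.
move=> /infpN hp l v; rewrite !KE => /neglE h; apply/neglE; exact: del_diagonal.
Qed.

Lemma eigen_vec (l1 l2 l3 l4 : F) (v : A4) :
  del pos1 v = l1 *: v -> del pos2 v = l2 *: v -> del pos3 v = l3 *: v -> del pos4 v = l4 *: v ->
  let l := \row_p (if p == pos1 then l1 else if p == pos2 then l2 else if p == pos3 then l3 else l4) in
  exists k : F, v = k *: xm l 0.
Proof.
move=> h1 h2 h3 h4 l; exists (cf v l 0); apply: joint_eigen => p; rewrite mxE.
by case: (pos_cases p) => ->.
Qed.

Lemma scalar_vec (v : A4) : del pos1 v = 0 -> del pos2 v = 0 -> del pos3 v = 0 ->
  del pos4 v = 0 -> exists k : F, v = k%:K :> A.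
Proof.
move=> h1 h2 h3 h4; have [||||k ->] := @eigen_vec 0 0 0 0 v; rewrite ?scale0r //.
exists k; rewrite -[RHS]mulr1 KE; congr (_ *: _); congr xm.
by apply/rowP=> p; rewrite !mxE; do 3!case: ifP => _ //.
Qed.

Lemma sigma1_vec (v : A4) : del pos1 v = 0 -> del pos2 v = 0 -> del pos3 v = - v ->
  del pos4 v = 0 -> negl We v.
Proof.
move=> h1 h2 h3 h4; have [||||k ->] := @eigen_vec 0 0 (-1) 0 v; rewrite ?scale0r ?scaleN1r //.
apply/neglE; exists k; congr (_ *: _); congr xm.
by apply/rowP=> p; rewrite mxE sigma1E; case: (pos_cases p) => ->; rewrite ?oppr0.
Qed.

Lemma at_posE (a : F) p q : at_pos a p 0 q = if q == p then a else 0.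
Proof. by rewrite !mxE eqxx /=; case: eqP; rewrite ?mulr1 ?mulr0. Qed.

Lemma sigmaD : (sigma + sigma1 : 'rV[F]_4) = at_pos 1 pos1.
Proof. exact: addrK. Qed.

Lemma sigma_gam (GamA : condA Gam) : sigma \in Gam. Proof. by case: GamA. Qed.

Lemma xm_sigma (GamA : condA Gam) : (xm sigma 0 : A) * We = xm (sigma + sigma1) 0.
Proof.
have [h|h] := boolP (sigma1 \in Gam).
  have i0 b : b \in Gam -> in_idx (b, 0).
    by move=> hb; rewrite in_idxE hb; apply/asboolP/(Jprod0 hJ).
  by rewrite /We xmM ?i0 ?sigma_gam // addr0.
have -> : We = 0 by rewrite /We xm_out // in_idxE (negbTE h).
rewrite mulr0.
rewrite xm_out // in_idxE; apply/negP => /andP[h' _]; case/negP: h.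
by rewrite -[sigma1](addrK sigma) rpredB ?sigma_gam // addrC.
Qed.

Lemma sigma_line_vec (GamA : condA Gam) (v : A4) : del pos1 v = v -> del pos2 v = 0 ->
  del pos3 v = 0 -> del pos4 v = 0 ->
  exists k : F, v = k%:K * ((xm sigma 0 : A) * We) :> A.
Proof.
move=> h1 h2 h3 h4; have [||||k ->] := @eigen_vec 1 0 0 0 v; rewrite ?scale0r ?scale1r //.
exists k; rewrite xm_sigma // KE; congr (_ *: _); congr xm.
rewrite sigmaD; apply/rowP=> p; rewrite at_posE mxE.
by case: (pos_cases p) => ->.
Qed.

Lemma sigmaE p : sigma 0 p = if (p == pos1) || (p == pos3) then 1 else 0 :> F.
Proof.
by rewrite /sigma mxE !at_posE; case: (pos_cases p) => ->; rewrite /= ?addr0 ?add0r.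
Qed.

Lemma sigma2E p : sigma2 0 p = if p == pos1 then 1 else if p == pos3 then - 2%:R else 0 :> F.
Proof.
by rewrite /sigma2 mxE [X in _ + X]mxE !at_posE; case: (pos_cases p) => ->;
  rewrite /= ?oppr0 ?addr0 ?add0r.
Qed.

Lemma is_sg2E (a : G) :
  is_sg2 (co pos1) (co pos2) (co pos3) (co pos4) a = (val a == sigma2).
Proof.
apply/and4P/eqP => [[/eqP h1 /eqP h2 /eqP h3 /eqP h4]|e]; last first.
  by rewrite /co e !sigma2E /=; split.
apply/rowP=> p; rewrite sigma2E.
by case: (pos_cases p) => ->.
Qed.

Lemma exists_inf : [exists p, infp p] = ~~ `[< Jprod J = [set 0] >].
Proof.
apply/existsP/asboolPn => [[p /asboolP hp] e|h].
  have : Jprod J (unit4 p).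
    move=> q; rewrite mxE; have [->|_] := eqVneq q p; first by rewrite hp.
    by case: (hJ q) => ->.
  by rewrite e => /rowP/(_ p); rewrite !mxE eqxx.
apply: contrapT => hn; apply: h; apply/seteqP; split=> i /= hi.
  apply/rowP=> p; rewrite mxE; have := hi p; case: (hJ p) => e; rewrite e //.
  by case: hn; exists p; apply/asboolP.
by rewrite hi; exact: (Jprod0 hJ).
Qed.

Definition dom4 (a : 'rV[F]_4) i := in_idx (a, i) /\ (Jprod J = [set 0] -> a <> sigma2).

Lemma domE (a : G) i :
  dom (co pos1) (co pos2) (co pos3) (co pos4) infp a i <-> dom4 (val a) i.
Proof.
rewrite /dom is_sg2E exists_inf inJE /dom4 in_idxE (valP a) /=.
split=> [/andP[h1 h2]|[h1 h2]].
  by split=> // e ea; case/orP: h2 => [/asboolPn//|/eqP].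
rewrite h1 /=; have [e|e] := pselect (Jprod J = [set 0]).
  by apply/orP; right; apply/eqP; exact: h2.
by apply/orP; left; apply/asboolP.
Qed.

Definition gam_fun (mu : G -> F) (a : 'rV[F]_4) : F :=
  if insub a is Some g then mu g else 0.

Lemma gam_fun_val mu (a : G) : gam_fun mu (val a) = mu a.
Proof. by rewrite /gam_fun valK. Qed.

Lemma gam_fun_homZ mu (sg : G) : val sg = sigma -> (forall a b, mu (a + b) = mu a + mu b) ->
  mu sg = 0 -> homZ Gam (gam_fun mu).
Proof.
move=> esg hmu msg; split; last by rewrite -esg gam_fun_val.
move=> a b ha hb; pose a' : G := exist _ a ha; pose b' : G := exist _ b hb.
rewrite -[a]/(val a') -[b]/(val b') -(raddfD (val : G -> _)).
by rewrite !gam_fun_val.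
Qed.

Local Notation brA := (@brA F Gam J).

Local Notation Br sg := (br sg (del pos1 : A -> A) (del pos2 : A -> A)
  (del pos3 : A -> A) (del pos4 : A -> A) Xe).
Local Notation Brder sg := (brder sg (del pos1 : A -> A) (del pos2 : A -> A)
  (del pos3 : A -> A) (del pos4 : A -> A) Xe).

Lemma brE (sg : G) (u v : A) : val sg = sigma -> Br sg u v = brA u v.
Proof. by move=> e; rewrite /br /Xe e. Qed.

Lemma ring_der_brder (sg : G) (d : A -> A) : val sg = sigma -> derivation d ->
  (forall p u, d (del p u) = del p (d u)) -> d (xm sigma 0) = 0 -> Brder sg d.
Proof.
move=> esg D dp ds; apply: brder_derivation => //; try exact: del_derivation; try exact: dp.
by rewrite /Xe esg.
Qed.

Lemma dtA_xm0 p a : dtA p (xm a 0) = 0.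
Proof.
have [h|h] := boolP (in_idx (a, 0)); last by rewrite xm_out // (linear0e (@dtA_linear p)).
by rewrite dtA_xm // mxE scale0r.
Qed.

Lemma weight_brder (sg : G) (mu : 'rV[F]_4 -> F) : val sg = sigma -> homZ Gam mu ->
  Brder sg (dmuA mu : A -> A).
Proof.
move=> esg [hmu ms]; apply: ring_der_brder => //; first exact: dmuA_derivation.
- by move=> p u; exact: del_dmu.
by rewrite dmuA_xm ms scale0r.
Qed.

Lemma dt_brder (sg : G) p : val sg = sigma -> Brder sg (dtA p : A -> A).
Proof.
move=> esg; apply: ring_der_brder => //; first exact: dtA_derivation.
- by move=> q u; exact: del_dt.
exact: dtA_xm0.
Qed.

Hypothesis GamA : condA Gam.

(** Also true if sigma1 is not in Gam: then both sides are 0. *)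
Lemma sigma1_mulE (b : 'rV[F]_4) j : in_idx (b, j) ->
  We * (xm b j : A) = xm (b - at_pos 1 pos3) j.
Proof.
move=> hb; have [h|h] := boolP (sigma1 \in Gam).
  rewrite /We xmM ?add0r 1?addrC //.
  by rewrite in_idxE h; apply/asboolP/(Jprod0 hJ).
have -> : We = 0 by rewrite /We xm_out // in_idxE (negbTE h).
rewrite mul0r xm_out // in_idxE; apply/negP => /andP[h' _]; case/negP: h.
rewrite -[sigma1](addKr b) rpredD ?rpredN //; by case/andP: hb.
Qed.

Lemma sigma_mulE (b : 'rV[F]_4) j : in_idx (b, j) ->
  (xm sigma 0 : A) * We * (xm b j : A) = xm (b + at_pos 1 pos1) j.
Proof.
move=> hb; rewrite -mulrA sigma1_mulE //.
have i0 : in_idx (sigma, 0).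
  by rewrite in_idxE sigma_gam //; apply/asboolP/(Jprod0 hJ).
have eb : sigma + (b - at_pos 1 pos3) = b + at_pos 1 pos1.
  by rewrite -sigmaD addrCA.
have [h|h] := boolP (in_idx (b - at_pos 1 pos3, j)).
  by rewrite xmM // add0r eb.
rewrite [xm (b - _) j]xm_out // mulr0 xm_out // -eb.
move: h; apply: contra; rewrite !in_idxE => /andP[h1 h2]; rewrite h2 andbT.
by rewrite -[b - _](addKr sigma) rpredD ?rpredN ?sigma_gam.
Qed.

Lemma mul_linear_l (c : A) (d : A4 -> A4) : linear d -> linear (fun v => c * (d v : A) : A).
Proof. by move=> ld k u v; rewrite ld mulrDr -scalerAr. Qed.

Lemma dA1E (v : A4) : dA pos1 v = (xm sigma 0 : A) * We * (del pos2 v : A).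
Proof.
apply: (@xm_ext _ _ _ _ (dA pos1) (fun v => (xm sigma 0 : A) * We * (del pos2 v : A) : A)) v => [||a i hi].
- exact: lin_ext_linear.
- exact: mul_linear_l (@del_linear pos2).
rewrite del_xm // mulrDr -!scalerAr !sigma_mulE ?in_idx_dec //.
by rewrite /dA (tnth_nth id) /= /dA1 lin_ext_xm hi.
Qed.

Lemma dA2E (v : A4) : dA pos2 v = - ((xm sigma 0 : A) * We * (del pos1 v : A)).
Proof.
apply: (@xm_ext _ _ _ _ (dA pos2) (fun v => - ((xm sigma 0 : A) * We * (del pos1 v : A)) : A)) v => [||a i hi].
- exact: lin_ext_linear.
- by move=> k u v; rewrite (mul_linear_l _ (@del_linear pos1)) opprD scalerN.
rewrite del_xm // mulrDr -!scalerAr !sigma_mulE ?in_idx_dec //.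
by rewrite /dA (tnth_nth id) /= /dA2 lin_ext_xm hi opprD scaleNr.
Qed.

Lemma dA3E (v : A4) : dA pos3 v = We * (del pos4 v : A).
Proof.
apply: (@xm_ext _ _ _ _ (dA pos3) (fun v => We * (del pos4 v : A) : A)) v => [||a i hi].
- exact: lin_ext_linear.
- exact: mul_linear_l (@del_linear pos4).
rewrite del_xm // mulrDr -!scalerAr !sigma1_mulE ?in_idx_dec //.
by rewrite /dA (tnth_nth id) /= /dA3 lin_ext_xm hi.
Qed.

Lemma dA4E (v : A4) : dA pos4 v = - (We * ((v : A) + (del pos3 v : A))).
Proof.
apply: (@xm_ext _ _ _ _ (dA pos4) (fun v => - (We * ((v : A) + (del pos3 v : A))) : A)) v => [||a i hi].
- exact: lin_ext_linear.
- move=> k u v; rewrite (@del_linear pos3) addrACA -scalerDr.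
  by rewrite mulrDr -scalerAr opprD scalerN.
rewrite del_xm // !mulrDr -!scalerAr !sigma1_mulE ?in_idx_dec //.
rewrite /dA (tnth_nth id) /= /dA4 lin_ext_xm hi.
by rewrite scaleNr -opprD; congr (- _); rewrite scalerDl scale1r addrA [X in X + _]addrC.
Qed.

Theorem concrete_decomposition (E : A4 -> A4) : linear E ->
  (forall a i b j, dom4 a i -> dom4 b j -> exists k : F,
     E (brA (xm a i) (xm b j)) - (brA (E (xm a i)) (xm b j) + brA (xm a i) (E (xm b j)))
     = k *: xm sigma1 0) ->
  exists (u : A4) (k : 'I_4 -> F) (mu : 'rV[F]_4 -> F) (tau : 'I_4 -> F), homZ Gam mu /\
  forall a i, dom4 a i -> exists l : F,
    E (xm a i) - (brA u (xm a i) + \sum_p k p *: dA p (xm a i) + dmuA mu (xm a i)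
      + \sum_p tau p *: dtA p (xm a i)) = l *: xm sigma1 0.
Proof.
move=> lE hE.
have [_ hGam _ _] := GamA.
have [a1 a10 g1] := hGam pos1; have [a2 a20 g2] := hGam pos2.
have [a3 a30 g3] := hGam pos3; have [a4 a40 g4] := hGam pos4.
pose sg : G := exist (fun a => a \in Gam) sigma (sigma_gam GamA).
pose e1 : G := exist (fun a => a \in Gam) _ g1; pose e2 : G := exist (fun a => a \in Gam) _ g2.
pose e3 : G := exist (fun a => a \in Gam) _ g3; pose e4 : G := exist (fun a => a \in Gam) _ g4.
have sgE : [/\ co pos1 sg = 1, co pos2 sg = 0, co pos3 sg = 1 & co pos4 sg = 0].
  by rewrite /co /= !sigmaE.
have e1E : [/\ co pos1 e1 != 0, co pos2 e1 = 0, co pos3 e1 = 0 & co pos4 e1 = 0].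
  by rewrite /co /= !at_posE.
have e2E : [/\ co pos1 e2 = 0, co pos2 e2 != 0, co pos3 e2 = 0 & co pos4 e2 = 0].
  by rewrite /co /= !at_posE.
have e3E : [/\ co pos1 e3 = 0, co pos2 e3 = 0, co pos3 e3 != 0 & co pos4 e3 = 0].
  by rewrite /co /= !at_posE.
have e4E : [/\ co pos1 e4 = 0, co pos2 e4 = 0, co pos3 e4 = 0 & co pos4 e4 != 0].
  by rewrite /co /= !at_posE.
have D p := del_derivation p.
have hW : [/\ (del pos1 We : A) = 0, (del pos2 We : A) = 0,
    (del pos3 We : A) = - We & (del pos4 We : A) = 0].
  by split; rewrite /We del_sigma1 sigma1E /= ?oppr0 ?scale0r // scaleN1r.
have wd mu : (forall a b, mu (a + b) = mu a + mu b) -> mu sg = 0 ->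
    exists M : A -> A, Brder sg M /\
      forall a i, M (mon Xe te a i) = (mu a)%:K * mon Xe te a i.
  move=> hmu ms; exists (dmuA (gam_fun mu)); split.
    by apply: weight_brder => //; apply: gam_fun_homZ hmu ms.
  move=> a i; have [hi|hi] := boolP (inJ infp i).
    by rewrite monE // dmuA_xm gam_fun_val KE.
  have ti : te i = 0.
    by rewrite /te xm_out // in_idxE negb_and -inJE hi orbT.
  by rewrite /mon ti !mulr0; exact: linear0e (@dmuA_linear _).
have sd tau : exists M : A -> A, Brder sg M /\ forall a i, inJ infp i ->
    M (mon Xe te a i) = \sum_p (tau p * (i 0 p)%:R)%:K * mon Xe te a (dec i p).
  exists (fun v : A => \sum_p (tau p)%:K * (dtA p v : A)); split.
    by apply: brder_sum; [exact: D|exact: D|exact: D|exact: D|move=> p; exact: dt_brder].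
  move=> a i hi; apply: eq_bigr => p _.
  have hp : inJ infp (dec i p) by exact: inJ_dec.
  have hx : in_idx (val a, i) by rewrite in_idxE (valP a) -inJE.
  by rewrite !monE // dtA_xm // !KE scalerA.
have hE' : isder (co pos1) (co pos2) (co pos3) (co pos4) sg
   (del pos1 : A -> A) (del pos2 : A -> A) (del pos3 : A -> A) (del pos4 : A -> A)
   Xe We infp te (E : A -> A).
  split; first by move=> c u v; rewrite !KE lE.
  move=> a i b j ha hb; have hi := dom_inJ ha; have hj := dom_inJ hb.
  rewrite !monE // !brE //; apply/neglE; apply: hE; exact/domE.
have e0 (v : A) : (del pos1 v : A) = 0 -> (del pos2 v : A) = 0 -> (del pos3 v : A) = 0 ->
    (del pos4 v : A) = 0 -> exists k : F, v = k%:K by exact: scalar_vec.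
have eZ (v : A) : (del pos1 v : A) = v -> (del pos2 v : A) = 0 -> (del pos3 v : A) = 0 ->
    (del pos4 v : A) = 0 -> exists k : F, v = k%:K * (Xe sg * We) by exact: sigma_line_vec.
have diag1 : ~~ infp pos1 -> forall v : A, (del pos1 (del pos1 v) : A) = 0 -> (del pos1 v : A) = 0.
  by move=> /infpN hp v; exact: del_diagonal0.
have hP p q r s c := @has_primitives_del p q r s c.
have := derivation_decomposition char0 (coD pos1) (coD pos2) (coD pos3) (coD pos4)
  sgE e1E e2E e3E e4E (D pos1) (D pos2) (D pos3) (D pos4)
  (del_comm pos2 pos1) (del_comm pos3 pos1) (del_comm pos4 pos1)
  (del_comm pos3 pos2) (del_comm pos4 pos2) (del_comm pos4 pos3)
  XeD Xe0 (del_Xe pos1) (del_Xe pos2) (del_Xe pos3) (del_Xe pos4) hW sigma1_vec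
  te_mul (erefl : te 0 = 1) (del_te pos1) (del_te pos2) (del_te pos3) (del_te pos4)
  (hP pos1 pos2 pos3 pos4 0 isT isT isT) (hP pos2 pos1 pos3 pos4 0 isT isT isT)
  (hP pos3 pos1 pos2 pos4 1 isT isT isT) (hP pos4 pos1 pos2 pos3 0 isT isT isT)
  (@del_diag pos2) (@del_diag pos4) eZ e0 diag1 wd sd hE'.
move=> [u [k1 [k2 [k3 [k4 [mu [tau [hmu ms h]]]]]]]].
pose kk (p : 'I_4) := if p == pos1 then k1 else if p == pos2 then k2 else if p == pos3 then k3 else k4.
exists u, kk.
exists (gam_fun mu), tau; split; first exact: gam_fun_homZ hmu ms.
move=> a i hd; have ha : a \in Gam by case: hd => /andP[].
have hi : inJ infp i by rewrite inJE; case: hd => /andP[].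
pose g : G := exist (fun a => a \in Gam) a ha.
have /neglE[l el] := h g i ((domE g i).2 hd).
have eT : \sum_p tau p *: dtA p (xm a i)
    = \sum_p (tau p * (i 0 p)%:R)%:K * mon Xe te g (dec i p) :> A.
  apply: eq_bigr => p _; have hp : inJ infp (dec i p) by exact: inJ_dec.
  by rewrite monE // dtA_xm ?KE ?scalerA //; case: hd.
have eH : \sum_p kk p *: dA p (xm a i)
   = k1%:K * ham1 sg (del pos2 : A -> A) Xe We (xm a i)
     + k2%:K * ham2 sg (del pos1 : A -> A) Xe We (xm a i)
     + k3%:K * ham3 (del pos4 : A -> A) We (xm a i)
     + k4%:K * ham4 (del pos3 : A -> A) We (xm a i) :> A.
  by rewrite sum_pos dA1E dA2E dA3E dA4E !KE.
exists l; rewrite -el eT eH monE // brE //.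
rewrite dmuA_xm (gam_fun_val mu g : gam_fun mu a = mu g) (KE (mu g)).
by have -> : val g = a by [].
Qed.

Let sg : G := exist (fun a => a \in Gam) sigma (sigma_gam GamA).
Let esg : val sg = sigma. Proof. by []. Qed.

Let sgE : [/\ co pos1 sg = 1, co pos2 sg = 0, co pos3 sg = 1 & co pos4 sg = 0].
Proof. by rewrite /co /= !sigmaE. Qed.

Lemma brA_jacobi u v w : brA u (brA v w) = brA (brA u v) w + brA v (brA u w).
Proof.
have ex := brE _ _ esg.
have D p := del_derivation p.
by have := br_jacobi sgE (D pos1) (D pos2) (D pos3) (D pos4)
  (del_comm pos2 pos1) (del_comm pos3 pos1) (del_comm pos4 pos1)
  (del_comm pos3 pos2) (del_comm pos4 pos2) (del_comm pos4 pos3)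
  (del_Xe pos1) (del_Xe pos2) (del_Xe pos3) (del_Xe pos4) u v w.
Qed.

Lemma brA_linear_r u : linear (brA u).
Proof.
move=> c v w; rewrite brA_anti brA_linear_l opprD -scalerN.
by rewrite -!(brA_anti u).
Qed.

Lemma brA_exp_mon (a b : G) (v : A4) : brA (xm (val a) 0) ((xm (val b) 0 : A) * (v : A) : A) =
  (xm (val (a + b + sg)) 0 : A) * ((co pos1 a * co pos2 b - co pos2 a * co pos1 b) *: v
      + co pos1 a *: del pos2 v - co pos2 a *: del pos1 v)
  + (xm (val (a + b)) 0 : A) * (((co pos3 a + 1) * co pos4 b - (co pos3 b + 1) * co pos4 a) *: v
      + (co pos3 a + 1) *: del pos4 v - co pos4 a *: del pos3 v).
Proof.
have D p := del_derivation p.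
have := br_exp_mon sg (D pos1) (D pos2) (D pos3) (D pos4) XeD
  (del_Xe pos1) (del_Xe pos2) (del_Xe pos3) (del_Xe pos4) a b v.
by rewrite brE // !KE.
Qed.

Lemma brA_one v : brA (xm 0 0) v = del pos4 v.
Proof.
have D p := del_derivation p.
by have := br1 sg (D pos1) (D pos2) (D pos3) (D pos4) Xe v; rewrite brE.
Qed.

Lemma brA_msigma v : brA (xm (- sigma) 0) v = - del pos2 v.
Proof.
have := br_Xneg (coD pos1) (coD pos2) (coD pos3) (coD pos4) sgE XeD Xe0
  (del_Xe pos1) (del_Xe pos2) (del_Xe pos3) (del_Xe pos4) v.
by rewrite brE // /Xe raddfN.
Qed.

Lemma brA_xm0 (a b : G) : brA (xm (val a) 0) (xm (val b) 0) =
  (co pos1 a * co pos2 b - co pos2 a * co pos1 b) *: xm (val a + val b + sigma) 0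
  + ((co pos3 a + 1) * co pos4 b - (co pos3 b + 1) * co pos4 a) *: xm (val a + val b) 0.
Proof.
have := brX sg XeD (del_Xe pos1) (del_Xe pos2) (del_Xe pos3) (del_Xe pos4) a b.
by rewrite brE // !KE /Xe !raddfD.
Qed.

Lemma brder_brA (d : A -> A) : Brder sg d ->
  forall u v, d (brA u v) = brA (d u) v + brA u (d v).
Proof. by move=> [_ h] u v; have := h u v; rewrite !(brE _ _ esg). Qed.

Lemma dA_linear p : linear (@dA F Gam J p).
Proof.
case: (pos_cases p) => ->; rewrite /dA (tnth_nth id) /=; exact: lin_ext_linear.
Qed.

Lemma dA_brA p u v : dA p (brA u v) = brA (dA p u) v + brA u (dA p v).
Proof.
have D q := del_derivation q.
have hW : [/\ (del pos1 We : A) = 0, (del pos2 We : A) = 0,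
    (del pos3 We : A) = - We & (del pos4 We : A) = 0].
  by split; rewrite /We del_sigma1 sigma1E /= ?oppr0 ?scale0r // scaleN1r.
have X1 := del_Xe pos1; have X2 := del_Xe pos2; have X3 := del_Xe pos3; have X4 := del_Xe pos4.
have D1 := D pos1; have D2 := D pos2; have D3 := D pos3; have D4 := D pos4.
case: (pos_cases p) => ->.
- rewrite !dA1E; apply: (@brder_brA (fun v => Xe sg * We * (del pos2 v : A))).
  by apply: (brder_ham1 sgE D1 D2 D3 D4 _ _ _ X1 X2 X3 X4 hW); exact: del_comm.
- rewrite !dA2E; apply: (@brder_brA (fun v => - (Xe sg * We * (del pos1 v : A)))).
  by apply: (brder_ham2 sgE D1 D2 D3 D4 _ _ _ X1 X2 X3 X4 hW); exact: del_comm.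
- rewrite !dA3E; apply: (@brder_brA (fun v => We * (del pos4 v : A))).
  by apply: (brder_ham3 sgE D1 D2 D3 D4 _ _ _ X4 hW); exact: del_comm.
rewrite !dA4E; apply: (@brder_brA (fun v => - (We * ((v : A) + (del pos3 v : A))))).
by apply: (brder_ham4 sgE D1 D2 D3 D4 _ _ _ X3 hW); exact: del_comm.
Qed.

Lemma dmuA_brA mu u v : homZ Gam mu ->
  dmuA mu (brA u v) = brA (dmuA mu u) v + brA u (dmuA mu v).
Proof. by move=> hmu; apply: brder_brA; exact: weight_brder. Qed.

Lemma dtA_brA p u v : dtA p (brA u v) = brA (dtA p u) v + brA u (dtA p v).
Proof. by apply: brder_brA; exact: dt_brder. Qed.

(** * The derived algebra *)

Local Notation B4 := (@B4 F Gam J).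
Local Notation B := (@B F Gam J).
Local Notation piB := (@piB F Gam J).
Local Notation derived := (@derived F Gam J).
Local Notation brB4 := (@brB4 F Gam J).

Lemma piB_br_derived u v : piB (brA u v) \in derived.
Proof. by rewrite -brB4_pi; apply/asboolP/lspan_sub; exists (piB u), (piB v). Qed.

Lemma piBZ k u : piB (k *: u) = k *: piB u.
Proof. by have := @piB_is_linear F Gam J k u 0; rewrite [piB 0]raddf0 !addr0. Qed.
Lemma piB0 : piB 0 = 0. Proof. exact: raddf0. Qed.

Lemma piB_derivedZ k u : k != 0 -> piB (k *: u) \in derived -> piB u \in derived.
Proof.
by move=> k0; rewrite piBZ => h; rewrite -[piB u]scale1r -(mulVf k0) -scalerA rpredZ.
Qed.

Lemma gam_at p : exists2 g : G, co p g != 0 & forall q, q != p -> co q g = 0.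
Proof.
have [_ hG _ _] := GamA; have [a a0 ha] := hG p.
exists (exist (fun a => a \in Gam) _ ha); first by rewrite /co /= at_posE eqxx.
by move=> q qp; rewrite /co /= at_posE (negbTE qp).
Qed.

Lemma cancel_sigma (V : zmodType) (u v s : V) : u + v + (- u - s) + s = v.
Proof. by rewrite addrACA subrr add0r subrK. Qed.

Lemma valGD (a b : G) : val (a + b) = val a + val b. Proof. exact: raddfD. Qed.
Lemma valGN (a : G) : val (- a) = - val a. Proof. exact: raddfN. Qed.

Lemma coN p (a : G) : co p (- a) = - co p a.
Proof. exact: addfN (coD p) a. Qed.

(** If a_4 or a_2 is nonzero, bracket x^a with 1 or x^(-sigma). Otherwise two
    families of brackets give multiples of x^a, with coefficients (1 - a_1) g_2
    and - (a_3 + 2) g_4, and only sigma2 makes both vanish. *)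
Lemma exp_derived (a : G) : val a <> sigma2 -> piB (xm (val a) 0) \in derived.
Proof.
move=> a2'; have [a4|a4] := eqVneq (co pos4 a) 0; last first.
  by apply: (piB_derivedZ a4); rewrite -del_xm0 -brA_one; exact: piB_br_derived.
have [a2|a2] := eqVneq (co pos2 a) 0; last first.
  apply: (piB_derivedZ a2); rewrite -del_xm0 -[del _ _]opprK -brA_msigma.
  by rewrite raddfN rpredN; exact: piB_br_derived.
have [g2 g20 g2E] := gam_at pos2; have [g4 g40 g4E] := gam_at pos4.
have [a1|a1] := eqVneq (co pos1 a) 1; last first.
  have k0 : (1 - co pos1 a) * co pos2 g2 != 0 by rewrite mulf_neq0 // subr_eq0 eq_sym.
  apply: (piB_derivedZ k0); have := piB_br_derived (xm (val (g2 + a)) 0) (xm (val (- g2 - sg)) 0).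
  rewrite brA_xm0 !coD !coN; case: sgE => -> -> -> ->; rewrite (g2E pos1 isT) (g2E pos3 isT) (g2E pos4 isT) a2 a4.
  have -> : val (g2 + a) + val (- g2 - sg) + sigma = val a.
    by rewrite valGD [val (- g2 - sg)]valGD !valGN cancel_sigma.
  have -> : (0 + co pos1 a) * (- co pos2 g2 - 0) - (co pos2 g2 + 0) * (- 0 - 1)
    = (1 - co pos1 a) * co pos2 g2 by ring.
  have -> : (0 + co pos3 a + 1) * (- 0 - 0) - (- 0 - 1 + 1) * (0 + 0) = 0 :> F by ring.
  by rewrite scale0r addr0.
have k0 : - (co pos3 a + 2%:R) * co pos4 g4 != 0.
  rewrite mulf_neq0 // oppr_eq0 addr_eq0; apply/eqP => a3; apply: a2'.
  apply/rowP=> p; rewrite sigma2E -/(co p a).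
  by case: (pos_cases p) => ->.
apply: (piB_derivedZ k0); have := piB_br_derived (xm (val (g4 + a)) 0) (xm (val (- g4)) 0).
rewrite brA_xm0 !coD !coN (g4E pos1 isT) (g4E pos2 isT) (g4E pos3 isT) a2 a4.
have -> : val (g4 + a) + val (- g4) = val a.
  by rewrite valGD valGN [val g4 + _]addrC addrK.
have -> : (0 + co pos1 a) * - 0 - (0 + 0) * - 0 = 0 :> F by ring.
have -> : (0 + co pos3 a + 1) * - co pos4 g4 - (- 0 + 1) * (co pos4 g4 + 0)
  = - (co pos3 a + 2%:R) * co pos4 g4 by ring.
by rewrite scale0r add0r.
Qed.

Lemma xm0_mul (v : A4) : (xm 0 0 : A) * (v : A) = v.
Proof. by rewrite -[xm 0 0]/(1 : A) mul1r. Qed.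

(** The coefficients of [brA_exp_mon] for the brackets used in [inf_derived]. *)
Lemma descent_pos1 (V : lmodType F) (v v1 : V) (x a : F) : x != 0 ->
  ((- 0 - 1) * x - (- x - 0) * 0) *: v + (- 0 - 1) *: (a *: v) - (- x - 0) *: v1
  = x *: (v1 + - (1 + a / x) *: v).
Proof.
move=> x0; rewrite scalerA -scalerDl -scaleNr scalerDr scalerA addrC.
by congr (_ *: _ + _ *: _); [ring|rewrite mulrN mulrDr mulrC [a / x]mulrC mulrA divff //; ring].
Qed.

Lemma descent_zero (V : lmodType F) (v v4 v3 : V) :
  ((- 0 - 1 + 1) * 0 - (0 + 1) * (- 0 - 0)) *: v + (- 0 - 1 + 1) *: v4 - (- 0 - 0) *: v3 = 0.
Proof.
have e : - 0 - 1 + 1 = 0 :> F by ring.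
by rewrite e !subr0 oppr0 !mulr0 !subr0 !scale0r subr0 addr0.
Qed.

Lemma descent_pos3 (V : lmodType F) (v v3 : V) (x a : F) : x != 0 ->
  ((- 0 + 1) * x - (0 + 1) * - x) *: v + (- 0 + 1) *: (a *: v) - - x *: v3
  = x *: (v3 + (2%:R + a / x) *: v).
Proof.
move=> x0; rewrite scalerA -scalerDl -scaleNr scalerDr scalerA addrC.
by congr (_ *: _ + _ *: _); [ring|rewrite mulrDr [a / x]mulrC mulrA divff //; ring].
Qed.

(** If t_4 or t_2 is present, then d4 or d2 is onto and both are inner. If t_1
    is present and t_2 is not, bracketing with x^(-g-sigma) acts on x^g v as a
    multiple of d1 + c on the eigenvectors v of d2, and d1 + c is onto; t_3 is
    treated in the same way with d4. *)
Lemma inf_derived p : J p = [set: nat] -> forall u, piB u \in derived.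
Proof.
have onto4 : J pos4 = [set: nat] -> forall u, piB u \in derived.
  move=> h4 u; have [_ /(_ h4) /eqP] := prim_total pos4 0 u.
  rewrite scale0r addr0 subr_eq0 => /eqP->; rewrite -brA_one; exact: piB_br_derived.
have onto2 : J pos2 = [set: nat] -> forall u, piB u \in derived.
  move=> h2 u; have [_ /(_ h2) /eqP] := prim_total pos2 0 u.
  rewrite scale0r addr0 subr_eq0 => /eqP->; rewrite -[del _ _]opprK -brA_msigma.
  by rewrite raddfN rpredN; exact: piB_br_derived.
have by_mon : (forall a i, in_idx (a, i) -> piB (xm a i) \in derived) ->
    forall u, piB u \in derived.
  move=> h u; rewrite -(lin_ext_xm_id u) lin_extE raddf_sum; apply: rpred_sum => k _.
  by rewrite /= piBZ; apply: rpredZ; apply: h; case: (k) => -[].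
have fin_eigen q c l a i : J q <> [set: nat] -> q != l -> in_idx (a, i) ->
    del q (prim l c (xm a i)) = a 0 q *: prim l c (xm a i).
  move=> hq ql hi; rewrite prim_comm // del_xm //.
  have -> : i 0 q = 0%N.
    by case/andP: hi => _ /asboolP/(_ q); case: (hJ q) => // ->.
  by rewrite scale0r addr0 linearZe //; exact: lin_ext_linear.
case: (pos_cases p) => -> // hp; apply: by_mon => a i hi.
  have [/onto2//|h2] := EM (J pos2 = [set: nat]).
  have [g g0 gE] := gam_at pos2.
  pose v := prim pos1 (- (1 + a 0 pos2 / co pos2 g)) (xm a i).
  have := prim_total pos1 (- (1 + a 0 pos2 / co pos2 g)) (xm a i).
  rewrite -/v => -[_ /(_ hp) /eqP]; rewrite subr_eq0 => /eqP ev.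
  have v2 : del pos2 v = a 0 pos2 *: v by exact: fin_eigen.
  apply: (piB_derivedZ g0); have := piB_br_derived (xm (val (- g - sg)) 0) ((xm (val g) 0 : A) * (v : A) : A).
  rewrite brA_exp_mon !coD !coN; case: sgE => -> -> -> ->; rewrite (gE pos1 isT) (gE pos3 isT) (gE pos4 isT) v2.
  rewrite descent_pos1 // descent_zero ev mulr0 addr0.
  have -> : val (- g - sg + g + sg) = 0 by rewrite -opprD -addrA addNr.
  by rewrite xm0_mul.
have [/onto4//|h4] := EM (J pos4 = [set: nat]).
have [g g0 gE] := gam_at pos4.
pose v := prim pos3 (2%:R + a 0 pos4 / co pos4 g) (xm a i).
have := prim_total pos3 (2%:R + a 0 pos4 / co pos4 g) (xm a i).
rewrite -/v => -[_ /(_ hp) /eqP]; rewrite subr_eq0 => /eqP ev.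
have v4 : del pos4 v = a 0 pos4 *: v by exact: fin_eigen.
apply: (piB_derivedZ g0); have := piB_br_derived (xm (val (- g)) 0) ((xm (val g) 0 : A) * (v : A) : A).
rewrite brA_exp_mon !coN (gE pos1 isT) (gE pos2 isT) (gE pos3 isT) v4.
rewrite descent_pos3 // ev.
have -> : val (- g + g) = 0 by rewrite addNr.
have -> k : (- 0 * 0 - - 0 * 0) *: v + - 0 *: k - - 0 *: del pos1 v = 0 :> A4.
  by rewrite oppr0 !mul0r subr0 !scale0r subr0 addr0.
by rewrite mulr0 add0r xm0_mul.
Qed.
Lemma exists_infinite : Jprod J <> [set 0] -> exists p, J p = [set: nat].
Proof.
move=> h; have := exists_inf; rewrite (asboolF h) .
by move=> /existsP[p /asboolP hp]; exists p.
Qed.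

Lemma xm_expand u : u = \sum_(k <- msupp u) mcoeff k u *: xm (val k).1 (val k).2.
Proof. by rewrite -[LHS]lin_ext_xm_id lin_extE. Qed.

Lemma cf_sum (I : Type) (r : seq I) (c : I -> F) (v : I -> A4) a i :
  cf (\sum_(k <- r) c k *: v k) a i = \sum_(k <- r) c k * cf (v k) a i.
Proof.
elim: r => [|k r IH]; first by rewrite !big_nil cf0.
by rewrite !big_cons cfD cfZ IH.
Qed.

(** The bracket of x^a and x^b lives in the exponents a + b + sigma and a + b,
    and either structure constant vanishes when its exponent is sigma2. *)
Lemma cf_brA_sigma2 u v : Jprod J = [set 0] -> cf (brA u v) sigma2 0 = 0.
Proof.
move=> j0; have jz a i : in_idx (a, i) -> i = 0.
  by rewrite in_idxE j0 => /andP[_ /asboolP].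
pose z (_ : A4) : F^o := 0.
have zl : linear z by move=> k a b; rewrite /z scaler0 addr0.
apply: (@xm_ext _ _ _ _ (fun u => cf (brA u v) sigma2 0 : F^o) z) u => [||a i ha] //.
  by move=> k a b; rewrite (@brA_linear_l F Gam J v) cfD cfZ.
apply: (@xm_ext _ _ _ _ (fun v => cf (brA (xm a i) v) sigma2 0 : F^o) z) v => [||b j hb] //.
  by move=> k c d; rewrite brA_linear_r cfD cfZ.
rewrite (jz _ _ ha) (jz _ _ hb).
have [ga gb] : a \in Gam /\ b \in Gam by split; [case/andP: ha|case/andP: hb].
pose a' : G := exist _ a ga; pose b' : G := exist _ b gb.
rewrite -[a]/(val a') -[b]/(val b') brA_xm0 cfD !cfZ !cf_xm /z.
have E (c : 'rV[F]_4) p : ((c, 0 : 'rV[nat]_4) == (sigma2, 0)) -> c 0 p = sigma2 0 p.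
  by case/eqP => ->.
have coE p : co p a' + co p b' = (a + b) 0 p by rewrite mxE.
have cosE p : (co p a' + co p b') + sigma 0 p = (a + b + sigma) 0 p by rewrite coE [RHS]mxE.
have sum0 (x y : F) : x = 0 -> y = 0 -> x + y = 0 by move=> -> ->; rewrite addr0.
have mul0 (x y : F) : x = 0 -> x * y = 0 by move=> ->; rewrite mul0r.
apply: sum0; (case: eqP => [/(introT eqP) h|_]; last by rewrite mulr0); apply: mul0.
  have := cosE pos1; have := cosE pos2; rewrite !(E _ _ h).
  rewrite !sigma2E !sigmaE /= addr0 => h2 h1.
  have -> : co pos2 b' = - co pos2 a' by apply/eqP; rewrite -addr_eq0 addrC h2.
  have -> : co pos1 b' = - co pos1 a'.
    by apply/eqP; rewrite -addr_eq0 addrC -(inj_eq (addIr 1)) h1 add0r.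
  ring.
have := coE pos3; have := coE pos4; rewrite !(E _ _ h) !sigma2E /= => h4 h3.
have -> : co pos4 b' = - co pos4 a' by apply/eqP; rewrite -addr_eq0 addrC h4.
have -> : co pos3 b' = - 2%:R - co pos3 a' by rewrite -h3 [co pos3 a' + _]addrC addrK.
ring.
Qed.

Lemma piB_derived u : (Jprod J = [set 0] -> cf u sigma2 0 = 0) -> piB u \in derived.
Proof.
have [j0 h|/exists_infinite[p hp] _] := pselect (Jprod J = [set 0]); last exact: inf_derived hp u.
rewrite (xm_expand u) raddf_sum; apply: rpred_sum => k _; rewrite /= piBZ.
case: k => -[a i] hk /=; have hi : i = 0.
  by move: hk; rewrite in_idxE j0 => /andP[_ /asboolP].
have [e|ne] := eqVneq a sigma2.
  suff -> : mcoeff (exist _ (a, i) hk : idx Gam J) u = 0 by rewrite scale0r rpred0.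
  move: (h j0); rewrite /cf -e -hi insubT; exact.
apply: rpredZ; have ga : a \in Gam by case/andP: hk.
rewrite hi; apply: (exp_derived (a := exist _ a ga)); exact/eqP.
Qed.

Lemma derivedE w : w \in derived -> exists n (c : 'I_n -> F) (x : 'I_n -> A4 * A4),
  w = piB (\sum_i c i *: brA (x i).1 (x i).2).
Proof.
move=> /asboolP[n [c [z [hz ->]]]].
have /choice[x hx] : forall i, exists x : A4 * A4, z i = piB (brA x.1 x.2).
  move=> i; have [u [v ->]] := hz i; exists (repr u, repr v).
  by rewrite -brB4_pi !piB_repr.
exists n, c, x; rewrite raddf_sum; apply: eq_bigr => i _.
by rewrite hx /= piBZ.
Qed.

Lemma derived_cf w : w \in derived -> Jprod J = [set 0] -> cf (repr w) sigma2 0 = 0.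
Proof.
move=> /derivedE[n [c [x wE]]] j0.
have /piB_eq[d] : piB (repr w) = piB (\sum_i c i *: brA (x i).1 (x i).2).
  by rewrite piB_repr.
move/(canRL (subrK _)) => ->.
rewrite cfD cfZ cf_xm cf_sum big1 => [|i _]; last by rewrite cf_brA_sigma2 ?mulr0.
rewrite [_ == _](_ : _ = false) ?mulr0 ?addr0 //.
apply/eqP => -[/rowP/(_ pos1)]; rewrite sigma2E sigma1E /= oppr0 => /eqP.
by rewrite eq_sym oner_eq0.
Qed.

(** * Derivations induced by linear maps of A4 *)

Local Notation brB := (@brB F Gam J).
Local Notation Der := (Der Gam J).
Local Notation induced := (@induced F Gam J).
Local Notation descend := (@descend F Gam J).

(** Such a T preserves the derived algebra, so that [induced T] does not take
    its default value. *)
Definition induces (T : A4 -> A4) : Prop :=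
  [/\ linear T, exists c : F, T (xm sigma1 0) = c *: xm sigma1 0
    & forall u v, T (brA u v) = brA (T u) v + brA u (T v)].

Lemma descendE T u : induces T -> descend T (piB u) = piB (T u).
Proof.
move=> [lT Ts _].
pose T' : {linear A4 -> A4} := HB.pack T (GRing.isLinear.Build F A4 A4 *:%R T lT).
exact: (@descend_pi _ _ _ T').
Qed.

Lemma descend_derived T w : induces T -> w \in derived -> descend T w \in derived.
Proof.
move=> hT /derivedE[n [c [x ->]]]; rewrite descendE //; have [lT _ hbr] := hT.
rewrite linear_sum // raddf_sum; apply: rpred_sum => i _.
rewrite /= piBZ; apply: rpredZ.
by rewrite hbr piBD; apply: rpredD; exact: piB_br_derived.
Qed.

Lemma val_induced T v : induces T -> val (induced T v) = piB (T (repr (val v))).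
Proof. by move=> hT; rewrite insubdK //; apply: descend_derived => //; exact: (valP v). Qed.

Lemma valBD (u v : B) : val (u + v) = val u + val v.
Proof. exact: (raddfD (val : B -> B4)). Qed.
Lemma valBN (u : B) : val (- u) = - val u.
Proof. exact: (raddfN (val : B -> B4)). Qed.
Lemma valBZ k (u : B) : val (k *: u) = k *: val u.
Proof. by rewrite linearZ. Qed.

(** The common form of the inner derivations, of dbar2 and of the derivations
    induced from A4. *)
Lemma Der_of T (D : B -> B) : induces T ->
  (forall v, val (D v) = piB (T (repr (val v)))) -> Der D.
Proof.
move=> hT hD; have [lT _ hbr] := hT.
have hD' v u : val v = piB u -> val (D v) = piB (T u).
  by move=> e; rewrite hD -(descendE _ hT) piB_repr e descendE.
split=> [k u v|u v]; apply: val_inj.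
  rewrite (hD' _ (k *: repr (val u) + repr (val v))).
    by rewrite lT piBD piBZ [RHS]valBD valBZ !hD.
  by rewrite piBD piBZ !piB_repr valBD valBZ.
rewrite (hD' _ (brA (repr (val u)) (repr (val v)))) // hbr piBD [RHS]valBD.
by rewrite -!brB4_pi -!hD !piB_repr.
Qed.

Lemma induces_brA u : induces (brA u).
Proof.
split; [exact: brA_linear_r| |exact: brA_jacobi].
by exists 0; rewrite brA_anti brA_sigma1 oppr0 scale0r.
Qed.

Lemma induces_dmu mu : homZ Gam mu -> induces (dmuA mu).
Proof.
move=> hmu; split; [exact: dmuA_linear| |by move=> u v; exact: dmuA_brA].
by exists (mu sigma1); exact: dmuA_sigma1.
Qed.

Lemma induces_dt p : induces (dtA p).
Proof.
split; [exact: dtA_linear| |exact: dtA_brA].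
by exists 0; rewrite dtA_sigma1 scale0r.
Qed.

Lemma induces_dA p : induces (@dA F Gam J p).
Proof.
split; [exact: dA_linear| |exact: dA_brA].
by exists 0; rewrite dA_sigma1 scale0r.
Qed.

Lemma Der0 : Der 0.
Proof.
apply: (@Der_of (fun=> 0)) => [|v]; last by rewrite piB0.
have l0 : linear (fun _ : A4 => 0 : A4) by move=> k u v; rewrite scaler0 addr0.
split=> //; first by exists 0; rewrite scale0r.
move=> u v; rewrite (linear0e (@brA_linear_r u)) addr0.
by rewrite brA_anti (linear0e (@brA_linear_r v)) oppr0.
Qed.

Lemma generators_Der : generators Gam J `<=` Der.
Proof.
move=> D [[[[[u _ <-]|[mu hmu <-]]|[p _ <-]]|[p _ <-]]|->].
- by apply: (@Der_of (brA (repr (val u)))) => [|v //]; exact: induces_brA.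
- by apply: (@Der_of (dmuA mu)) => [|v]; [|apply: val_induced]; exact: induces_dmu.
- by apply: (@Der_of (dtA p)) => [|v]; [|apply: val_induced]; exact: induces_dt.
- rewrite /dd; case: asboolP => _; last exact: Der0.
  by apply: (@Der_of (@dA F Gam J p)) => [|v]; [|apply: val_induced]; exact: induces_dA.
rewrite /dbar2; case: asboolP => _; last exact: Der0.
apply: (@Der_of (brA (xm sigma2 0))) => [|v]; first exact: induces_brA.
by rewrite /= -[X in brB4 _ X]piB_repr brB4_pi.
Qed.

Lemma brB_linear_r u : linear (brB u).
Proof.
have h : Der (adB u) by apply: generators_Der; do 4!left; exists u.
by case: h.
Qed.

Lemma brB_linear_l v : linear (brB^~ v).
Proof.
have anti x y : brB x y = - brB y x.
  by apply: val_inj; rewrite valBN /= /Defs.brB4 brA_anti; exact: raddfN.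
by move=> k x y; rewrite anti brB_linear_r opprD -scalerN -!(anti _ v).
Qed.

Lemma lspan_Der : lspan (generators Gam J) `<=` Der.
Proof.
move=> D [n [c [w [hw ->]]]].
have wD i : Der (w i) by apply: generators_Der.
have sE (v : B) : (\sum_i c i *: w i) v = \sum_i c i *: w i v.
  by rewrite fct_sumE.
split=> [k u v|u v]; rewrite !sE.
  rewrite scaler_sumr -big_split; apply: eq_bigr => i _ /=.
  by have [-> _] := wD i; rewrite scalerDr !scalerA mulrC.
rewrite (linear_sum _ _ _ (@brB_linear_l v)) (linear_sum _ _ _ (@brB_linear_r u)).
rewrite -big_split; apply: eq_bigr => i _ /=.
by have [_ ->] := wD i; rewrite scalerDr.
Qed.

Lemma br_inner (R : comPzRingType) (s u W v v1 v2 v3 v4 : R) :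
  [/\ s * W * v2 = s * (W * v2 - v1 * 0) + (u - u) * v4 - (v + v3) * 0,
      - (s * W * v1) = s * (0 * v2 - v1 * W) + (u - u) * v4 - (v + v3) * 0,
      W * v4 = s * (0 * v2 - v1 * 0) + (u + (- u + W)) * v4 - (v + v3) * 0
    & - (W * (v + v3)) = s * (0 * v2 - v1 * 0) + (u - u) * v4 - (v + v3) * W].
Proof. by split; ring. Qed.

(** When t_p is present, the element W t_p exists, and this is why dA_p gives a
    new derivation only in its absence. *)
Lemma dA_inner p v : J p = [set: nat] -> sigma1 \in Gam ->
  dA p v = brA (xm sigma1 (unit4 p)) v.
Proof.
move=> hp hs1; pose u : A := xm sigma1 (unit4 p).
have hu : in_idx (sigma1, unit4 p).
  rewrite in_idxE hs1; apply/asboolP => q; rewrite mxE.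
  by have [->|_] := eqVneq q p; [rewrite hp|case: (hJ q) => ->].
have du q : (del q u : A) = - (q == pos3)%:R *: u + (q == p)%:R *: We.
  rewrite /u del_xm // sigma1E mxE; congr (_ + _).
  have [->|_] := eqVneq q p; last by rewrite !scale0r.
  congr (_ *: xm _ _); apply/rowP => r; rewrite !mxE.
  by case: (_ == _).
rewrite -/u -(brE _ _ esg) /br !du; clearbody u.
have [i1 i2 i3 i4] := br_inner (Xe sg) u We (v : A) (del pos1 v : A) (del pos2 v : A)
  (del pos3 v : A) (del pos4 v : A).
have simp := (oppr0, @scale0r, @scale1r, add0r, addr0, @scaleN1r).
case: (pos_cases p) => ->; rewrite ?eqxx /= !simp.
- by rewrite dA1E.
- by rewrite dA2E.
- by rewrite dA3E.
by rewrite dA4E.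
Qed.

(** * Lifting a derivation to A4 *)

Local Notation gens := (generators Gam J).

(** By [piB_derived] and [derived_cf], the condition for the class of u to be in
    B. *)
Definition repr_in_B (u : A4) := Jprod J = [set 0] -> cf u sigma2 0 = 0.
Definition toB (u : A4) : B := insubd (0 : B) (piB u).

Lemma val_toB u : repr_in_B u -> val (toB u) = piB u.
Proof. by move=> h; rewrite insubdK //; exact: piB_derived. Qed.

Lemma dom_repr_in_B a i : dom4 a i -> repr_in_B (xm a i).
Proof.
move=> [hi h] j0; rewrite cf_xm; have := h j0.
by case: eqP => // -[-> _].
Qed.

Lemma repr_toB (v : B) : repr_in_B (repr (val v)) /\ toB (repr (val v)) = v.
Proof.
have h : repr_in_B (repr (val v)) by move=> j0; exact: derived_cf (valP v) j0.
by split=> //; apply: val_inj; rewrite val_toB // piB_repr.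
Qed.

Lemma msupp_dom u (k : idx Gam J) : repr_in_B u -> k \in msupp u -> dom4 (val k).1 (val k).2.
Proof.
move=> h hk; split; first by case: k {hk} => -[].
move=> j0 e; have := h j0; case: k hk e => -[a i] hk hs /= e.
have hi : i = 0 by have := hk; rewrite in_idxE j0 => /andP[_ /asboolP].
rewrite /cf -e -hi insubT => h0; move: hs; rewrite -mcoeff_neq0.
by rewrite h0 eqxx.
Qed.

Lemma linear_ext_in_B (V : lmodType F) (f g : A4 -> V) : linear f -> linear g ->
  (forall a i, dom4 a i -> f (xm a i) = g (xm a i)) -> forall u, repr_in_B u -> f u = g u.
Proof.
move=> lf lg fg u hu; rewrite (xm_expand u) !linear_sum //.
by apply: eq_big_seq => k hk; rewrite fg //; exact: msupp_dom hk.
Qed.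

Lemma val_linear : linear (val : B -> B4).
Proof. by move=> k u v; rewrite valBD valBZ. Qed.

Section OneDerivation.
Variables (D : B -> B) (hD : Der D).

(** Where the monomial is not in B, which can only be x^sigma2, the value 0 is
    arbitrary. *)
Definition lift_of : A4 -> A4 := lin_ext (fun a i =>
  if `[< dom4 a i >] then repr (val (D (toB (xm a i)))) else 0).

Lemma lift_linear : linear lift_of. Proof. exact: lin_ext_linear. Qed.

Lemma lift_dom a i : dom4 a i -> piB (lift_of (xm a i)) = val (D (toB (xm a i))).
Proof.
by move=> h; rewrite /lift_of lin_ext_xm (proj1 h) asboolT // piB_repr.
Qed.

Lemma lift_class u : repr_in_B u -> piB (lift_of u) = val (D (toB u)).
Proof.
have [lD _] := hD; move=> hu.
have e : toB u = \sum_(k <- msupp u) mcoeff k u *: toB (xm (val k).1 (val k).2).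
  apply: val_inj; rewrite val_toB // (linear_sum _ _ _ val_linear) {1}(xm_expand u).
  rewrite (linear_sum _ _ _ (@piB_is_linear F Gam J)).
  apply: eq_big_seq => k hk; rewrite val_toB //.
  by apply: dom_repr_in_B; exact: msupp_dom hk.
rewrite e (linear_sum _ _ _ lD) (linear_sum _ _ _ val_linear) {1}(xm_expand u).
rewrite (linear_sum _ _ _ lift_linear) (linear_sum _ _ _ (@piB_is_linear F Gam J)).
by apply: eq_big_seq => k hk; rewrite lift_dom //; exact: msupp_dom hk.
Qed.

Lemma lift_br a i b j : dom4 a i -> dom4 b j -> exists k : F,
  lift_of (brA (xm a i) (xm b j)) - (brA (lift_of (xm a i)) (xm b j) + brA (xm a i) (lift_of (xm b j)))
  = k *: xm sigma1 0.
Proof.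
move=> ha hb; apply/piB_eq; have [_ brD] := hD.
rewrite lift_class; last by move=> j0; exact: cf_brA_sigma2.
have -> : toB (brA (xm a i) (xm b j)) = brB (toB (xm a i)) (toB (xm b j)).
  apply: val_inj; rewrite val_toB; last by move=> j0; exact: cf_brA_sigma2.
  by rewrite /= !val_toB ?brB4_pi //; exact: dom_repr_in_B.
rewrite brD valBD /= -!lift_dom // !val_toB ?brB4_pi ?piBD //; exact: dom_repr_in_B.
Qed.
End OneDerivation.

(** Bracketing with u is a derivation of B even if u is not in B. Then u is a
    multiple of x^sigma2 plus an element of B, and x^sigma2 gives dbar2. *)
Lemma span_ad u : exists2 D : B -> B, lspan gens D &
  forall v, val (D v) = piB (brA u (repr (val v))).
Proof.
have inner w : repr_in_B w -> lspan gens (adB (toB w)) /\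
    forall v, val (adB (toB w) v) = piB (brA w (repr (val v))).
  move=> hw; split; first by apply: lspan_sub; do 4!left; exists (toB w).
  by move=> v; rewrite -brB4_pi piB_repr -val_toB.
have [[j0 hs]|hn] := pselect (Jprod J = [set 0] /\ sigma2 \in Gam); last first.
  have [|h1 h2] := inner u; last by exists (adB (toB u)).
  move=> j0; apply: cf_out; rewrite in_idxE negb_and.
  by apply/orP; left; apply/negP => hs; apply: hn.
pose c := cf u sigma2 0.
have hw : repr_in_B (u - c *: xm sigma2 0).
  move=> _; rewrite cfB cfZ cf_xm eqxx in_idxE hs.
  have -> : `[< Jprod J 0 >] by apply/asboolP/(Jprod0 hJ).
  by rewrite mulr1 subrr.
have [h1 h2] := inner _ hw.
exists (adB (toB (u - c *: xm sigma2 0)) + c *: @dbar2 F Gam J) => [|v].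
  by apply: lspanD => //; apply/lspanZ/lspan_sub; right.
rewrite [X in val X](_ : _ = adB (toB (u - c *: xm sigma2 0)) v + c *: @dbar2 F Gam J v) //.
rewrite valBD valBZ h2 /dbar2 asboolT //=.
rewrite -[X in brB4 _ X]piB_repr brB4_pi -piBZ -piBD.
by rewrite addrC -(@brA_linear_l F Gam J) addrC subrK.
Qed.

Lemma span_dA p : exists2 D : B -> B, lspan gens D &
  forall v, val (D v) = piB (dA p (repr (val v))).
Proof.
have [hs|hs] := boolP (sigma1 \in Gam); last first.
  exists 0 => [|v]; first exact: lspan0.
  have W0 : We = 0 by rewrite /We xm_out // in_idxE (negbTE hs).
  suff -> : dA p (repr (val v)) = 0 by rewrite piB0; exact: (raddf0 (val : B -> B4)).
  case: (pos_cases p) => ->; rewrite ?dA1E ?dA2E ?dA3E ?dA4E W0 ?mulr0 ?mul0r ?oppr0 //.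
have [hp|hp] := hJ p; last first.
  have [D h1 h2] := span_ad (xm sigma1 (unit4 p)).
  by exists D => // v; rewrite h2 -dA_inner.
exists (@dd F Gam J p) => [|v]; first by apply: lspan_sub; left; right; exists p.
by rewrite /dd asboolT // val_induced //; exact: induces_dA.
Qed.

Lemma Der_lspan : Der `<=` lspan gens.
Proof.
move=> D hD.
have [u [k [mu [tau [hmu h]]]]] := concrete_decomposition (@lift_linear D) (lift_br hD).
have [D1 h1 e1] := span_ad u.
have /choice[D2 hD2] : forall p, exists E : B -> B, lspan gens E /\
    forall v, val (E v) = piB (dA p (repr (val v))).
  by move=> p; have [E ? ?] := span_dA p; exists E.
pose T (v : A4) := brA u v + \sum_p k p *: dA p v + dmuA mu v + \sum_p tau p *: dtA p v.
have lsum (c : 'I_4 -> F) (d : 'I_4 -> A4 -> A4) : (forall p, linear (d p)) ->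
    linear (fun v => \sum_p c p *: d p v).
  move=> ld x v w; rewrite scaler_sumr -big_split; apply: eq_bigr => p _ /=.
  by rewrite ld scalerDr !scalerA mulrC.
have ladd (d d' : A4 -> A4) : linear d -> linear d' -> linear (fun v => d v + d' v).
  by move=> ld ld' x v w; rewrite ld ld' scalerDr addrACA.
have lT : linear T.
  apply: (ladd _ _ (ladd _ _ (ladd _ _ _ _) _) _).
  - exact: brA_linear_r.
  - by apply: lsum => p; exact: dA_linear.
  - exact: dmuA_linear.
  by apply: lsum => p; exact: dtA_linear.
have eT v : val (D v) = piB (T (repr (val v))).
  have [hv ev] := repr_toB v; rewrite -{1}ev -lift_class //.
  apply: (@linear_ext_in_B _ (piB \o lift_of D) (piB \o T)) hv.
  - by apply: linear_comp; [exact: lift_linear|exact: piB_is_linear].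
  - by apply: linear_comp => //; exact: piB_is_linear.
  by move=> a i /h hl; apply/piB_eq.
pose D' := D1 + \sum_p k p *: D2 p + @dmu F Gam J mu + \sum_p tau p *: @dt F Gam J p.
have -> : D = D'.
  apply/funext => v; apply: val_inj; rewrite eT /T 3!piBD.
  have -> : D' v = D1 v + \sum_p k p *: D2 p v + @dmu F Gam J mu v
      + \sum_p tau p *: @dt F Gam J p v by rewrite /D' /= !fct_sumE.
  rewrite !valBD !(linear_sum _ _ _ val_linear) !(linear_sum _ _ _ (@piB_is_linear F Gam J)) e1.
  rewrite (val_induced _ (induces_dmu hmu)).
  congr (_ + _ + _ + _); apply: eq_bigr => p _; first by rewrite (hD2 p).2.
  by rewrite (val_induced _ (induces_dt p)).
apply: lspanD; first apply: lspanD; first apply: lspanD => //.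
- by apply: lspan_sum => p; apply: lspanZ; case: (hD2 p).
- by apply: lspan_sub; do 3!left; right; exists mu.
by apply: lspan_sum => p; apply/lspanZ/lspan_sub; left; left; right; exists p.
Qed.
End Concrete.

Theorem theorem2p1 (F : closedFieldType) (char0 : [pchar F] =i pred0)
    (Gam : zmodClosed 'rV[F]_4) (GamA : condA Gam)
    (J : 'I_4 -> set nat)
    (hJ : forall p, J p = [set 0%N] \/ J p = [set: nat]) :
  Der Gam J = lspan (generators Gam J).
Proof.
apply/seteqP; split; [exact: Der_lspan|exact: lspan_Der].
Qed.
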